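(* For every $h_0>0$ and $\alpha_0>0$ there is a constant $C>0$, independent of $h$ and $\alpha$, such that for all $0<\alpha\le\alpha_0$ and $0<h\le h_0$ the following holds. If $(y,u,z)$ is the optimal solution of the continuous problem $(\widetilde{\mathrm P})$ and $(y_h,u_h,z_h)$ is the optimal solution of the discretized problem $(\widetilde{\mathrm{DP}}_h)$ (both problems with parameter $\alpha$, both described in the context), then $$\|u-u_h\|_{L^2(\Omega)}\le C\left(\alpha^{-1}h+\alpha^{-3/2}h^2\right).$$
   Context: **Continuous problem.** Let $n\in\{2,3\}$ and let $\Omega\subset\mathbb R^n$ be a convex, open, bounded domain with $C^{1,1}$ or polygonal (polyhedral) boundary. Let $y_c,y_d\in L^2(\Omega)$, $\alpha,\beta>0$, and $-\infty<a<0<b<+\infty$. Let $A$ be the operator $(Ay)(x)=-\sum_{i,j=1}^n\partial_{x_j}(a_{ij}(x)y_{x_i})+c_0(x)y(x)$, where $a_{ij},c_0\in L^\infty(\Omega)$, $c_0\ge0$, $a_{ij}=a_{ji}$, and, for some $\theta>0$, $\sum_{i,j}a_{ij}(x)\xi_i\xi_j\ge\theta\|\xi\|^2$ for almost all $x\in\Omega$ and all $\xi\in\mathbb R^n$. For $f\in L^2(\Omega)$ let $\mathcal S f\in H^1_0(\Omega)$ be the unique weak solution $y$ of $Ay=f$ in $\Omega$, $y=0$ on $\partial\Omega$. Let $U_{ad}=\{v\in L^2(\Omega): a\le v\le b\text{ a.e. in }\Omega\}$. Problem $(\widetilde{\mathrm P})$ is: minimize $$\tfrac12\|y-y_d\|_{L^2(\Omega)}^2+\tfrac\alpha4\|u\|_{L^2(\Omega)}^2+\tfrac\alpha4\|z\|_{L^2(\Omega)}^2+\beta\|z\|_{L^1(\Omega)}$$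 over $(y,u,z)\in H_0^1(\Omega)\times L^2(\Omega)\times L^2(\Omega)$ subject to $y=\mathcal S(u+y_c)$, $u=z$, $z\in U_{ad}$. It has a unique solution. **Meshes.** $\{\mathcal T_h\}_{h>0}$ is a family of regular, quasi-uniform triangulations. With $\rho_T$ the diameter of a cell $T$, $\sigma_T$ the diameter of the largest ball contained in $T$, and $h=\max_{T\in\mathcal T_h}\rho_T$, there are constants $\kappa,\tau>0$ such that $\rho_T/\sigma_T\le\kappa$ and $h/\rho_T\le\tau$ for all $T\in\mathcal T_h$ and all $h$. Let $\bar\Omega_h=\bigcup_{T\in\mathcal T_h}T$, and let $\Omega_h\subset\Omega$ be its interior. If $\Omega$ is a polyhedral domain, $\Omega_h=\Omega$. If $\Omega$ has a $C^{1,1}$ boundary, $\bar\Omega_h$ is convex, all boundary vertices of $\bar\Omega_h$ lie on $\partial\Omega$, and $|\Omega\setminus\Omega_h|\le c\,h^2$ with a constant $c$ independent of $h$. **Discrete spaces.** $Y_h=U_h$ is the space of functions in $C(\bar\Omega)$ that are affine on each $T\in\mathcal T_h$ and vanish on $\bar\Omega\setminus\Omega_h$. Let $\phi_1,\dots,\phi_{N_h}$ be the nodal (hat) basis of this space, so that $z_h=\sum_i z_i\phi_i$ with $z_i=z_h(x_i)$. Set $U_{ad,h}=U_h\cap U_{ad}=\{\sum_i z_i\phi_i: a\le z_i\le b\ \forall i\}$. For $f\in L^2(\Omega)$, $\mathcal S_hf\in Y_h$ is the unique $y_h\in Y_h$ with $$\int_{\Omega_h}\Big(\sum_{i,j}a_{ij}(y_h)_{x_i}(v_h)_{x_j}+c_0y_hv_h\Big)dx=\int_{\Omega_h}f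 v_h\,dx\quad\forall v_h\in Y_h .$$ The setting is assumed to be such that the standard finite element estimate holds: there is $c_1>0$ independent of $h,u,y_c$ with $\|y-y_h\|_{L^2(\Omega)}+h\|\nabla y-\nabla y_h\|_{L^2(\Omega)}\le c_1h^2(\|u\|_{L^2(\Omega)}+\|y_c\|_{L^2(\Omega)})$ for $y=\mathcal S(u+y_c)$, $y_h=\mathcal S_h(u+y_c)$; in particular $\|\mathcal S-\mathcal S_h\|_{L^2\to L^2}\le c_1h^2$ and $\|\mathcal S-\mathcal S_h\|_{L^2\to H^1}\le c_1h$. **Discretized problem.** For $z_h=\sum_iz_i\phi_i\in U_h$ define $$\|z_h\|_{L^2_h(\Omega_h)}=\Big(\sum_{i=1}^{N_h}z_i^2\int_{\Omega_h}\phi_i\,dx\Big)^{1/2},\qquad \|z_h\|_{L^1_h(\Omega_h)}=\sum_{i=1}^{N_h}|z_i|\int_{\Omega_h}\phi_i\,dx .$$ Problem $(\widetilde{\mathrm{DP}}_h)$ is: minimize $$\tfrac12\|y_h-y_d\|_{L^2(\Omega_h)}^2+\tfrac\alpha4\|u_h\|_{L^2(\Omega_h)}^2+\tfrac\alpha4\|z_h\|_{L^2_h(\Omega_h)}^2+\beta\|z_h\|_{L^1_h(\Omega_h)}$$ over $(y_h,u_h,z_h)\in Y_h\times U_h\times U_h$ subject to $y_h=\mathcal S_h(u_h+y_c)$, $u_h=z_h$, $z_h\in U_{ad,h}$. It has a unique solution. The constant $C$ may depend on the fixed data ($\Omega$, $A$, $y_c$, $y_d$, $a$, $b$, $\beta$,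 $\alpha_0$, $h_0$, the mesh-family constants), but not on $h$ or $\alpha$. *)

(* Defs.v *)
From HB Require Import structures.
From mathcomp Require Import all_boot all_order all_algebra.
From mathcomp Require Import all_classical all_reals all_analysis.
Import Order.TTheory GRing.Theory Num.Theory.
Import numFieldNormedType.Exports.
Set Implicit Arguments.
Unset Strict Implicit.
Unset Printing Implicit Defensive.
Local Open Scope classical_set_scope.
Local Open Scope ring_scope.

(* 'rV[R]_n carries the product sigma-algebra, which is also its Borel one. *)
Section rV_measurable.
Context (R : realType) (n : nat).

Let coord (i : 'I_n) (x : 'rV[R]_n) : R := x ord0 i.

Let rV_set0 : g_sigma_preimage coord set0.
Proof. exact: sigma_algebra0. Qed.

Let rV_setC A : g_sigma_preimage coord A -> g_sigma_preimage coord (~` A).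
Proof. exact: sigma_algebraC. Qed.

Let rV_bigcup (F : (set 'rV[R]_n)^nat) :
  (forall i, g_sigma_preimage coord (F i)) ->
  g_sigma_preimage coord (\bigcup_i (F i)).
Proof. exact: sigma_algebra_bigcup. Qed.

HB.instance Definition _ := @isMeasurable.Build default_measure_display
  'rV[R]_n (g_sigma_preimage coord) rV_set0 rV_setC rV_bigcup.

End rV_measurable.

Lemma measurable_rV_coord (R : realType) (n : nat) (i : 'I_n) :
  measurable_fun [set: 'rV[R]_n] (fun x : 'rV[R]_n => x ord0 i).
Proof.
move=> _ Y mY; rewrite setTI; apply: sub_sigma_algebra => /=.
rewrite -bigcup_seq/=; exists i => /=; first by rewrite mem_index_enum.
by exists Y => //; rewrite setTI.
Qed.

Lemma measurable_fun_rV (R : realType) (n : nat) d (T : measurableType d)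
    (f : T -> 'rV[R]_n) :
  (forall i, measurable_fun [set: T] (fun t => f t ord0 i)) ->
  measurable_fun [set: T] f.
Proof.
move=> mf _ Y mY; rewrite setTI.
have : g_sigma_preimage (fun i : 'I_n => (fun x : 'rV[R]_n => x ord0 i) \o f)
    (f @^-1` Y).
  rewrite g_sigma_preimage_comp.
  by exists Y => //; rewrite setTI.
apply: smallest_sub; first exact: sigma_algebra_measurable.
rewrite -bigcup_seq => A [i _ [B mB <-]].
exact: mf.
Qed.

Definition rV_cons (R : realType) (n : nat) (p : measurableTypeR R * 'rV[R]_n) :
  'rV[R]_n.+1 := row_mx (p.1%:M : 'rV[R]_1) p.2.

Lemma rV_cons0 (R : realType) (n : nat) (p : measurableTypeR R * 'rV[R]_n) :
  rV_cons p ord0 ord0 = p.1.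
Proof.
rewrite /rV_cons mxE; case: splitP => [j _|j /=]; last by [].
by rewrite mxE !ord1.
Qed.

Lemma rV_consS (R : realType) (n : nat) (p : measurableTypeR R * 'rV[R]_n) j :
  rV_cons p ord0 (lift ord0 j) = p.2 ord0 j.
Proof.
rewrite /rV_cons mxE; case: splitP => [[[|//] ?] //|k /= jk].
by congr (p.2 _ _); apply/val_inj; case: jk.
Qed.

Definition rV_uncons (R : realType) (n : nat) (x : 'rV[R]_n.+1) :
  measurableTypeR R * 'rV[R]_n := (x ord0 ord0, \row_j x ord0 (lift ord0 j)).

Lemma rV_consK (R : realType) (n : nat) :
  cancel (@rV_cons R n) (@rV_uncons R n).
Proof.
move=> [t x]; rewrite /rV_uncons rV_cons0; congr pair.
by apply/rowP => j; rewrite mxE rV_consS.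
Qed.

Lemma measurable_rV_cons (R : realType) (n : nat) :
  measurable_fun setT (@rV_cons R n).
Proof.
apply: measurable_fun_rV => i; case: (unliftP ord0 i) => [j|] ->.
  under eq_fun do rewrite rV_consS.
  apply: (measurableT_comp (@measurable_rV_coord R n j)).
  exact: measurable_snd.
under eq_fun do rewrite rV_cons0.
exact: measurable_fst.
Qed.

Lemma measurable_rV_uncons (R : realType) (n : nat) :
  measurable_fun setT (@rV_uncons R n).
Proof.
apply: measurable_fun_pair; first exact: measurable_rV_coord.
apply: measurable_fun_rV => i.
under eq_fun do rewrite mxE.
exact: measurable_rV_coord.
Qed.

HB.instance Definition _ (R : realType) (n : nat) :=
  isMeasurableFun.Build _ _ _ _ (@rV_cons R n) (@measurable_rV_cons R n).

(* The library's sigma-finiteness instance for m1 \x m2 is not inferred, being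
   overridden by the one for subprobabilities. *)
Lemma product_sigma_finite d1 d2 (T1 : measurableType d1)
    (T2 : measurableType d2) (R : realType)
    (m1 : {sigma_finite_measure set T1 -> \bar R})
    (m2 : {sigma_finite_measure set T2 -> \bar R}) :
  sigma_finite setT (m1 \x m2)%E.
Proof.
have /sigma_finiteP[F [TF ndF Foo]] := sigma_finiteT m1.
have /sigma_finiteP[G [TG ndG Goo]] := sigma_finiteT m2.
exists (fun n => F n `*` G n).
  rewrite -setXTT TF TG predeqE => -[x y]; split; last first.
    by move=> [n _ []/= ? ?]; split; exists n.
  move=> [/= [n _ Fnx] [k _ Gky]]; exists (maxn n k) => //; split.
  - by move: x Fnx; exact/subsetPset/ndF/leq_maxl.
  - by move: y Gky; exact/subsetPset/ndG/leq_maxr.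
move=> k; have [? ?] := Foo k; have [? ?] := Goo k.
split; first exact: measurableX.
by rewrite product_measure1E// lte_mul_pinfty// ge0_fin_numE.
Qed.

Section lebesgue_rV_succ.
Context (R : realType) (n : nat).
Variable m : {sigma_finite_measure set 'rV[R]_n -> \bar R}.

Definition lebesgue_rV_succ : set 'rV[R]_n.+1 -> \bar R :=
  pushforward (lebesgue_measure \x m)%E (@rV_cons R n).

Let lebesgue_rV_succ0 : lebesgue_rV_succ set0 = 0%E.
Proof. exact: measure0. Qed.

Let lebesgue_rV_succ_ge0 A : (0 <= lebesgue_rV_succ A)%E.
Proof. exact: measure_ge0. Qed.

Let lebesgue_rV_succ_sigma_additive : semi_sigma_additive lebesgue_rV_succ.
Proof. exact: measure_semi_sigma_additive. Qed.

HB.instance Definition _ := isMeasure.Build _ _ _ lebesgue_rV_succ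
  lebesgue_rV_succ0 lebesgue_rV_succ_ge0 lebesgue_rV_succ_sigma_additive.

Let lebesgue_rV_succ_sigma_finite : sigma_finite setT lebesgue_rV_succ.
Proof.
have [F UF mF] := product_sigma_finite (@lebesgue_measure R) m.
exists (fun i => @rV_uncons R n @^-1` F i).
  by rewrite -preimage_bigcup -UF preimage_setT.
move=> i; have [mFi Fioo] := mF i; split.
  by rewrite -[X in measurable X]setTI; exact: measurable_rV_uncons.
rewrite /lebesgue_rV_succ /pushforward -comp_preimage.
rewrite (_ : _ \o _ = id) ?preimage_id//.
by apply/funext => p /=; rewrite rV_consK.
Qed.

HB.instance Definition _ := Measure_isSigmaFinite.Build _ _ _ lebesgue_rV_succ
  lebesgue_rV_succ_sigma_finite.

End lebesgue_rV_succ.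

(* Lebesgue measure on R^n: the n-fold product of the one on R. *)
Fixpoint lebesgue_rV (R : realType) (n : nat) :
    {sigma_finite_measure set 'rV[R]_n -> \bar R} :=
  match n with
  | 0 => \d_(0 : 'rV[R]_0)
  | n'.+1 => lebesgue_rV_succ (lebesgue_rV R n')
  end.

Section finite_element_optimal_control.
Context {R : realType} {n : nat}.
Local Notation V := 'rV[R]_n.
Local Notation mu := (lebesgue_rV R n).
Implicit Types (D Omega : set V) (f u v w y z yh uh vh zh yc yd : V -> R) (g : V -> V).
Implicit Types (A : V -> 'M[R]_n) (c : V -> R) (gy gv : V -> V).
Implicit Types (T : n.+1.-tuple V) (K : seq (n.+1.-tuple V)).

(* The library norm on 'rV[R]_n is the max norm, hence the Euclidean one. *)
Definition dotv (x y : V) : R := \sum_(i < n) x ord0 i * y ord0 i.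
Definition enorm (x : V) : R := Num.sqrt (dotv x x).

(* Functions on D are total functions of which only the values on D matter:
   f \_ D is f extended by 0 outside D. *)
Definition L2 D f : Prop := f \_ D \in Lfun mu 2%:E.
Definition Linfty D f : Prop := f \_ D \in Lfun mu +oo%E.
Definition L2norm D f : R := fine ('N[mu]_(2%:E)[EFin \o (f \_ D)])%E.
Definition L1norm D f : R := fine ('N[mu]_1[EFin \o (f \_ D)])%E.

Definition partial (i : 'I_n) f : V -> R := 'D_(delta_mx ord0 i) f.

Definition smooth f : Prop :=
  forall (vs : seq V) (x : V),
    differentiable (foldr (fun (d : V) (h : V -> R) => 'D_d h) f vs) x.

Definition test_function Omega f : Prop :=
  [/\ smooth f, compact (closure [set x | f x != 0]) &
      closure [set x | f x != 0] `<=` Omega].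

Definition weak_gradient Omega y g : Prop :=
  forall f, test_function Omega f -> forall i : 'I_n,
    \int[mu]_(x in Omega) (y x * partial i f x) =
    - \int[mu]_(x in Omega) (g x ord0 i * f x).

Definition Sobolev_H1 Omega y g : Prop :=
  [/\ L2 Omega y, forall i : 'I_n, L2 Omega (fun x => g x ord0 i) &
      weak_gradient Omega y g].

(* y is in the H^1-closure of the test functions, and g is its weak gradient. *)
Definition Sobolev_H10 Omega y g : Prop :=
  Sobolev_H1 Omega y g /\
  exists phi : nat -> V -> R,
    [/\ forall k, test_function Omega (phi k),
        L2norm Omega (phi k \- y) @[k --> \oo] --> (0 : R) &
        forall i : 'I_n,
          L2norm Omega (fun x => partial i (phi k) x - g x ord0 i)
            @[k --> \oo] --> (0 : R)].

Record convex_domain Omega : Prop := ConvexDomain {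
  domain_nonempty : Omega !=set0;
  domain_open : open Omega;
  domain_bounded : bounded_set Omega;
  domain_convex : convex_set Omega }.

Definition polyhedral Omega : Prop :=
  exists s : seq (V * R),
    Omega = [set x | forall p, p \in s -> dotv p.1 x < p.2].

Definition C11 f : Prop :=
  (forall x : V, differentiable f x) /\
  exists L : R, forall x y v : V,
    `|'D_v f x - 'D_v f y| <= L * enorm (x - y) * enorm v.

(* Near each boundary point, Omega is the set of points strictly above the
   graph of a C^{1,1} function of the n - 1 coordinates orthogonal to some unit
   vector e; x - dotv x e *: e is the orthogonal projection on these. *)
Definition C11_boundary Omega : Prop :=
  forall x0, (closure Omega `\` Omega) x0 ->
    exists (e : V) (f : V -> R) (r : R),
      [/\ enorm e = 1, C11 f, 0 < r &
          forall x, enorm (x - x0) < r ->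
            (Omega x <-> f (x - dotv x e *: e) < dotv x e)].

Record elliptic Omega A c0 : Prop := Elliptic {
  elliptic_coef_bounded : forall i j : 'I_n, Linfty Omega (fun x => A x i j);
  elliptic_c0_bounded : Linfty Omega c0;
  elliptic_c0_ge0 : {ae mu, forall x, Omega x -> 0 <= c0 x};
  elliptic_sym : {ae mu, forall x, Omega x -> forall i j, A x i j = A x j i};
  elliptic_coercive : exists2 theta : R, 0 < theta &
    {ae mu, forall x, Omega x -> forall xi : V,
      theta * enorm xi ^+ 2 <=
      \sum_(i < n) \sum_(j < n) A x i j * xi ord0 i * xi ord0 j} }.

(* gy and gv stand for the gradients of y and v. *)
Definition energy A c0 y gy v gv (x : V) : R :=
  \sum_(i < n) \sum_(j < n) A x i j * gy x ord0 i * gv x ord0 j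
  + c0 x * y x * v x.

(* y = S f, with weak gradient g *)
Definition weak_solution Omega A c0 f y g : Prop :=
  Sobolev_H10 Omega y g /\
  forall v gv, Sobolev_H10 Omega v gv ->
    \int[mu]_(x in Omega) energy A c0 y g v gv x =
    \int[mu]_(x in Omega) (f x * v x).

Definition Uad Omega (a b : R) v : Prop :=
  L2 Omega v /\ {ae mu, forall x, Omega x -> a <= v x <= b}.

Definition feasible Omega A c0 yc (a b : R) y u z : Prop :=
  [/\ L2 Omega u, L2 Omega z,
      exists g, weak_solution Omega A c0 (u \+ yc) y g,
      {ae mu, forall x, Omega x -> u x = z x} &
      Uad Omega a b z].

Definition cost Omega yd (alpha beta : R) y u z : R :=
  1 / 2 * L2norm Omega (y \- yd) ^+ 2 + alpha / 4 * L2norm Omega u ^+ 2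
  + alpha / 4 * L2norm Omega z ^+ 2 + beta * L1norm Omega z.

Definition optimal Omega A c0 yc yd (a b alpha beta : R) y u z : Prop :=
  feasible Omega A c0 yc a b y u z /\
  forall y' u' z', feasible Omega A c0 yc a b y' u' z' ->
    cost Omega yd alpha beta y u z <= cost Omega yd alpha beta y' u' z'.

Definition hull (s : seq V) : set V :=
  [set x | exists l : 'I_(size s) -> R,
    [/\ forall i, 0 <= l i, \sum_i l i = 1 & x = \sum_i l i *: s`_i]].

Definition diameter D : R := sup [set enorm (p.1 - p.2) | p in D `*` D].

Definition inball_diameter D : R :=
  sup [set 2 * r | r in [set r : R | 0 <= r /\
    exists x, [set x' | enorm (x' - x) <= r] `<=` D]].

(* A mesh is the list of its cells, a cell being given by its n + 1 vertices. *)
Definition triangulation K : Prop :=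
  (forall T, T \in K -> free [seq x - thead T | x <- behead T]) /\
  (forall T T', T \in K -> T' \in K ->
    hull T `&` hull T' = hull [seq x <- T | x \in tval T']).

Definition mesh_closure K : set V := \bigcup_(T in [set` K]) hull T.
Definition mesh_domain K : set V := interior (mesh_closure K).

Definition mesh_size K : R := \big[Num.max/0]_(T <- K) diameter (hull T).

Record mesh_family Omega (kappa tau c : R) (H : set R)
    (Th : R -> seq (n.+1.-tuple V)) : Prop := MeshFamily {
  mesh_size_gt0 : forall h, H h -> 0 < h;
  mesh_triangulation : forall h, H h -> triangulation (Th h);
  mesh_sizeE : forall h, H h -> mesh_size (Th h) = h;
  mesh_regular : forall h, H h -> forall T, T \in Th h ->
    diameter (hull T) / inball_diameter (hull T) <= kappa;
  mesh_quasi_uniform : forall h, H h -> forall T, T \in Th h ->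
    h / diameter (hull T) <= tau;
  mesh_sub : forall h, H h -> mesh_domain (Th h) `<=` Omega;
  mesh_polyhedral : polyhedral Omega ->
    forall h, H h -> mesh_domain (Th h) = Omega;
  mesh_C11 : C11_boundary Omega -> forall h, H h ->
    [/\ convex_set (mesh_closure (Th h)),
        forall T x, T \in Th h -> x \in tval T ->
          ~ mesh_domain (Th h) x -> (closure Omega `\` Omega) x &
        (mu (Omega `\` mesh_domain (Th h)) <= (c * h ^+ 2)%:E)%E] }.

Definition affine_on D f : Prop :=
  exists (k : R) (d : V), forall x, D x -> f x = k + dotv d x.

(* Y_h = U_h *)
Definition Yh Omega K v : Prop :=
  [/\ {within closure Omega, continuous v},
      forall T, T \in K -> affine_on (hull T) v &
      forall x, closure Omega x -> ~ mesh_domain K x -> v x = 0].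

(* The classical gradient inside the cells; the faces are negligible. *)
Definition grad_h K v (x : V) : V :=
  \row_i (partial i v \_ (\bigcup_(T in [set` K]) interior (hull T))) x.

(* yh = S_h f *)
Definition discrete_solution Omega K A c0 f yh : Prop :=
  Yh Omega K yh /\
  forall vh, Yh Omega K vh ->
    \int[mu]_(x in mesh_domain K)
      energy A c0 yh (grad_h K yh) vh (grad_h K vh) x =
    \int[mu]_(x in mesh_domain K) (f x * vh x).

Definition fe_estimate Omega A c0 (c1 : R) (H : set R)
    (Th : R -> seq (n.+1.-tuple V)) : Prop :=
  forall h, H h -> forall u w y g yh, L2 Omega u -> L2 Omega w ->
    weak_solution Omega A c0 (u \+ w) y g ->
    discrete_solution Omega (Th h) A c0 (u \+ w) yh ->
    L2norm Omega (y \- yh)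
      + h * L2norm Omega (fun x => enorm (g x - grad_h (Th h) yh x)) <=
    c1 * h ^+ 2 * (L2norm Omega u + L2norm Omega w).

(* The vertices carrying a basis function: those at which elements of Y_h are
   not forced to vanish. *)
Definition nodes K : seq V :=
  [seq x <- undup (flatten [seq tval T | T <- K]) | x \in mesh_domain K].

Definition nodal_basis Omega K (phi : V -> V -> R) : Prop :=
  forall p, p \in nodes K ->
    Yh Omega K (phi p) /\
    forall q, q \in nodes K -> phi p q = (q == p)%:R.

Definition L2h_norm K (phi : V -> V -> R) z : R :=
  Num.sqrt
    (\sum_(p <- nodes K) z p ^+ 2 * \int[mu]_(x in mesh_domain K) phi p x).

Definition L1h_norm K (phi : V -> V -> R) z : R :=
  \sum_(p <- nodes K) `|z p| * \int[mu]_(x in mesh_domain K) phi p x.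

Definition Uadh Omega K (a b : R) v : Prop := Yh Omega K v /\ Uad Omega a b v.

Definition feasible_h Omega K A c0 yc (a b : R) yh uh zh : Prop :=
  [/\ Yh Omega K uh, Yh Omega K zh,
      discrete_solution Omega K A c0 (uh \+ yc) yh,
      forall x, closure Omega x -> uh x = zh x &
      Uadh Omega K a b zh].

Definition cost_h K phi yd (alpha beta : R) yh uh zh : R :=
  1 / 2 * L2norm (mesh_domain K) (yh \- yd) ^+ 2
  + alpha / 4 * L2norm (mesh_domain K) uh ^+ 2
  + alpha / 4 * L2h_norm K phi zh ^+ 2 + beta * L1h_norm K phi zh.

Definition optimal_h Omega K phi A c0 yc yd (a b alpha beta : R) yh uh zh :
    Prop :=
  feasible_h Omega K A c0 yc a b yh uh zh /\
  forall yh' uh' zh', feasible_h Omega K A c0 yc a b yh' uh' zh' ->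
    cost_h K phi yd alpha beta yh uh zh <=
    cost_h K phi yd alpha beta yh' uh' zh'.

End finite_element_optimal_control.

(* Main.v *)
Require Import Defs.
From mathcomp Require Import all_boot all_order all_algebra.
From mathcomp Require Import all_classical all_reals all_analysis.
From mathcomp Require Import measurable_realfun ess_sup_inf ring lra.
Import Order.TTheory GRing.Theory Num.Theory.
Import numFieldNormedType.Exports.
Local Open Scope classical_set_scope.
Local Open Scope ring_scope.
Set Implicit Arguments.
Unset Strict Implicit.
Unset Printing Implicit Defensive.

(** Each optimal control is characterised by a variational inequality,
    [continuous_VI] and [discrete_VI]. The continuous one is tested with the
    discrete control [u_h], the discrete one with the quasi-interpolant [pi] of
    [u], whose nodal values are the averages of [u] weighted by the hat
    functions. Write [B (f, g) = (f, g)_h - (f, g)] for the lumping error. This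
    test function is tailored to the lumped norms:
    - [pi] is admissible, as averages keep the bounds;
    - [(pi, v_h)_h = (u, v_h)] for all [v_h] in [Y_h] ([lump_quasi_interp]);
    - the lumped [L^1] norm of [pi] is at most the [L^1] norm of [u], while that
      of [u_h] is at least its [L^1] norm ([quasi_interp_L1], [Yh_L1_le]).
    So in the sum of the two inequalities the [L^1] terms drop out, and the
    quadratic terms in the controls leave [- alpha |u - u_h|^2] and lumping errors.
    By symmetry of the solution operators, the terms in the states reduce to
    three:
    - [(y - y_h, w)] with [w = S_h (u_h - u)]; as [y_h - w] is the discrete state
      of [u], [y - y_h] is its error of order [h^2] minus [w], and completing the
      square leaves a term of order [h^4];
    - the product of [y - y_d] with the discretisation error of [S (u_h - u)], of
      order [h^2 |u - u_h|];
    - [- B (q_h, pi)] with [q_h = S_h (y_h - y_d)].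
    This is [control_balance].

    On [Y_h] the form [B] is a variance over the vertices of each cell, hence
    positive semidefinite and bounded by [h^2 |grad v_h|^2] ([lump_err_ge0],
    [lump_err_le]). Completing squares ([error_balance]) removes the mixed terms
    at the price of [B (q_h, q_h) / alpha], which is of order [h^2 / alpha], and of
    [alpha B (pi, pi)]. For the latter, [u] is a function of the adjoint state
    [p = S (y - y_d)] with Lipschitz constant [1 / alpha] ([projection_formula]),
    and [p] is [h^2]-close to a finite element function with bounded gradient, so
    that [B (pi, pi)] is of order [h^2 / alpha^2] ([lump_err_quasi_interp]). In all,
    [alpha |u - u_h|^2 <= C h^2 / alpha], that is [|u - u_h| <= C h / alpha].

    The solution operators come from the Lax-Milgram argument on the closure of
    the test functions ([weak_solution_exists]), which rests on the completeness
    of [L^2] and on the Poincare inequality, and from linear algebra in [Y_h]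
    ([discrete_solution_exists]). *)

(** * Square integrable functions *)

Section square_integrable.
Context d (T : measurableType d) (R : realType).
Variable mu : {measure set T -> \bar R}.
Variable D : set T.
Hypothesis mD : measurable D.
Implicit Types f g h : T -> R.

(** Only the values on [D] enter, and integrals are real numbers: the form in
    which everything below is computed. See [L2P] and [L2normE]. *)
Definition sqint f : Prop :=
  measurable_fun D f /\ mu.-integrable D (EFin \o (fun x => f x ^+ 2)).

Definition ip f g : R := \int[mu]_(x in D) (f x * g x).

Definition nrm f : R := Num.sqrt (ip f f).

Lemma le_sq_integrable f g h : sqint g -> sqint h -> measurable_fun D f ->
  (forall x, D x -> `|f x| <= g x ^+ 2 + h x ^+ 2) ->
  mu.-integrable D (EFin \o f).
Proof.
move=> [mg ig] [mh ih] mf fgh.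
apply: (@le_integrable _ _ _ mu _ mD _
  (EFin \o (fun x => g x ^+ 2 + h x ^+ 2))).
- exact/measurable_EFinP.
- by move=> x Dx /=; rewrite lee_fin (le_trans (fgh x Dx))// ler_norm.
- by have := integrableD mD ig ih.
Qed.

Lemma sqint_mul f g : sqint f -> sqint g ->
  mu.-integrable D (EFin \o (fun x => f x * g x)).
Proof.
move=> sf sg; apply: (le_sq_integrable sf sg).
  by apply: measurable_funM; [case: sf|case: sg].
by move=> x _; rewrite ler_norml; apply/andP; split; nra.
Qed.

Lemma le_sqint f g h : sqint g -> sqint h -> measurable_fun D f ->
  (forall x, D x -> `|f x| <= `|g x| + `|h x|) -> sqint f.
Proof.
move=> sg sh mf fgh; split => //.
have s2 k : sqint k -> sqint (fun x => 2 * k x).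
  move=> [mk ik]; split; first exact: measurable_funM.
  under eq_fun do rewrite /= exprMn.
  have := integrableZl mD (2 ^+ 2) ik.
  by apply: eq_integrable => // x _ /=; rewrite EFinM.
apply: (le_sq_integrable (s2 _ sg) (s2 _ sh)); first exact: measurable_funX.
move=> x Dx; rewrite normrX.
rewrite -(real_normK (num_real (2 * g x))) -(real_normK (num_real (2 * h x))).
rewrite !normrM (ger0_norm (ler0n R 2)).
have := fgh x Dx; have := normr_ge0 (f x); have := normr_ge0 (g x).
have := normr_ge0 (h x).
move: `|f x| `|g x| `|h x| => F G K K0 G0 F0 FGK.
apply: (@le_trans _ _ ((G + K) ^+ 2)); last by nra.
by rewrite ler_sqr ?nnegrE//; lra.
Qed.

Lemma sqint0 : sqint (fun=> 0).
Proof.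
split; first exact: measurable_cst.
apply: eq_integrable (integrable0 mu D) => // x _ /=.
by rewrite expr0n.
Qed.

Lemma sqintD f g : sqint f -> sqint g -> sqint (fun x => f x + g x).
Proof.
move=> sf sg; apply: (le_sqint sf sg) => [|x _]; last exact: ler_normD.
by apply: measurable_funD; [case: sf|case: sg].
Qed.

Lemma sqintZ (k : R) f : sqint f -> sqint (fun x => k * f x).
Proof.
move=> [mf jf]; split; first exact: measurable_funM.
under eq_fun do rewrite /= exprMn.
have := integrableZl mD (k ^+ 2) jf.
by apply: eq_integrable => // x _ /=; rewrite EFinM.
Qed.

Lemma sqintN f : sqint f -> sqint (fun x => - f x).
Proof. by move=> /(sqintZ (-1)); under eq_fun do rewrite mulN1r. Qed.

Lemma sqintB f g : sqint f -> sqint g -> sqint (fun x => f x - g x).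
Proof. by move=> sf sg; apply: sqintD => //; exact: sqintN. Qed.

Lemma sqint_norm f : sqint f -> sqint (fun x => `|f x|).
Proof.
move=> sf; apply: (le_sqint sf sqint0) => [|x _].
  by apply: measurableT_comp => //; case: sf.
by rewrite normr_id normr0 addr0.
Qed.

Lemma ipC f g : ip f g = ip g f.
Proof. by apply: eq_Rintegral => x _; rewrite mulrC. Qed.

Lemma eq_ip f f' g g' : (forall x, D x -> f x = f' x) ->
  (forall x, D x -> g x = g' x) -> ip f g = ip f' g'.
Proof.
by move=> ff gg; apply: eq_Rintegral => x; rewrite inE => Dx; rewrite ff// gg.
Qed.

Lemma ipDl f g h : sqint f -> sqint g -> sqint h ->
  ip (fun x => f x + g x) h = ip f h + ip g h.
Proof.
move=> sf sg sh; rewrite /ip -RintegralD//; try exact: sqint_mul.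
by apply: eq_Rintegral => x _; rewrite mulrDl.
Qed.

Lemma ipZl k f g : sqint f -> sqint g -> ip (fun x => k * f x) g = k * ip f g.
Proof.
move=> sf sg; rewrite /ip -RintegralZl//; last exact: sqint_mul.
by apply: eq_Rintegral => x _; rewrite mulrA.
Qed.

Lemma ipDr f g h : sqint f -> sqint g -> sqint h ->
  ip h (fun x => f x + g x) = ip h f + ip h g.
Proof. by move=> *; rewrite ipC ipDl// ![ip _ h]ipC. Qed.

Lemma ipZr k f g : sqint f -> sqint g -> ip g (fun x => k * f x) = k * ip g f.
Proof. by move=> *; rewrite ipC ipZl// ipC. Qed.

Lemma ipNl f g : sqint f -> sqint g -> ip (fun x => - f x) g = - ip f g.
Proof.
by move=> sf sg; rewrite -mulN1r -ipZl//; apply: eq_ip => // x; rewrite mulN1r.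
Qed.

Lemma ipBl f g h : sqint f -> sqint g -> sqint h ->
  ip (fun x => f x - g x) h = ip f h - ip g h.
Proof. by move=> sf sg sh; rewrite ipDl ?ipNl//; exact: sqintN. Qed.

Lemma ipBr f g h : sqint f -> sqint g -> sqint h ->
  ip h (fun x => f x - g x) = ip h f - ip h g.
Proof. by move=> *; rewrite ipC ipBl// ![ip _ h]ipC. Qed.

Lemma ip_ge0 f : 0 <= ip f f.
Proof. by apply: Rintegral_ge0 => x _; rewrite -expr2 sqr_ge0. Qed.

Lemma nrm_ge0 f : 0 <= nrm f. Proof. exact: sqrtr_ge0. Qed.

Lemma nrm_sq f : nrm f ^+ 2 = ip f f.
Proof. by rewrite sqr_sqrtr// ip_ge0. Qed.

Lemma le_nrm f g : (forall x, D x -> `|f x| <= `|g x|) -> sqint f -> sqint g ->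
  nrm f <= nrm g.
Proof.
move=> fg sf sg; rewrite ler_wsqrtr//; apply: le_Rintegral => //;
  try exact: sqint_mul.
move=> x Dx; rewrite -!expr2 -real_normK ?num_real// -(@real_normK _ (g x)) ?num_real//.
by rewrite ler_sqr ?nnegrE// fg.
Qed.

End square_integrable.

(** Behind the Cauchy-Schwarz inequality and the bound on the first variation of
    the energy along a minimising sequence. *)
Lemma discriminant_le (R : realType) (A B C : R) :
  0 <= A -> (forall t, 0 <= A * t ^+ 2 + 2 * B * t + C) -> B ^+ 2 <= A * C.
Proof.
move=> A0 H; have [A00|An0] := eqVneq A 0.
  have C0 : 0 <= C by have := H 0; rewrite !(expr0n, mulr0, add0r).
  have [->|Bn0] := eqVneq B 0; first by rewrite expr0n A00 mul0r.
  have := H (- (C + 1) / (2 * B)).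
  have -> : 2 * B * (- (C + 1) / (2 * B)) = - (C + 1) by field.
  by rewrite A00 mul0r; lra.
have Ap : 0 < A by rewrite lt_def An0.
have := H (- B / A).
have -> : A * (- B / A) ^+ 2 + 2 * B * (- B / A) + C = (A * C - B ^+ 2) / A.
  by field.
by rewrite pmulr_lge0 ?invr_gt0// subr_ge0.
Qed.

Section cauchy_schwarz.
Context d (T : measurableType d) (R : realType).
Variable mu : {measure set T -> \bar R}.
Variable D : set T.
Hypothesis mD : measurable D.
Implicit Types f g h : T -> R.
Local Notation sqint := (sqint mu D).
Local Notation ip := (ip mu D).
Local Notation nrm := (nrm mu D).

Lemma ip_sq_le f g : sqint f -> sqint g -> ip f g ^+ 2 <= ip f f * ip g g.
Proof.
move=> sf sg; rewrite mulrC; apply: discriminant_le => [|t]; first exact: ip_ge0.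
have := ip_ge0 mu D (fun x => f x + t * g x).
have stg := sqintZ mD t sg; have sfg := sqintD mD sf stg.
rewrite ipDl// !ipDr// !ipZl// !ipZr// (ipC _ _ g f).
by congr (0 <= _); ring.
Qed.

Lemma ip_le f g : sqint f -> sqint g -> `|ip f g| <= nrm f * nrm g.
Proof.
move=> sf sg; rewrite -(@ler_pXn2r _ 2)// ?nnegrE//; last first.
  by rewrite mulr_ge0// nrm_ge0.
by rewrite exprMn !nrm_sq real_normK ?num_real// ip_sq_le.
Qed.

Lemma nrmD f g : sqint f -> sqint g -> nrm (fun x => f x + g x) <= nrm f + nrm g.
Proof.
move=> sf sg; rewrite -(@ler_pXn2r _ 2)// ?nnegrE// ?addr_ge0 ?nrm_ge0//.
have sfg := sqintD mD sf sg.
rewrite sqrrD !nrm_sq ipDl// !ipDr// (ipC _ _ g f).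
have := le_trans (ler_norm _) (ip_le sf sg); rewrite mulr2n; lra.
Qed.

Lemma nrmZ k f : sqint f -> nrm (fun x => k * f x) = `|k| * nrm f.
Proof.
move=> sf; rewrite /nrm ipZl//; last exact: sqintZ.
rewrite ipZr// mulrA -expr2 sqrtrM ?sqr_ge0// sqrtr_sqr//.
Qed.

Lemma eq_nrm f g : (forall x, D x -> f x = g x) -> nrm f = nrm g.
Proof. by move=> fg; congr Num.sqrt; exact: eq_ip. Qed.

Lemma nrmN f : nrm (fun x => - f x) = nrm f.
Proof. by congr Num.sqrt; apply: eq_Rintegral => x _; rewrite mulrNN. Qed.

Lemma nrmB f g : sqint f -> sqint g -> nrm (fun x => f x - g x) <= nrm f + nrm g.
Proof.
by move=> sf sg; rewrite -(nrmN g); apply: nrmD => //; exact: sqintN.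
Qed.

Lemma nrm_distC f g : nrm (fun x => f x - g x) = nrm (fun x => g x - f x).
Proof. by rewrite -nrmN; apply: eq_nrm => x _; rewrite opprB. Qed.

Lemma nrm_le_dist f g : sqint f -> sqint g ->
  nrm f <= nrm (fun x => f x - g x) + nrm g.
Proof.
move=> sf sg; have := nrmD (sqintB mD sf sg) sg; apply: le_trans.
by rewrite le_eqVlt; apply/orP; left; apply/eqP/eq_nrm => x _; rewrite subrK.
Qed.

Lemma nrm0 : nrm (fun=> 0) = 0.
Proof.
rewrite /nrm (_ : ip _ _ = 0) ?sqrtr0// /ip.
under eq_Rintegral do rewrite mul0r.
by rewrite Rintegral_cst// mul0r.
Qed.

End cauchy_schwarz.

Section riesz_fischer.
Context d (T : measurableType d) (R : realType).
Variable mu : {measure set T -> \bar R}.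
Variable D : set T.
Hypothesis mD : measurable D.
Local Notation sqint := (sqint mu D).
Local Notation ip := (ip mu D).
Local Notation nrm := (nrm mu D).

Lemma integral_sqr f : sqint f ->
  (\int[mu]_(x in D) (f x ^+ 2)%:E = (ip f f)%:E)%E.
Proof.
move=> [_ sf]; rewrite /ip /Rintegral fineK.
  by apply: eq_integral => x _; rewrite expr2.
have := integrable_fin_num mD sf.
by congr (_ \is a fin_num); apply: eq_integral => x _ /=; rewrite expr2.
Qed.

Lemma limn_einf_le (u : nat -> \bar R) (c : \bar R) N :
  (forall m, (N <= m)%N -> (u m <= c)%E) -> (limn_einf u <= c)%E.
Proof.
move=> uc; rewrite limn_einf_lim; apply: lime_le; first exact: is_cvg_einfs.
apply: nearW => m; apply: (@le_trans _ _ (u (maxn m N))).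
  by apply: ereal_inf_lbound; exists (maxn m N) => //=; rewrite leq_maxl.
by apply: uc; rewrite leq_maxr.
Qed.

(** Weighting the squared increments [(v_(j+1) - v_j)^2] by [4^j] keeps their
    sum integrable, hence finite almost everywhere; by
    [t <= 4^j t^2 + 4^-j] the increments are then themselves summable. *)
Lemma ae_cvg_of_fast_cauchy (v : nat -> T -> R) :
  (forall j, sqint (v j)) ->
  (forall j, ip (fun x => v j.+1 x - v j x) (fun x => v j.+1 x - v j x)
             <= (8 ^+ j)^-1) ->
  {ae mu, forall x, D x -> cvgn (fun j => v j x)}.
Proof.
move=> sv v8.
pose dv j x := v j.+1 x - v j x.
have sdv j : sqint (dv j) by exact: sqintB.
pose f j x : \bar R := (4 ^+ j * dv j x ^+ 2)%:E.
have f0 j x : (0 <= f j x)%E by rewrite lee_fin mulr_ge0// ?sqr_ge0// exprn_ge0.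
have mf j : measurable_fun D (f j).
  apply/measurable_EFinP; apply: measurable_funM => //.
  by apply: measurable_funX; case: (sdv j).
have iG : mu.-integrable D (fun x => (\sum_(j <oo) f j x)%E).
  apply/integrableP; split.
    exact: (ge0_emeasurable_sum (P := xpredT)).
  under eq_integral do rewrite gee0_abs ?nneseries_ge0//.
  rewrite integral_nneseries//.
  apply: (@le_lt_trans _ _ (\sum_(j <oo) (2 / (2 ^ (j + 1))%:R)%:E)%E).
  apply: lee_nneseries => [j _ _|j _].
    by apply: integral_ge0 => x Dx; exact: f0.
  rewrite /f.
  under eq_integral do rewrite EFinM.
  rewrite ge0_integralZl//; last 2 first.
    by apply/measurable_EFinP; apply: measurable_funX; case: (sdv j).
    by move=> x _; rewrite lee_fin sqr_ge0.
  rewrite integral_sqr// -EFinM lee_fin.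
  apply: (@le_trans _ _ (4 ^+ j * (8 ^+ j)^-1)).
    by apply: ler_wpM2l (v8 j); rewrite exprn_ge0.
  rewrite (_ : 8 ^+ j = 4 ^+ j * 2 ^+ j :> R); last first.
      by rewrite -exprMn; congr (_ ^+ _); ring.
    rewrite invfM mulrA mulfV ?expf_neq0//.
    by rewrite addn1 expnS natrM invfM mulrA mulfV// natrX.
  by rewrite (cvg_lim _ (@cvg_geometric_eseries_half R 2 0))// ltry.
have := integrable_ae mD iG; apply: filterS => x + Dx => /(_ Dx) Gx.
have cG : cvgn (series (fun j => 4 ^+ j * dv j x ^+ 2)).
  apply: nondecreasing_is_cvgn.
    by apply: nondecreasing_series => j _; rewrite mulr_ge0// ?sqr_ge0// exprn_ge0.
  exists (fine (\sum_(j <oo) f j x)%E) => _ [m _ <-].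
  rewrite -lee_fin fineK// /series/= -sumEFin.
  by apply: (@nneseries_lim_ge _ (f^~ x) xpredT 0%N m) => j _ _; exact: f0.
have c4 : cvgn (series (fun j => (4^-1 : R) ^+ j)).
  have := @is_cvg_geometric_series R 1 (4^-1).
  rewrite /geometric; under eq_fun do rewrite mul1r.
  by apply; rewrite ger0_norm// invf_lt1// ltr1n.
have cs : cvgn (series (fun j => dv j x)).
  apply: normed_cvg; apply: series_le_cvg (is_cvg_seriesD cG c4) => // j.
  - exact: normr_ge0.
  - change (0 <= 4 ^+ j * dv j x ^+ 2 + 4^-1 ^+ j).
    apply: addr_ge0; last by apply: exprn_ge0; rewrite invr_ge0.
    by apply: mulr_ge0 (sqr_ge0 _); exact: exprn_ge0.
  change (`|dv j x| <= 4 ^+ j * dv j x ^+ 2 + 4^-1 ^+ j); rewrite exprVn.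
  have p4 : (0 : R) < 4 ^+ j by rewrite exprn_gt0.
  rewrite -(real_normK (num_real (dv j x))).
  move: `|dv j x| (normr_ge0 (dv j x)) => t t0.
  rewrite -(ler_pM2l p4) mulrDr mulfV ?gt_eqF//.
  move: (4 ^+ j) p4 => q q0; nra.
have -> : (fun j => v j x) = (fun j => v 0%N x + series (fun j => dv j x) j).
  apply/funext => j; rewrite /series/= telescope_sumr// addrC subrK//.
by apply: is_cvgD cs; exact: is_cvg_cst.
Qed.

(** A subsequence with increments at most [8^-j] converges almost everywhere;
    Fatou's lemma passes the Cauchy bound to its limit, for the whole sequence. *)
Lemma riesz_fischer (u : nat -> T -> R) :
  (forall k, sqint (u k)) ->
  (forall e, 0 < e -> exists N, forall k l, (N <= k)%N -> (N <= l)%N ->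
    ip (fun x => u k x - u l x) (fun x => u k x - u l x) <= e) ->
  exists2 w, sqint w & nrm (fun x => u k x - w x) @[k --> \oo] --> (0 : R).
Proof.
move=> su cu.
have [N HN] := choice (fun j => cu (8 ^+ j)^-1 ltac:(by rewrite invr_gt0 exprn_gt0)).
pose s j := (\sum_(i < j.+1) N i)%N.
have Ns j i : (i <= j)%N -> (N i <= s j)%N.
  by move=> ij; rewrite /s (bigD1 (Ordinal (ij : (i < j.+1)%N)))//= leq_addr.
pose v j := u (s j).
have sv j : sqint (v j) by exact: su.
have v8 j : ip (fun x => v j.+1 x - v j x) (fun x => v j.+1 x - v j x)
             <= (8 ^+ j)^-1.
  by apply: HN; apply: Ns.
have cv := ae_cvg_of_fast_cauchy sv v8.
pose W x := limn_esup (fun j => (v j x)%:E).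
have mW : measurable_fun D W.
  apply: measurable_fun_limn_esup => j; apply/measurable_EFinP.
  by case: (sv j).
pose w x := fine (W x).
have mw : measurable_fun D w by apply: measurableT_comp.
have vw : {ae mu, forall x, D x -> v j x @[j --> \oo] --> w x}.
  apply: filterS cv => x + Dx => /(_ Dx) c.
  have e : EFin (v j x) @[j --> \oo] --> (limn (fun j => v j x))%:E.
    by apply: cvg_EFin => //; exact: nearW.
  by rewrite /w /W; have [_ ->] := cvg_limn_einf_sup e.
have key k j : (forall l, (N j <= l)%N ->
    ip (fun x => u k x - u l x) (fun x => u k x - u l x) <= (8 ^+ j)^-1) ->
  (\int[mu]_(x in D) ((u k x - w x) ^+ 2)%:E <= (8 ^+ j)^-1%:E)%E.
  move=> Hk.
  pose g l x := ((u k x - v l x) ^+ 2)%:E.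
  have mg l : measurable_fun D (g l).
    apply/measurable_EFinP; apply: measurable_funX; apply: measurable_funB.
      by case: (su k).
    by case: (sv l).
  have g0 l x : D x -> (0 <= g l x)%E by rewrite lee_fin sqr_ge0.
  have := fatou mu mD mg g0.
  have -> : (\int[mu]_(x in D) limn_einf (g^~ x) =
             \int[mu]_(x in D) ((u k x - w x) ^+ 2)%:E)%E.
    apply: ae_eq_integral => //.
    - rewrite /limn_einf; apply: measurableT_comp => //.
      apply: measurable_fun_limn_esup => l.
      exact: measurableT_comp.
    - apply/measurable_EFinP; apply: measurable_funX; apply: measurable_funB => //.
      by case: (su k).
    - apply: filterS vw => x + Dx => /(_ Dx) c.
      have e : (g l x) @[l --> \oo] --> ((u k x - w x) ^+ 2)%:E.
        apply: cvg_EFin; first exact: nearW.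
        rewrite /g/= /comp/=; under eq_fun do rewrite /= expr2.
        rewrite expr2.
        have cc : u k x - v l x @[l --> \oo] --> u k x - w x.
          by apply: cvgB => //; exact: cvg_cst.
        exact: cvgM.
      by have [-> _] := cvg_limn_einf_sup e.
  move=> /le_trans; apply; apply: (@limn_einf_le _ _ j) => m jm.
  rewrite integral_sqr; last exact: sqintB.
  by rewrite lee_fin; apply: Hk; exact: Ns.
have suw k j : (forall l, (N j <= l)%N ->
    ip (fun x => u k x - u l x) (fun x => u k x - u l x) <= (8 ^+ j)^-1) ->
    sqint (fun x => u k x - w x).
  move=> Hk; have m1 : measurable_fun D (fun x => u k x - w x).
    by apply: measurable_funB => //; case: (su k).
  split => //; apply/integrableP; split.
    by apply/measurable_EFinP; exact: measurable_funX.
  under eq_integral do rewrite gee0_abs ?lee_fin ?sqr_ge0//.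
  by apply: le_lt_trans (key _ _ Hk) _; rewrite ltry.
exists w.
  have : sqint (fun x => u (N 0%N) x - (u (N 0%N) x - w x)).
    apply: sqintB => //; apply: (@suw _ 0%N) => l Nl; exact: HN.
  rewrite (_ : (fun x => _) = w)//; apply/funext => x; lra.
apply/cvgrPdist_le => e e0.
have [j hj] : exists j, (8 ^+ j)^-1 <= e ^+ 2.
  have e2 : 0 < e ^+ 2 by rewrite exprn_gt0.
  exists (Num.bound (e ^+ 2)^-1).
  rewrite invf_ple ?posrE// ?exprn_gt0//.
  have /archi_boundP : 0 <= (e ^+ 2)^-1 by rewrite invr_ge0 ltW.
  move=> /ltW /le_trans; apply.
  by rewrite -natrX ler_nat ltnW// ltn_expl.
near=> k.
have Hk l : (N j <= l)%N ->
    ip (fun x => u k x - u l x) (fun x => u k x - u l x) <= (8 ^+ j)^-1.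
  by move=> jl; apply: HN => //; near: k; exact: nbhs_infty_ge.
rewrite sub0r normrN ger0_norm ?nrm_ge0//.
rewrite -(@ler_pXn2r _ 2)// ?nnegrE ?nrm_ge0//; last exact: ltW.
rewrite nrm_sq -lee_fin -integral_sqr; last exact: suw Hk.
by apply: le_trans (key _ _ Hk) _; rewrite lee_fin.
Unshelve. all: by end_near. Qed.

End riesz_fischer.

(** * Lebesgue measure and partial derivatives *)

Section borel_rV.
Context (R : realType) (n : nat).
Local Notation V := 'rV[R]_n.

Lemma rV_norm_coord (x : V) i : `|x ord0 i| <= `|x|.
Proof.
rewrite [leRHS]mx_normrE.
exact: (@le_bigmax_cond _ _ _ _ (ord0, i) xpredT (fun ij : 'I_1 * 'I_n => `|x ij.1 ij.2|)).
Qed.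

Lemma rV_norm_le (x : V) c : 0 <= c -> (forall i, `|x ord0 i| <= c) -> `|x| <= c.
Proof.
move=> c0 xc; rewrite [leLHS]mx_normrE.
by apply: bigmax_le => // -[i j] _ /=; rewrite ord1.
Qed.

Lemma measurable_box (q : V) (r : R) :
  measurable [set x : V | forall i, `|x ord0 i - q ord0 i| < r].
Proof.
rewrite (_ : [set _ | _] = \bigcap_(i in [set: 'I_n])
    ((fun x : V => x ord0 i) @^-1` [set t | `|t - q ord0 i| < r])); last first.
  by apply/seteqP; split => [x Hx i _|x Hx i] /=; apply: Hx.
apply: fin_bigcap_measurable => // i _.
rewrite -[X in measurable X]setTI; apply: measurable_rV_coord => //.
apply: open_measurable.
rewrite (_ : [set t | _] = ball (q ord0 i) r); first exact: ball_open.
by apply/seteqP; split => t /=; rewrite -ball_normE /= distrC.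
Qed.

Lemma open_measurable_rV (U : set V) : open U -> measurable U.
Proof.
move=> oU.
pose box (a : 'rV[rat]_n * nat) : set V :=
  [set x | forall i, `|x ord0 i - ratr (a.1 ord0 i)| < a.2.+1%:R^-1].
have -> : U = \bigcup_(a in [set a | box a `<=` U]) box a.
  apply/seteqP; split=> [x Ux|x [a /= aU ax]]; last exact: aU.
  have /nbhs_ballP[e /= e0 eU] : nbhs x U by exact: open_nbhs_nbhs.
  pose k := Num.bound (4 / e).
  have ke : k.+1%:R^-1 <= e / 4.
    rewrite invf_ple ?posrE//; last exact: divr_gt0.
    rewrite invf_div; apply: le_trans (ltW (archi_boundP _)) _.
      by rewrite divr_ge0// ltW.
    by rewrite ler_nat.
  move: ke; set d := k.+1%:R^-1 => ke.
  have d0 : 0 < d by rewrite invr_gt0.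
  have /choice[q Hq] : forall i : 'I_n, exists q : rat, `|x ord0 i - ratr q| < d.
    move=> i; have : x ord0 i - d < x ord0 i + d by lra.
    move=> /rat_in_itvoo[q]; rewrite in_itv/= => /andP[q1 q2].
    by exists q; rewrite ltr_distl; apply/andP; split; lra.
  exists (\row_i q i, k); last by move=> i /=; rewrite mxE.
  move=> y yq; apply: eU; rewrite mx_norm_ball /ball_ /=.
  have yx i : `|(x - y) ord0 i| < 2 * d.
    have := yq i; have := Hq i; rewrite /= !mxE -/d => xq qy.
    rewrite (_ : _ - _ = (x ord0 i - ratr (q i)) - (y ord0 i - ratr (q i))); last by ring.
    by apply: le_lt_trans (ler_normB _ _) _; lra.
  apply: (@le_lt_trans _ _ (2 * d)); last by lra.
  by apply: rV_norm_le => [|i]; [lra|exact/ltW].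
rewrite bigcup_mkcond; apply: countable_bigcupT_measurable => // a.
case: ifPn => // _.
have := measurable_box (\row_i ratr (a.1 ord0 i)) (a.2.+1%:R^-1).
by congr measurable; apply/seteqP; split=> x /= H i; have := H i; rewrite mxE.
Qed.

Lemma continuous_measurable_rV (D : set V) (f : V -> R) : open D ->
  {in D, continuous f} -> measurable_fun D f.
Proof.
move=> oD cf; apply: (measurability _ (RGenOpens.measurableE R)).
move=> _ [_ [a [b ->] <-]]; apply: open_measurable_rV.
rewrite openE => x [Dx fx].
have fb : nbhs x (f @^-1` `]a, b[%classic).
  by apply: cf; [exact/mem_set|apply: open_nbhs_nbhs; split => //; exact: interval_open].
by apply: filterI fb; exact: open_nbhs_nbhs.
Qed.

Lemma continuous_measurable_rVT (f : V -> R) :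
  continuous f -> measurable_fun setT f.
Proof.
by move=> cf; exact: (continuous_measurable_rV openT (fun x _ => cf x)).
Qed.

End borel_rV.

Section lebesgue_rV_facts.
Context (R : realType).

Lemma rV_cons_preimage_box n (M : R) :
  @rV_cons R n @^-1` [set x | forall i, `|x ord0 i| <= M] =
  `[- M, M]%classic `*` [set y : 'rV[R]_n | forall i, `|y ord0 i| <= M].
Proof.
apply/seteqP; split => [[t y] /= H|[t y] /= [tM yM] i].
  split => [|i]; first by have := H ord0; rewrite rV_cons0 in_itv/= ler_norml.
  by have := H (lift ord0 i); rewrite rV_consS.
case: (unliftP ord0 i) => [j|] ->; first by rewrite rV_consS.
by rewrite rV_cons0 /= ler_norml.
Qed.

Lemma measurable_cube n (M : R) :
  measurable [set x : 'rV[R]_n | forall i, `|x ord0 i| <= M].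
Proof.
rewrite (_ : [set _ | _] = \bigcap_(i in [set: 'I_n])
    ((fun x : 'rV[R]_n => x ord0 i) @^-1` `[- M, M]%classic)); last first.
  apply/seteqP; split => [x Hx i _|x Hx i] /=; first by rewrite in_itv/= -ler_norml.
  by have := Hx i I; rewrite /= in_itv/= -ler_norml.
apply: fin_bigcap_measurable => // i _.
by rewrite -[X in measurable X]setTI; exact: measurable_rV_coord.
Qed.

Lemma lebesgue_rV_cube_lty n (M : R) :
  (lebesgue_rV R n [set x | forall i, (`|x ord0 i| <= M)%R] < +oo)%E.
Proof.
elim: n => [|n IH].
  rewrite /= diracE; by case: (_ \in _); rewrite ltry.
rewrite /= /lebesgue_rV_succ /pushforward rV_cons_preimage_box.
rewrite product_measure1E//; last exact: measurable_cube.
apply: lte_mul_pinfty => //.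
rewrite ge0_fin_numE// (_ : _ `[(- M)%R, M]%classic = lebesgue_measure `[(- M)%R, M]%classic)//.
by rewrite lebesgue_measure_itv/=; case: ifP => _; rewrite ?ltry// -EFinB ltry.
Qed.

Lemma bounded_lebesgue_rV_lty n (D : set 'rV[R]_n) : measurable D ->
  bounded_set D -> (lebesgue_rV R n D < +oo)%E.
Proof.
move=> mD [M [_ HM]]; apply: le_lt_trans (lebesgue_rV_cube_lty n (M + 1)).
apply: le_measure; rewrite ?inE//; first exact: measurable_cube.
move=> x Dx i; apply: le_trans (rV_norm_coord _ _) _.
by apply: HM Dx; rewrite ltrDl.
Qed.

Lemma rV_cons_dot n (d : 'rV[R]_n.+1) (t : R) y :
  dotv d (rV_cons (t, y)) = d ord0 ord0 * t +
    dotv (\row_j d ord0 (lift ord0 j)) y.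
Proof.
rewrite /dotv big_ord_recl rV_cons0; congr (_ + _).
by apply: eq_bigr => i _; rewrite rV_consS mxE.
Qed.

Lemma measurable_dotv n (d : 'rV[R]_n) : measurable_fun setT (dotv d).
Proof.
rewrite /dotv; apply: measurable_sum => i.
by apply: measurable_funM => //; exact: measurable_rV_coord.
Qed.

(** Either the slices in the last coordinates are hyperplanes again, or they are
    everything over one value of the first coordinate and empty over the others. *)
Lemma lebesgue_rV_hyperplane n (d : 'rV[R]_n) (k : R) : d != 0 ->
  lebesgue_rV R n [set x | dotv d x = k] = 0%E.
Proof.
elim: n d k => [d k|n IH d k d0]; first by rewrite thinmx0 eqxx.
rewrite /= /lebesgue_rV_succ /pushforward.
have [d'0|d'0] := eqVneq (\row_j d ord0 (lift ord0 j)) 0.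
  have d00 : d ord0 ord0 != 0.
    apply: contra d0 => /eqP d00; apply/eqP/rowP => i; rewrite mxE.
    case: (unliftP ord0 i) => [j|] -> //.
    by have /rowP/(_ j) := d'0; rewrite !mxE.
  rewrite (_ : _ @^-1` _ = [set k / d ord0 ord0] `*` setT); last first.
    have e t y : dotv d (rV_cons (t, y)) = d ord0 ord0 * t.
      rewrite rV_cons_dot d'0 /dotv big1 ?addr0// => i _.
      by rewrite mxE mul0r.
    apply/seteqP; split => [[t y]|[t y]] /=; rewrite e.
      by move=> <-; split => //; rewrite mulrC mulKf.
    by move=> [-> _]; rewrite mulrC divfK.
  rewrite product_measure1E// [X in (X * _)%E](_ : _ = 0%E) ?mul0e//.
  exact: lebesgue_measure_set1.
rewrite /product_measure1.
rewrite (eq_integral (cst 0%E)) ?integral0// => t _ /=.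
rewrite -(IH _ (k - d ord0 ord0 * t) d'0); congr (lebesgue_rV _ _ _).
apply/seteqP; split => y /=; rewrite /xsection /= ?inE /= rV_cons_dot.
  by move=> <-; ring.
by move=> ->; ring.
Qed.

End lebesgue_rV_facts.

Section integral_partial.
Context (R : realType).

(** Weaker than smoothness, and stable under products with coordinates and under
    restriction to slices, as the induction on the dimension requires. *)
Record C1 n (f : 'rV[R]_n -> R) : Prop := C1Intro {
  C1_continuous : continuous f;
  C1_derivable : forall x i, derivable f x (delta_mx ord0 i);
  C1_partial : forall i, continuous (partial i f) }.

Definition bounded_support n (f : 'rV[R]_n -> R) : Prop :=
  exists M : R, forall x, M < `|x| -> f x = 0.

Lemma rV_cons_shift0 n (t h : R) (y : 'rV[R]_n) :
  h *: delta_mx ord0 ord0 + rV_cons (t, y) = rV_cons (h + t, y).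
Proof.
apply/rowP => i; rewrite mxE [X in X + _]mxE [X in _ * X + _]mxE eqxx /=.
case: (unliftP ord0 i) => [j|] ->; first by rewrite !rV_consS mulr0 add0r.
by rewrite !rV_cons0 eqxx mulr1.
Qed.

Lemma rV_cons_shiftS n (t h : R) (y : 'rV[R]_n) j :
  h *: delta_mx ord0 (lift ord0 j) + rV_cons (t, y) =
  rV_cons (t, h *: delta_mx ord0 j + y).
Proof.
apply/rowP => i; rewrite mxE [X in X + _]mxE [X in _ * X + _]mxE eqxx /=.
case: (unliftP ord0 i) => [k|] ->.
  by rewrite !rV_consS !mxE /= (inj_eq lift_inj).
by rewrite !rV_cons0 mulr0 add0r.
Qed.

Lemma rV_consD n (t t' : R) (y y' : 'rV[R]_n) :
  rV_cons (t, y) - rV_cons (t', y') = rV_cons (t - t', y - y').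
Proof.
apply/rowP => i; rewrite mxE [X in _ + X]mxE.
by case: (unliftP ord0 i) => [k|] ->; rewrite ?rV_consS ?rV_cons0 ?mxE.
Qed.

Lemma rV_cons_norm n (t : R) (y : 'rV[R]_n) : `|rV_cons (t, y)| <= `|t| + `|y|.
Proof.
apply: rV_norm_le => [|i]; first by rewrite addr_ge0.
case: (unliftP ord0 i) => [k|] ->.
  by rewrite rV_consS /=; apply: le_trans (rV_norm_coord _ _) _; rewrite lerDr.
by rewrite rV_cons0 lerDl.
Qed.

Lemma rV_cons_norm_ge0 n (t : R) (y : 'rV[R]_n) : `|t| <= `|rV_cons (t, y)|.
Proof. by have := rV_norm_coord (rV_cons (t, y)) ord0; rewrite rV_cons0. Qed.

Lemma rV_cons_norm_geS n (t : R) (y : 'rV[R]_n) : `|y| <= `|rV_cons (t, y)|.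
Proof.
apply: rV_norm_le => // i.
by have := rV_norm_coord (rV_cons (t, y)) (lift ord0 i); rewrite rV_consS.
Qed.

Lemma rV_cons_continuousl n (y : 'rV[R]_n) :
  continuous (fun t : R => rV_cons (t, y)).
Proof.
move=> t; apply/cvgrPdist_le => e e0; near=> s.
rewrite rV_consD subrr; apply: le_trans (rV_cons_norm _ _) _.
rewrite normr0 addr0; near: s; apply: cvgr_dist_le => //; exact: cvg_id.
Unshelve. all: by end_near. Qed.

Lemma rV_cons_continuousr n (t : R) :
  continuous (fun y : 'rV[R]_n => rV_cons (t, y)).
Proof.
move=> y; apply/(@cvgrPdist_le _ _ _ _ (nbhs_filter y)) => e e0; near=> s.
rewrite rV_consD subrr; apply: le_trans (rV_cons_norm _ _) _.
rewrite normr0 add0r; near: s; apply/nbhs_ballP; exists e => //= z.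
by rewrite mx_norm_ball => /ltW.
Unshelve. all: by end_near. Qed.

Lemma partial_support n (f : 'rV[R]_n -> R) M i :
  (forall x, M < `|x| -> f x = 0) -> forall x, M < `|x| -> partial i f x = 0.
Proof.
move=> f0 x Mx; rewrite /partial -(derive_cst (0 : R) x (delta_mx ord0 i)).
apply: near_eq_derive.
have oM : open [set y : 'rV[R]_n | M < `|y|].
  have := @open_comp _ _ (fun y : 'rV[R]_n => `|y|) [set t | M < t].
  by apply => [y _|]; [exact: norm_continuous|exact: open_gt].
have : nbhs x [set y : 'rV[R]_n | M < `|y|] by exact: open_nbhs_nbhs.
by apply: filterS => y /= /f0 ->.
Qed.

Lemma continuous_support_integrable n (f : 'rV[R]_n -> R) M :
  continuous f -> (forall x, M < `|x| -> f x = 0) ->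
  (lebesgue_rV R n).-integrable setT (EFin \o f).
Proof.
move=> cf f0; pose Q := [set x : 'rV[R]_n | `|x| <= M].
have bQ : bounded_set Q.
  by exists M; split=> [|N MN x /= xM]; [exact: num_real|rewrite (le_trans xM)// ltW].
have clQ : closed Q.
  have := @closed_comp _ _ (fun y : 'rV[R]_n => `|y|) [set t | t <= M].
  by apply => [y _|]; [exact: norm_continuous|exact: closed_le].
have mQ : measurable Q.
  rewrite -[Q]setCK; apply: measurableC; apply: open_measurable_rV.
  exact: closed_openC.
have cQ : compact (f @` Q).
  apply: continuous_compact; last exact: bounded_closed_compact.
  exact: continuous_subspaceT.
have mf : measurable_fun setT f.
  exact: continuous_measurable_rVT.
have : (lebesgue_rV R n).-integrable Q (EFin \o f).
  apply: measurable_bounded_integrable => //.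
  - exact: bounded_lebesgue_rV_lty.
  - exact: measurable_funTS.
  - have [N [rN HN]] := compact_bounded cQ.
    exists N; split => // K NK x Qx; apply: HN NK _ _; by exists x.
move=> /(integrable_mkcond _ mQ); apply: eq_integrable => // x _.
rewrite patchE; case: ifPn => //; rewrite notin_setE /= => /negP.
by rewrite -ltNge => /f0 ->.
Qed.

(** The fundamental theorem of calculus on an interval around the support. *)
Lemma integral_derive1_support (g : R -> R) M :
  (forall t, derivable g t 1) -> continuous (derive1 g) ->
  (forall t, M < `|t| -> g t = 0) ->
  (\int[lebesgue_measure]_t (derive1 g t)%:E = 0)%E.
Proof.
move=> dg cg g0; pose K := Num.max M 0 + 1.
have K0 : 0 < K by rewrite ltr_wpDl// le_max lexx orbT.
have MK : M < K by rewrite ltr_pwDr// le_max lexx.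
have gK t : K <= `|t| -> g t = 0 by move=> Kt; apply: g0; exact: lt_le_trans Kt.
have dgK t : M < `|t| -> derive1 g t = 0.
  move=> Mt; rewrite derive1E -(derive_cst (0 : R) t 1); apply: near_eq_derive.
  have oM : open [set y : R | M < `|y|].
    have := @open_comp _ _ (fun y : R => `|y|) [set t | M < t].
    by apply => [y _|]; [exact: norm_continuous|exact: open_gt].
  have : nbhs t [set y : R | M < `|y|] by exact: open_nbhs_nbhs.
  by apply: filterS => y /= /g0 ->.
have cg0 : continuous g.
  by move=> t; apply/differentiable_continuous/derivable1_diffP.
have -> : (\int[lebesgue_measure]_t (derive1 g t)%:E =
    \int[lebesgue_measure]_(t in `[(- K)%R, K]) (derive1 g t)%:E)%E.
  rewrite [RHS]integral_mkcond; apply: eq_integral => t _.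
  rewrite patchE; case: ifPn => //.
  rewrite notin_setE /= in_itv /= => /negP; rewrite -ler_norml -ltNge => Kt.
  by rewrite dgK// (lt_trans MK).
have := @continuous_FTC2 R (derive1 g) g (- K) K.
have -> : g K = 0 by apply: gK; exact: ler_norm.
have -> : g (- K) = 0 by apply: gK; rewrite normrN; exact: ler_norm.
rewrite subee; last by [].
apply.
- by lra.
- exact: continuous_subspaceT.
- split; first by move=> t _; exact: dg.
    exact/cvg_at_right_filter/cg0.
  exact/cvg_at_left_filter/cg0.
- by move=> t _.
Qed.

Lemma derivable_slice0 n (f : 'rV[R]_n.+1 -> R) t y :
  derivable f (rV_cons (t, y)) (delta_mx ord0 ord0) ->
  derivable (fun s : R => f (rV_cons (s, y))) t 1.
Proof.
rewrite /derivable; set a := (fun h : R => h^-1 *: _); set b := (fun h : R => h^-1 *: _).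
suff -> : a = b by [].
by apply/funext => h; rewrite /a /b /= rV_cons_shift0 [_%:A]mulr1.
Qed.

Lemma derive1_slice0 n (f : 'rV[R]_n.+1 -> R) t y :
  derive1 (fun s : R => f (rV_cons (s, y))) t = partial ord0 f (rV_cons (t, y)).
Proof.
rewrite /derive1 /partial /derive.
set a := (fun h : R => h^-1 *: _); set b := (fun h : R => h^-1 *: _).
suff -> : a = b by [].
by apply/funext => h; rewrite /a /b /= rV_cons_shift0.
Qed.

Lemma derivable_sliceS n (f : 'rV[R]_n.+1 -> R) t y j :
  derivable f (rV_cons (t, y)) (delta_mx ord0 (lift ord0 j)) ->
  derivable (fun z : 'rV[R]_n => f (rV_cons (t, z))) y (delta_mx ord0 j).
Proof.
rewrite /derivable; set a := (fun h : R => h^-1 *: _); set b := (fun h : R => h^-1 *: _).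
suff -> : a = b by [].
by apply/funext => h; rewrite /a /b /= rV_cons_shiftS.
Qed.

Lemma partial_sliceS n (f : 'rV[R]_n.+1 -> R) t j :
  partial j (fun z : 'rV[R]_n => f (rV_cons (t, z))) =
  fun y => partial (lift ord0 j) f (rV_cons (t, y)).
Proof.
apply/funext => y; rewrite /partial /derive.
set a := (fun h : R => h^-1 *: _); set b := (fun h : R => h^-1 *: _).
suff -> : a = b by [].
by apply/funext => h; rewrite /a /b /= rV_cons_shiftS.
Qed.

Lemma C1_slice n (f : 'rV[R]_n.+1 -> R) t : C1 f ->
  C1 (fun z : 'rV[R]_n => f (rV_cons (t, z))).
Proof.
move=> [cf df pf]; split.
- move=> y; apply: (@continuous_comp _ _ _ (fun z => rV_cons (t, z)) f).
    exact: rV_cons_continuousr.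
  exact: cf.
- by move=> y i; exact/derivable_sliceS/df.
- move=> i; rewrite partial_sliceS => y.
  apply: (@continuous_comp _ _ _ (fun z => rV_cons (t, z)) (partial (lift ord0 i) f)).
    exact: rV_cons_continuousr.
  exact: pf.
Qed.

Lemma bounded_support_slice n (f : 'rV[R]_n.+1 -> R) t : bounded_support f ->
  bounded_support (fun z : 'rV[R]_n => f (rV_cons (t, z))).
Proof.
move=> [M f0]; exists M => y My; apply: f0; apply: lt_le_trans My _.
exact: rV_cons_norm_geS.
Qed.

Lemma partialM n (f g : 'rV[R]_n -> R) i : C1 f -> C1 g ->
  partial i (fun x => f x * g x) =
  fun x => f x * partial i g x + g x * partial i f x.
Proof.
move=> [_ df _] [_ dg _]; apply/funext => x.
exact: deriveM (df x i) (dg x i).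
Qed.

Lemma C1M n (f g : 'rV[R]_n -> R) : C1 f -> C1 g -> C1 (fun x => f x * g x).
Proof.
move=> Cf Cg; have [cf df pf] := Cf; have [cg dg pg] := Cg; split.
- by move=> x; exact: (cvgM (cf x) (cg x)).
- by move=> x i; exact: derivableM (df x i) (dg x i).
- move=> i; rewrite partialM// => x.
  exact: (cvgD (cvgM (cf x) (pg i x)) (cvgM (cg x) (pf i x))).
Qed.

Lemma partial_coord n (i : 'I_n) (x : 'rV[R]_n) j :
  partial j (fun y : 'rV[R]_n => y ord0 i) x = (i == j)%:R.
Proof.
rewrite /partial /derive (_ : (fun h : R => _) = (fun h => h^-1 * (h * (i == j)%:R))).
  apply: lim_near_cst => //; near=> h; rewrite mulKf//.
  by near: h; exact: nbhs_dnbhs_neq.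
by apply/funext => h; rewrite /= !mxE /= addrK eq_sym.
Unshelve. all: by end_near. Qed.

Lemma C1_coord n (i : 'I_n) : C1 (fun y : 'rV[R]_n => y ord0 i).
Proof.
split; first exact: coord_continuous.
- move=> x j; rewrite /derivable; apply/cvg_ex; exists (i == j)%:R.
  rewrite (_ : (fun h : R => _) = (fun h => h^-1 * (h * (i == j)%:R))).
    apply: cvg_near_cst; near=> h; rewrite mulKf//.
    by near: h; exact: nbhs_dnbhs_neq.
  by apply/funext => h; rewrite /= !mxE /= addrK eq_sym.
- move=> j; rewrite (_ : partial _ _ = cst (i == j)%:R); first exact: cst_continuous.
  by apply/funext => x; rewrite partial_coord.
Unshelve. all: by end_near. Qed.

(** Fubini: for the first coordinate the inner integral vanishes by the
    one-dimensional case, for the others by induction on the dimension. *)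
Lemma integral_partial n (f : 'rV[R]_n -> R) i : C1 f -> bounded_support f ->
  (\int[lebesgue_rV R n]_x (partial i f x)%:E = 0)%E.
Proof.
elim: n f i => [f [] //|n IH f i Cf Sf].
have [cf df pf] := Cf; have [M f0] := Sf.
have p0 := partial_support i f0.
have mp : measurable_fun setT (partial i f) by exact: continuous_measurable_rVT.
have ip : (lebesgue_measure \x lebesgue_rV R n)%E.-integrable setT
    ((EFin \o partial i f) \o @rV_cons R n).
  have := continuous_support_integrable (pf i) p0.
  rewrite /= /lebesgue_rV_succ => /integrableP[_ foo].
  apply/integrableP; split.
    apply: measurableT_comp; last exact: measurable_rV_cons.
    exact/measurable_EFinP.
  apply: le_lt_trans foo; rewrite ge0_integral_pushforward//=.
  - by apply/measurable_EFinP; exact: measurableT_comp.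
rewrite [LHS](@integral_pushforward _ _ _ _ _ _ (@measurable_rV_cons R n) _ setT
  (EFin \o partial i f))//=; last exact/measurable_EFinP.
case: (unliftP ord0 i) => [j|] Ei; subst i.
  rewrite preimage_setT -integral12_prod_meas1//.
  apply: integral0_eq => t _; rewrite /fubini_F /=.
  have := IH _ j (C1_slice t Cf) (bounded_support_slice t Sf).
  by rewrite partial_sliceS.
rewrite preimage_setT -integral21_prod_meas1//.
apply: integral0_eq => y _; rewrite /fubini_G /=.
rewrite -[RHS](@integral_derive1_support (fun s => f (rV_cons (s, y))) M).
- by apply: eq_integral => t _; rewrite derive1_slice0.
- by move=> t; exact/derivable_slice0/df.
- have -> : (fun s => f (rV_cons (s, y)))^`()%classic =
      (fun t => partial ord0 f (rV_cons (t, y))).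
    by apply/funext => t; exact: derive1_slice0.
  move=> t; apply: (@continuous_comp _ _ _ (fun s : R => rV_cons (s, y)) (partial ord0 f)).
    exact: rV_cons_continuousl.
  exact: pf.
- move=> t Mt; apply: f0; apply: lt_le_trans Mt _; exact: rV_cons_norm_ge0.
Qed.

End integral_partial.

(** * Relations that hold almost everywhere *)

Section ae_integral.
Context d (T : measurableType d) (R : realType).
Variable mu : {measure set T -> \bar R}.
Variable D : set T.
Hypothesis mD : measurable D.
Implicit Types f g : T -> R.

Lemma ae_le_integrable f g : measurable_fun D f ->
  mu.-integrable D (EFin \o g) -> {ae mu, forall x, D x -> `|f x| <= g x} ->
  mu.-integrable D (EFin \o f).
Proof.
move=> mf /integrableP[mg ig] fg; apply/integrableP; split.
  exact/measurable_EFinP.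
apply: le_lt_trans ig; apply: ae_ge0_le_integral => //.
- by apply: measurableT_comp => //; exact/measurable_EFinP.
- exact: measurableT_comp.
- apply: filterS fg => x + Dx => /(_ Dx) fgx /=.
  by rewrite lee_fin (le_trans fgx)// ler_norm.
Qed.

Lemma ae_eq_Rintegral f g : measurable_fun D f -> measurable_fun D g ->
  {ae mu, forall x, D x -> f x = g x} ->
  \int[mu]_(x in D) f x = \int[mu]_(x in D) g x.
Proof.
move=> mf mg fg; rewrite /Rintegral; congr fine.
apply: ae_eq_integral => //; try exact/measurable_EFinP.
by apply: filterS fg => x + Dx => /(_ Dx) /= ->.
Qed.

Lemma ae_le_Rintegral f g : mu.-integrable D (EFin \o f) ->
  mu.-integrable D (EFin \o g) -> {ae mu, forall x, D x -> f x <= g x} ->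
  \int[mu]_(x in D) f x <= \int[mu]_(x in D) g x.
Proof.
move=> jf jg fg; rewrite -subr_ge0 -RintegralB//.
have mf : measurable_fun D f by exact/measurable_EFinP/(measurable_int mu).
have mg : measurable_fun D g by exact/measurable_EFinP/(measurable_int mu).
rewrite (@ae_eq_Rintegral _ (fun x => `|g x - f x|)).
- exact: Rintegral_ge0.
- exact: measurable_funB.
- by apply: measurableT_comp => //; exact: measurable_funB.
- by apply: filterS fg => x + Dx => /(_ Dx) fgx; rewrite ger0_norm// subr_ge0.
Qed.

Lemma ae_le_sqint f g : measurable_fun D f -> sqint mu D g ->
  {ae mu, forall x, D x -> `|f x| <= `|g x|} -> sqint mu D f.
Proof.
move=> mf [mg ig] fg; split => //; apply: ae_le_integrable ig _.
  exact: measurable_funX.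
apply: filterS fg => x + Dx => /(_ Dx) fgx.
by rewrite normrX -(real_normK (num_real (g x))) ler_sqr ?nnegrE.
Qed.

Lemma ae_le_ip f f' g g' : sqint mu D f -> sqint mu D g ->
  sqint mu D f' -> sqint mu D g' ->
  {ae mu, forall x, D x -> f x * g x <= f' x * g' x} ->
  ip mu D f g <= ip mu D f' g'.
Proof. by move=> *; apply: ae_le_Rintegral => //; exact: sqint_mul. Qed.

Lemma ae_eq_ip f f' g g' : measurable_fun D f -> measurable_fun D g ->
  measurable_fun D f' -> measurable_fun D g' ->
  {ae mu, forall x, D x -> f x * g x = f' x * g' x} ->
  ip mu D f g = ip mu D f' g'.
Proof. by move=> *; apply: ae_eq_Rintegral => //; exact: measurable_funM. Qed.

End ae_integral.

Section L2_sqint.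
Context (R : realType) (n : nat).
Local Notation V := 'rV[R]_n.
Local Notation mu := (lebesgue_rV R n).
Variable D : set V.
Hypothesis mD : measurable D.
Implicit Types f g : V -> R.

Lemma L2P f : L2 D f <-> sqint mu D f.
Proof.
have e : EFin \o (fun x => (f \_ D) x ^+ 2) = (EFin \o (fun x => f x ^+ 2)) \_ D.
  apply/funext => x; rewrite /= !patchE; case: ifPn => // _.
  by rewrite expr0n.
split => [Hf|[mf jf]].
  split.
    apply/(measurable_restrictT _ mD).
    by move: Hf; rewrite /L2 inE => /andP[]; rewrite inE.
  by apply/(integrable_mkcond _ mD); rewrite -e; exact: Lfun2_integrable_sqr.
rewrite /L2 inE; apply/andP; split; rewrite inE.
  exact/(measurable_restrictT _ mD).
rewrite /= /finite_norm unlock poweR_lty//.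
move/(integrable_mkcond _ mD): jf; rewrite -e => /integrableP[_].
apply: le_lt_trans; rewrite le_eqVlt; apply/orP; left; apply/eqP.
apply: eq_integral => x _ /=.
by rewrite powR_mulrn// -normrX.
Qed.

Lemma L2normE f : sqint mu D f -> L2norm D f = nrm mu D f.
Proof.
move=> sf; rewrite /L2norm unlock.
have -> : (\int[mu]_x `|(EFin \o f \_ D) x| `^ 2 = (ip mu D f f)%:E)%E.
  rewrite -integral_sqr// [RHS]integral_mkcond; apply: eq_integral => x _ /=.
  rewrite !patchE; case: ifPn => _; last by rewrite normr0 powR0.
  by rewrite /= powR_mulrn// -normrX ger0_norm// sqr_ge0.
by rewrite /nrm /= powR12_sqrt// ip_ge0.
Qed.

Lemma L1normE f : mu.-integrable D (EFin \o f) ->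
  L1norm D f = \int[mu]_(x in D) `|f x|.
Proof.
move=> jf; rewrite /L1norm Lnorm1 /Rintegral [in RHS]integral_mkcond.
congr fine; apply: eq_integral => x _ /=; rewrite !patchE.
by case: ifPn => // _; rewrite normr0.
Qed.

Lemma Linfty_sqintM (k f : V -> R) : Linfty D k -> sqint mu D f ->
  sqint mu D (fun x => k x * f x).
Proof.
rewrite /Linfty inE => /andP[]; rewrite !inE /= => mk fk [mf jf].
have {}mk : measurable_fun D k by exact/(measurable_restrictT _ mD).
have mkf : measurable_fun D (fun x => k x * f x) by exact: measurable_funM.
have [M HM] : exists M : R, {ae mu, forall x, D x -> `|k x| <= M}.
  move: fk; rewrite /finite_norm unlock; case: ifPn => muT.
    move=> /ess_supr_bounded[M HM]; exists M; apply: filterS HM => x /=.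
    by rewrite patchE => + Dx; rewrite mem_set.
  move=> _; exists 0; exists setT; split => //.
  by apply/eqP; rewrite eq_le measure_ge0 leNgt muT.
apply: (ae_le_sqint mD mkf (sqintZ mD M (conj mf jf))).
apply: filterS HM => x + Dx => /(_ Dx) kM.
by rewrite !normrM ler_wpM2r// (le_trans kM)// ler_norm.
Qed.

End L2_sqint.

(** * Test functions and the Poincare inequality *)

Section test_functions.
Context (R : realType) (n : nat).
Local Notation V := 'rV[R]_n.
Local Notation mu := (lebesgue_rV R n).
Variable Omega : set V.
Hypothesis oO : open Omega.
Let mO : measurable Omega := open_measurable_rV oO.
Local Notation sq := (sqint mu Omega).
Local Notation ipO := (ip mu Omega).
Local Notation nrmO := (nrm mu Omega).
Local Notation test := (test_function Omega).

Lemma test_C1 f : test f -> C1 f.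
Proof.
move=> [sf _ _]; split.
- by move=> x; apply: differentiable_continuous; exact: (sf [::] x).
- by move=> x i; apply: diff_derivable; exact: (sf [::] x).
- move=> i x; apply: differentiable_continuous.
  exact: (sf [:: delta_mx ord0 i] x).
Qed.

Lemma test_bounded_support f : test f -> bounded_support f.
Proof.
move=> [_ cf _]; have [M [rM HM]] := compact_bounded cf.
exists (M + 1) => x Mx; apply/eqP/negPn/negP => fx.
have : `|x| <= M + 1 by apply: HM; [rewrite ltrDl|exact: subset_closure].
by rewrite leNgt Mx.
Qed.

Lemma test_out f x : test f -> ~ Omega x -> f x = 0.
Proof.
move=> [_ _ fO] Ox; apply/eqP/negPn/negP => fx; apply: Ox.
by apply: fO; exact: subset_closure.
Qed.

Lemma test_partial_out f i x : test f -> ~ Omega x -> partial i f x = 0.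
Proof.
move=> [_ _ fO] Ox; rewrite /partial -(derive_cst (0 : R) x (delta_mx ord0 i)).
apply: near_eq_derive.
have : nbhs x (~` closure [set x | f x != 0]).
  apply: open_nbhs_nbhs; split; last by move=> /fO.
  exact/closed_openC/closed_closure.
apply: filterS => y /= fy; apply/eqP/negPn/negP => fy0; apply: fy.
exact: subset_closure.
Qed.

Lemma integrable_Omega f : continuous f -> bounded_support f ->
  mu.-integrable Omega (EFin \o f).
Proof.
move=> cf [M f0]; have := continuous_support_integrable cf f0.
exact: integrableS.
Qed.

Lemma Rintegral_Omega f : (forall x, ~ Omega x -> f x = 0) ->
  \int[mu]_(x in Omega) f x = \int[mu]_x f x.
Proof.
move=> f0; rewrite Rintegral_mkcond; apply: eq_Rintegral => x _.
by rewrite patchE; case: ifPn => //; rewrite notin_setE => /f0.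
Qed.

Lemma continuous_sqint f : continuous f -> bounded_support f -> sq f.
Proof.
move=> cf [M f0]; split.
  by apply: measurable_funTS; exact: continuous_measurable_rVT.
apply: integrable_Omega.
  by move=> x; exact: (cvgM (cf x) (cf x)).
by exists M => x /f0 ->; rewrite expr0n.
Qed.

Lemma partial_bounded_support (f : V -> R) i :
  bounded_support f -> bounded_support (partial i f).
Proof. by move=> [M f0]; exists M; exact: partial_support. Qed.

Lemma test_sqint f : test f -> sq f.
Proof.
by move=> tf; apply: continuous_sqint (test_bounded_support tf); case: (test_C1 tf).
Qed.

Lemma test_partial_sqint f i : test f -> sq (partial i f).
Proof.
move=> tf; apply: continuous_sqint; first by case: (test_C1 tf).
exact/partial_bounded_support/test_bounded_support.
Qed.

Lemma test0 : test (fun=> 0).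
Proof.
have e : [set x : V | (0 : R) != 0] = set0.
  by apply/seteqP; split => x //=; rewrite eqxx.
split; rewrite ?e ?closure0//; last exact: compact0.
move=> vs x.
have -> : foldr (fun d (h : V -> R) => 'D_d h) (fun=> 0) vs = cst (0 : R).
  elim: vs => //= v vs ->; apply/funext => y; exact: derive_cst.
exact: differentiable_cst.
Qed.

Lemma foldr_derive_lin (f g : V -> R) (t : R) vs : smooth f -> smooth g ->
  foldr (fun d (h : V -> R) => 'D_d h) (fun x => f x + t * g x) vs =
  fun x => foldr (fun d (h : V -> R) => 'D_d h) f vs x +
           t * foldr (fun d (h : V -> R) => 'D_d h) g vs x.
Proof.
move=> sf sg; elim: vs => //= v vs ->; apply/funext => x.
have df := diff_derivable (v := v) (sf vs x).
have dg := diff_derivable (v := v) (sg vs x).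
have := deriveD df (derivableZ (k := t) dg); rewrite deriveZ// => <-.
Qed.

Lemma test_lin f g t : test f -> test g -> test (fun x => f x + t * g x).
Proof.
move=> [sf cf fO] [sg cg gO].
have sub : closure [set x | f x + t * g x != 0] `<=`
    closure [set x | f x != 0] `|` closure [set x | g x != 0].
  rewrite -closureU; apply: closure_subset => x /=.
  have [->|] := eqVneq (f x) 0; last by left.
  by have [->|] := eqVneq (g x) 0; [rewrite mulr0 addr0 eqxx|right].
split.
- move=> vs x; rewrite foldr_derive_lin//.
  apply: differentiableD; first exact: sf.
  apply: differentiableM; [exact: differentiable_cst|exact: sg].
- apply: subclosed_compact sub; first exact: closed_closure.
  exact: compactU.
- by move=> x /sub[/fO|/gO].
Qed.

Lemma partial_lin (f g : V -> R) t i : C1 f -> C1 g ->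
  partial i (fun x => f x + t * g x) = fun x : V => partial i f x + t * partial i g x.
Proof.
move=> [_ df _] [_ dg _]; apply/funext => x; rewrite /partial.
by have := deriveD (df x i) (derivableZ (k := t) (dg x i)); rewrite deriveZ// => <-.
Qed.

Lemma integral_partial_Omega f i : C1 f -> bounded_support f ->
  (forall x, ~ Omega x -> partial i f x = 0) ->
  \int[mu]_(x in Omega) partial i f x = 0.
Proof.
by move=> Cf Sf f0; rewrite Rintegral_Omega// /Rintegral integral_partial.
Qed.

Lemma bounded_supportM (f g : V -> R) : bounded_support g ->
  bounded_support (fun x => f x * g x).
Proof. by move=> [M g0]; exists M => x /g0 ->; rewrite mulr0. Qed.

(** The integral of [d_i (f g)] vanishes. *)
Lemma test_ibp f g i : test f -> test g ->
  ipO f (partial i g) = - ipO (partial i f) g.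
Proof.
move=> tf tg; apply/eqP; rewrite -addr_eq0; apply/eqP.
have Cf := test_C1 tf; have Cg := test_C1 tg.
have := integral_partial_Omega (i := i) (C1M Cf Cg) (bounded_supportM f (test_bounded_support tg)).
rewrite partialM// => <-; last first.
  by move=> x Ox; rewrite (test_partial_out _ tg)// (test_out tg)// mulr0 mul0r addr0.
rewrite [in RHS]RintegralD//.
- by congr (_ + _); exact: ipC.
- by apply: (sqint_mul mO); [exact: test_sqint|exact: test_partial_sqint].
- by apply: (sqint_mul mO); [exact: test_sqint|exact: test_partial_sqint].
Qed.

(** Poincare inequality: [\int phi^2 = - 2 \int x_i phi d_i phi], because the
    integral of [d_i (x_i phi^2)] vanishes. *)
Lemma test_poincare (i : 'I_n) (K : R) f : (forall x, Omega x -> `|x| <= K) ->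
  test f -> nrmO f <= 2 * K * nrmO (partial i f).
Proof.
move=> OK tf.
have [eO|/set0P[x0 /OK x0K]] := eqVneq Omega set0.
  by rewrite eO /nrm /ip !Rintegral_set0 sqrtr0 mulr0.
have K0 : 0 <= K by apply: le_trans x0K.
have sf := test_sqint tf; have sp := test_partial_sqint i tf.
have Cf := test_C1 tf; have Sf := test_bounded_support tf.
have Ci := C1_coord R i.
have sxf : sq (fun x : V => x ord0 i * f x).
  apply: continuous_sqint (bounded_supportM _ Sf).
  by have [] := C1M Ci Cf.
have xK : nrmO (fun x : V => x ord0 i * f x) <= K * nrmO f.
  rewrite -(ger0_norm K0) -nrmZ//; apply: le_nrm => //; last exact: sqintZ.
  move=> x Ox; rewrite !normrM ler_wpM2r// (le_trans (rV_norm_coord _ _))//.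
  by rewrite (le_trans (OK _ Ox))// ler_norm.
have e : ipO f f = - (2 * ipO (fun x : V => x ord0 i * f x) (partial i f)).
  apply/eqP; rewrite -addr_eq0; apply/eqP.
  have := integral_partial_Omega (i := i) (C1M Ci (C1M Cf Cf))
     (bounded_supportM _ (bounded_supportM f Sf)).
  rewrite partialM//; last exact: C1M.
  rewrite partialM// => <-; last first.
    move=> x Ox; rewrite (test_partial_out _ tf)// (test_out tf)//.
    by rewrite !(mulr0, mul0r, addr0).
  rewrite -(ipZl mO 2 sxf sp) /ip.
  rewrite -(RintegralD mO (sqint_mul mO sf sf) (sqint_mul mO (sqintZ mO 2 sxf) sp)).
  by apply: eq_Rintegral => x _; rewrite partial_coord eqxx mulr1; ring.
have := ip_le mO sxf sp; have := nrm_ge0 mu Omega f.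
have := nrm_ge0 mu Omega (partial i f); have := nrm_sq mu Omega f.
rewrite e; move: xK.
set X := nrmO (fun x : V => x ord0 i * f x); set F := nrmO f.
set P := nrmO (partial i f); set I := ipO _ _ => XF FE P0 F0 IX.
have {}FE : F ^+ 2 <= 2 * (K * F * P).
  rewrite FE; apply: le_trans (ler_norm _) _; rewrite normrN normrM ger0_norm//.
  rewrite ler_wpM2l//; apply: le_trans IX _; exact: ler_wpM2r.
have [->|Fn0] := eqVneq F 0; first by rewrite !mulr_ge0.
have Fp : 0 < F by rewrite lt_def Fn0.
by rewrite -(ler_pM2l Fp) -expr2; apply: le_trans FE _; lra.
Qed.

End test_functions.

(** * Weak solutions *)

Lemma cvgn_mull (R : realType) (c : R) (a : nat -> R) (l : R) :
  a @ \oo --> l -> c * a k @[k --> \oo] --> c * l.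
Proof. by move=> al; exact: (cvgM (cvg_cst c) al). Qed.

Lemma cvgn_le (R : realType) (a b : nat -> R) (la lb : R) :
  (forall k, a k <= b k) -> a @ \oo --> la -> b @ \oo --> lb -> la <= lb.
Proof. by move=> ab al bl; apply: (ler_cvg_to al bl); exact: nearW. Qed.

Lemma cvgn_unique (R : realType) (a : nat -> R) (l l' : R) :
  a @ \oo --> l -> a @ \oo --> l' -> l = l'.
Proof. by move=> /(cvg_lim (@Rhausdorff R)) <- /(cvg_lim (@Rhausdorff R)) <-. Qed.

Lemma cvgn_sum (R : realType) (I : Type) (s : seq I) (a : I -> nat -> R) (l : I -> R) :
  (forall i, a i @ \oo --> l i) ->
  \sum_(i <- s) a i k @[k --> \oo] --> \sum_(i <- s) l i.
Proof.
move=> al; elim: s => [|i s IH].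
  by rewrite big_nil; under eq_fun do rewrite big_nil; exact: cvg_cst.
by rewrite big_cons; under eq_fun do rewrite big_cons; exact: cvgD.
Qed.

Lemma cvg_dominated (R : realType) (a b : nat -> R) (C l : R) :
  (forall k, `|a k - l| <= C * b k) -> b @ \oo --> (0 : R) ->
  a @ \oo --> l.
Proof.
move=> ab b0; have c : C * b k @[k --> \oo] --> (0 : R).
  by rewrite -[X in _ --> X](mulr0 C); exact: cvgn_mull.
apply/subr_cvg0/norm_cvg0P.
by apply: squeeze_cvgr (cvg_cst 0) c; apply: nearW => k; rewrite normr_ge0 ab.
Qed.

Section Rintegral_sum.
Context d (T : measurableType d) (R : realType).
Variable mu : {measure set T -> \bar R}.
Variable D : set T.
Hypothesis mD : measurable D.

Lemma integrable_Rsum (I : Type) (s : seq I) (F : I -> T -> R) :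
  (forall i, mu.-integrable D (EFin \o F i)) ->
  mu.-integrable D (EFin \o (fun x => \sum_(i <- s) F i x)).
Proof.
move=> jF; elim: s => [|i s IH].
  apply: eq_integrable (integrable0 mu D) => // x _ /=.
  by rewrite big_nil.
have := integrableD mD (jF i) IH; apply: eq_integrable => // x _ /=.
by rewrite big_cons.
Qed.

Lemma Rintegral_sum (I : Type) (s : seq I) (F : I -> T -> R) :
  (forall i, mu.-integrable D (EFin \o F i)) ->
  \int[mu]_(x in D) (\sum_(i <- s) F i x) = \sum_(i <- s) \int[mu]_(x in D) F i x.
Proof.
move=> jF; elim: s => [|i s IH].
  rewrite big_nil; under eq_Rintegral do rewrite big_nil.
  by rewrite Rintegral_cst// mul0r.
rewrite big_cons -IH -RintegralD//; last exact: integrable_Rsum.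
by apply: eq_Rintegral => x _; rewrite big_cons.
Qed.

Lemma cvg_ip (u : nat -> T -> R) (w v : T -> R) :
  (forall k, sqint mu D (u k)) -> sqint mu D w -> sqint mu D v ->
  nrm mu D (fun x => u k x - w x) @[k --> \oo] --> (0 : R) ->
  ip mu D (u k) v @[k --> \oo] --> ip mu D w v.
Proof.
move=> su sw sv; apply: (cvg_dominated (C := nrm mu D v)) => k.
rewrite -ipBl// mulrC; apply: ip_le => //; exact: sqintB.
Qed.

End Rintegral_sum.

Section H10.
Context (R : realType) (n : nat).
Local Notation V := 'rV[R]_n.
Local Notation mu := (lebesgue_rV R n).
Variable Omega : set V.
Hypothesis oO : open Omega.
Let mO : measurable Omega := open_measurable_rV oO.
Local Notation sq := (sqint mu Omega).
Local Notation ipO := (ip mu Omega).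
Local Notation nrmO := (nrm mu Omega).
Local Notation test := (test_function Omega).
Implicit Types (y v f : V -> R) (g gv : V -> V).

Definition gradient f : V -> V := fun x => \row_i partial i f x.

Definition sqint1 y g : Prop := sq y /\ forall i, sq (fun x => g x ord0 i).

Definition H1_cvg (phi : nat -> V -> R) y g : Prop :=
  nrmO (fun x => phi k x - y x) @[k --> \oo] --> (0 : R) /\
  forall i, nrmO (fun x => partial i (phi k) x - g x ord0 i)
    @[k --> \oo] --> (0 : R).

Lemma gradient_sqint1 f : test f -> sqint1 f (gradient f).
Proof.
move=> tf; split=> [|i]; first exact: test_sqint.
by under eq_fun do rewrite mxE; exact: test_partial_sqint.
Qed.

Lemma sqint1_lin y g y' g' t : sqint1 y g -> sqint1 y' g' ->
  sqint1 (fun x => y x + t * y' x) (fun x => g x + t *: g' x).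
Proof.
move=> [sy sg] [sy' sg']; split=> [|i].
  by apply: sqintD => //; exact: sqintZ.
under eq_fun do rewrite !mxE.
by apply: sqintD => //; exact: sqintZ.
Qed.

(** Only the approximation by test functions has to be checked: the weak
    gradient identity passes to the limit. *)
Lemma H10P y g : Sobolev_H10 Omega y g <->
  sqint1 y g /\ exists phi, (forall k, test (phi k)) /\ H1_cvg phi y g.
Proof.
have e1 phi : (forall k, test (phi k)) -> sq y ->
    (fun k => L2norm Omega (phi k \- y)) = (fun k => nrmO (fun x => phi k x - y x)).
  move=> tphi sy; apply/funext => k; apply: L2normE => //.
  by apply: sqintB => //; exact: test_sqint.
have e2 phi i : (forall k, test (phi k)) -> sq (fun x => g x ord0 i) ->
    (fun k => L2norm Omega (fun x => partial i (phi k) x - g x ord0 i)) =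
    (fun k => nrmO (fun x => partial i (phi k) x - g x ord0 i)).
  move=> tphi sg; apply/funext => k; apply: L2normE => //.
  by apply: sqintB => //; exact: test_partial_sqint.
split.
  move=> [[/(L2P mO) sy sg _] [phi [tphi c1 c2]]].
  have {}sg i : sq (fun x => g x ord0 i) by exact/(L2P mO).
  split => //; exists phi; split => //; split; first by rewrite -e1.
  by move=> i; rewrite -e2.
move=> [[sy sg] [phi [tphi [c1 c2]]]].
split; last first.
  exists phi; split => //; first by rewrite e1.
  by move=> i; rewrite e2.
split; [exact/(L2P mO)|by move=> i; exact/(L2P mO)|].
move=> f tf i.
have sf := test_sqint oO tf; have spf := test_partial_sqint oO i tf.
have l1 : ipO (phi k) (partial i f) @[k --> \oo] --> ipO y (partial i f).
  by apply: cvg_ip => // k; exact: test_sqint.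
have l2 : - ipO (partial i (phi k)) f @[k --> \oo] --> - ipO (fun x => g x ord0 i) f.
  by apply: cvgN; apply: cvg_ip => // k; exact: test_partial_sqint.
apply: cvgn_unique l1 _.
by under eq_fun do rewrite test_ibp //.
Qed.

Lemma H10_sqint1 y g : Sobolev_H10 Omega y g -> sqint1 y g.
Proof. by move=> /H10P[]. Qed.

Lemma H10_test f : test f -> Sobolev_H10 Omega f (gradient f).
Proof.
move=> tf; apply/H10P; split; first exact: gradient_sqint1.
exists (fun=> f); split => //; split.
  rewrite (_ : nrmO _ = 0); first exact: cvg_cst.
  by rewrite -(nrm0 mu mO); apply: eq_nrm => x _; rewrite subrr.
move=> i; rewrite (_ : nrmO _ = 0); first exact: cvg_cst.
by rewrite -(nrm0 mu mO); apply: eq_nrm => x _; rewrite mxE subrr.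
Qed.

Lemma cvg_nrm_lin (u w : nat -> V -> R) (a b : V -> R) t :
  (forall k, sq (u k)) -> (forall k, sq (w k)) -> sq a -> sq b ->
  nrmO (fun x => u k x - a x) @[k --> \oo] --> (0 : R) ->
  nrmO (fun x => w k x - b x) @[k --> \oo] --> (0 : R) ->
  nrmO (fun x => (u k x + t * w k x) - (a x + t * b x)) @[k --> \oo] --> (0 : R).
Proof.
move=> su sw sa sb ua wb.
have c : nrmO (fun x => u k x - a x) + `|t| * nrmO (fun x => w k x - b x)
    @[k --> \oo] --> (0 : R).
  rewrite -[X in _ --> X]addr0; apply: (cvgD ua).
  by rewrite -[X in _ --> X](mulr0 `|t|); exact: cvgn_mull.
apply: squeeze_cvgr (cvg_cst 0) c; apply: nearW => k; rewrite nrm_ge0 /=.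
have sua := sqintB mO (su k) sa; have swb := sqintB mO (sw k) sb.
rewrite -(nrmZ _ _ swb)//; apply: le_trans (nrmD mO sua (sqintZ mO t swb)).
rewrite le_eqVlt; apply/orP; left; apply/eqP/eq_nrm => x _; ring.
Qed.

Lemma H10_lin y g y' g' t : Sobolev_H10 Omega y g -> Sobolev_H10 Omega y' g' ->
  Sobolev_H10 Omega (fun x => y x + t * y' x) (fun x => g x + t *: g' x).
Proof.
move=> /H10P[s [p [tp [c1 c2]]]] /H10P[s' [p' [tp' [c1' c2']]]].
apply/H10P; split; first exact: sqint1_lin.
exists (fun k x => p k x + t * p' k x); split => [k|]; first exact: test_lin.
split.
  apply: cvg_nrm_lin => //; try (by move=> k; exact: test_sqint).
    by case: s.
  by case: s'.
move=> i; have -> : (fun k => nrmO (fun x =>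
    partial i (fun z => p k z + t * p' k z) x - (g x + t *: g' x) ord0 i)) =
  (fun k => nrmO (fun x => (partial i (p k) x + t * partial i (p' k) x) -
    (g x ord0 i + t * g' x ord0 i))).
  apply/funext => k; apply: eq_nrm => x _; rewrite partial_lin ?mxE//.
    exact: test_C1 (tp k).
  exact: test_C1 (tp' k).
apply: cvg_nrm_lin => //; try (by move=> k; exact: test_partial_sqint).
  by case: s.
by case: s'.
Qed.

(** By density of the test functions. *)
Lemma H10_poincare (i : 'I_n) (K : R) y g :
  (forall x, Omega x -> `|x| <= K) -> Sobolev_H10 Omega y g ->
  nrmO y <= 2 * K * nrmO (fun x => g x ord0 i).
Proof.
move=> OK /H10P[[sy sg] [p [tp [c1 c2]]]].
have lim (u : nat -> V -> R) w : (forall k, sq (u k)) -> sq w ->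
    nrmO (fun x => u k x - w x) @[k --> \oo] --> (0 : R) ->
    nrmO (u k) @[k --> \oo] --> nrmO w.
  move=> su sw; apply: (cvg_dominated (C := 1)) => k; rewrite mul1r.
  rewrite ler_norml; apply/andP; split.
    by have := nrm_le_dist mO sw (su k); rewrite nrm_distC; lra.
  by have := nrm_le_dist mO (su k) sw; lra.
have l1 := lim _ _ (fun k => test_sqint oO (tp k)) sy c1.
have l2 := lim _ _ (fun k => test_partial_sqint oO i (tp k)) (sg i) (c2 i).
have l3 := @cvgn_mull R (2 * K) _ _ l2.
apply: (@cvgn_le R (fun k => nrmO (p k)) (fun k => 2 * K * nrmO (partial i (p k))) _ _ _ l1 l3).
by move=> k; exact: (test_poincare oO i OK (tp k)).
Qed.

End H10.

Section elliptic_form.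
Context (R : realType) (n : nat).
Local Notation V := 'rV[R]_n.
Local Notation mu := (lebesgue_rV R n).
Variable Omega : set V.
Hypothesis oO : open Omega.
Let mO : measurable Omega := open_measurable_rV oO.
Variables (A : V -> 'M[R]_n) (c0 : V -> R).
Hypothesis hA : elliptic Omega A c0.
Local Notation sq := (sqint mu Omega).
Local Notation ipO := (ip mu Omega).
Local Notation nrmO := (nrm mu Omega).
Local Notation test := (test_function Omega).
Local Notation sqint1 := (sqint1 Omega).
Implicit Types (y v f : V -> R) (g gv : V -> V).

(** Split into inner products of scalar functions, so that its algebra is that of
    [ip]; [energyE] gives back the integral of the energy density. *)
Definition aform y g v gv : R :=
  \sum_(i < n) \sum_(j < n) ipO (fun x => g x ord0 i) (fun x => A x i j * gv x ord0 j)
  + ipO y (fun x => c0 x * v x).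

Lemma sqint_coef g i j : sq (fun x => g x ord0 j) -> sq (fun x => A x i j * g x ord0 j).
Proof. by apply: Linfty_sqintM => //; exact: (elliptic_coef_bounded hA). Qed.

Lemma sqint_c0 v : sq v -> sq (fun x => c0 x * v x).
Proof. by apply: Linfty_sqintM => //; exact: (elliptic_c0_bounded hA). Qed.

Lemma energyE y g v gv : sqint1 y g -> sqint1 v gv ->
  \int[mu]_(x in Omega) energy A c0 y g v gv x = aform y g v gv.
Proof.
move=> [sy sg] [sv sgv].
have i1 i j := sqint_mul mO (sg i) (sqint_coef i (sgv j)).
have i2 := sqint_mul mO sy (sqint_c0 sv).
have i3 i := integrable_Rsum mO (index_enum 'I_n) (fun j => i1 i j).
rewrite /aform; under eq_bigr => i _ do rewrite /ip -Rintegral_sum//.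
rewrite -Rintegral_sum// /ip -RintegralD//; last exact: integrable_Rsum.
apply: eq_Rintegral => x _; rewrite /energy; congr (_ + _); last by ring.
by apply: eq_bigr => i _; apply: eq_bigr => j _; ring.
Qed.

Lemma integrable_energy y g v gv : sqint1 y g -> sqint1 v gv ->
  mu.-integrable Omega (EFin \o energy A c0 y g v gv).
Proof.
move=> [sy sg] [sv sgv].
have i1 i j := sqint_mul mO (sg i) (sqint_coef i (sgv j)).
have i2 := sqint_mul mO sy (sqint_c0 sv).
have i3 i := integrable_Rsum mO (index_enum 'I_n) (fun j => i1 i j).
have := integrableD mO (integrable_Rsum mO (index_enum 'I_n) i3) i2.
apply: eq_integrable => // x _ /=; rewrite /energy; congr EFin.
congr (_ + _); last by ring.
by apply: eq_bigr => i _; apply: eq_bigr => j _; ring.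
Qed.

Lemma aform_lin y g y' g' v gv t : sqint1 y g -> sqint1 y' g' -> sqint1 v gv ->
  aform (fun x => y x + t * y' x) (fun x => g x + t *: g' x) v gv =
  aform y g v gv + t * aform y' g' v gv.
Proof.
move=> [sy sg] [sy' sg'] [sv sgv]; rewrite /aform mulrDr addrACA; congr (_ + _).
  rewrite mulr_sumr -big_split; apply: eq_bigr => i _ /=.
  rewrite mulr_sumr -big_split; apply: eq_bigr => j _ /=.
  have sA := sqint_coef i (sgv j).
  rewrite -ipZl// -ipDl//; last exact: sqintZ.
  by apply: eq_ip => // x _; rewrite !mxE.
have sC := sqint_c0 sv.
by rewrite -ipZl// -ipDl//; exact: sqintZ.
Qed.

Lemma aformC y g v gv : sqint1 y g -> sqint1 v gv ->
  aform y g v gv = aform v gv y g.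
Proof.
move=> h1 h2; rewrite -!energyE//; apply: ae_eq_Rintegral => //.
- by apply/measurable_EFinP; exact: measurable_int (integrable_energy h1 h2).
- by apply/measurable_EFinP; exact: measurable_int (integrable_energy h2 h1).
apply: filterS (elliptic_sym hA) => x /[apply] Asym.
rewrite /energy; congr (_ + _); last by ring.
rewrite exchange_big; apply: eq_bigr => i _; apply: eq_bigr => j _.
by rewrite Asym; ring.
Qed.

Lemma aform_coercive (theta : R) : 0 < theta ->
  {ae mu, forall x, Omega x -> forall xi : V, theta * enorm xi ^+ 2 <=
      \sum_(i < n) \sum_(j < n) A x i j * xi ord0 i * xi ord0 j} ->
  forall y g, sqint1 y g ->
  theta * (\sum_(i < n) ipO (fun x => g x ord0 i) (fun x => g x ord0 i)) <=
  aform y g y g.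
Proof.
move=> t0 Ath y g hy; have [sy sg] := hy.
have i1 i := sqint_mul mO (sg i) (sg i).
rewrite /ip -Rintegral_sum// -RintegralZl//; last exact: integrable_Rsum.
rewrite -energyE//; apply: ae_le_Rintegral => //.
- have := integrableZl mO theta (integrable_Rsum mO (index_enum 'I_n) i1).
  by apply: eq_integrable => // x _ /=; rewrite EFinM.
- exact: integrable_energy.
apply: filterS2 Ath (elliptic_c0_ge0 hA) => x + + Ox => /(_ Ox) Ax /(_ Ox) cx.
rewrite /energy; apply: ler_wpDr.
  by rewrite -mulrA mulr_ge0// -expr2 sqr_ge0.
apply: le_trans (Ax (g x)); rewrite /enorm sqr_sqrtr//.
by apply: sumr_ge0 => i _; rewrite -expr2 sqr_ge0.
Qed.

Lemma aform_ge0 y g : sqint1 y g -> 0 <= aform y g y g.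
Proof.
move=> hy; have [theta t0 Ath] := elliptic_coercive hA.
apply: le_trans (aform_coercive t0 Ath hy).
by apply: mulr_ge0; [exact: ltW|apply: sumr_ge0 => i _; exact: ip_ge0].
Qed.

Lemma cvg_aform phi y g v gv : (forall k, test (phi k)) -> sqint1 y g ->
  sqint1 v gv -> H1_cvg Omega phi y g ->
  aform (phi k) (gradient (phi k)) v gv @[k --> \oo] --> aform y g v gv.
Proof.
move=> tp [sy sg] [sv sgv] [c1 c2]; apply: cvgD.
  apply: cvgn_sum => i; apply: cvgn_sum => j; apply: cvg_ip => //.
  - by move=> k; have [_] := gradient_sqint1 oO (tp k); apply.
  - exact: sqint_coef.
  - have := c2 i; under [X in _ -> X @ _ --> _]eq_fun do under eq_fun do rewrite mxE.
    exact.
apply: cvg_ip => //; last exact: sqint_c0.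
by move=> k; exact: test_sqint.
Qed.

Lemma weak_solutionP f y g : weak_solution Omega A c0 f y g <->
  Sobolev_H10 Omega y g /\ forall v gv, Sobolev_H10 Omega v gv ->
    aform y g v gv = ipO f v.
Proof.
split=> -[hy hw]; split=> // v gv hv; have := hw v gv hv; rewrite energyE//;
  by [exact: H10_sqint1 hy|exact: H10_sqint1 hv].
Qed.

Lemma weak_solution_lin f f' y g y' g' t : sq f -> sq f' ->
  weak_solution Omega A c0 f y g -> weak_solution Omega A c0 f' y' g' ->
  weak_solution Omega A c0 (fun x => f x + t * f' x)
    (fun x => y x + t * y' x) (fun x => g x + t *: g' x).
Proof.
move=> sf sf' /weak_solutionP[hy wy] /weak_solutionP[hy' wy'].
apply/weak_solutionP; split; first exact: H10_lin.
move=> v gv hv; have [sv _] := H10_sqint1 oO hv.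
rewrite aform_lin; try exact: (H10_sqint1 oO).
by rewrite wy// wy'// -ipZl// -ipDl//; exact: sqintZ.
Qed.

Lemma weak_solution0 : weak_solution Omega A c0 (fun=> 0) (fun=> 0) (fun=> 0).
Proof.
have h0 : Sobolev_H10 Omega (fun=> 0 : R) (fun=> 0 : V).
  have := H10_test oO (test0 Omega).
  congr Sobolev_H10; apply/funext => x; apply/rowP => i; rewrite !mxE.
  exact: derive_cst.
apply/weak_solutionP; split => // v gv hv.
have [sv sgv] := H10_sqint1 oO hv; have z u : sq u -> ipO (fun=> 0) u = 0.
  move=> su; transitivity (ipO (fun x => 0 * u x) u); last by rewrite ipZl// mul0r.
  by apply: eq_ip => // x _; rewrite mul0r.
rewrite /aform z; last exact: sqint_c0.
rewrite z// addr0 big1// => i _; rewrite big1// => j _.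
rewrite -[RHS](z _ (sqint_coef i (sgv j))).
by apply: eq_ip => // x _; rewrite mxE.
Qed.

Section existence.
Variables (i0 : 'I_n) (K : R).
Hypothesis OK : forall x, Omega x -> `|x| <= K.

(** Lax-Milgram for the symmetric form: a minimising sequence of the energy
    [a(phi, phi) - 2 (f, phi)] over test functions is Cauchy, because its first
    variation at [phi_k] is controlled by the defect [J phi_k - inf J]. *)
Lemma weak_solution_exists f : sq f ->
  exists y g, weak_solution Omega A c0 f y g.
Proof.
move=> sf; have [theta t0 Ath] := elliptic_coercive hA.
pose a phi psi := aform phi (gradient phi) psi (gradient psi).
have alin phi psi chi t : test phi -> test psi -> test chi ->
    a (fun x => phi x + t * psi x) chi = a phi chi + t * a psi chi.
  move=> t1 t2 t3; rewrite /a -aform_lin; try exact: gradient_sqint1.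
  congr aform; apply/funext => x; apply/rowP => i; rewrite !mxE.
  by rewrite partial_lin//; [exact: (test_C1 t1)|exact: (test_C1 t2)].
have aC phi psi : test phi -> test psi -> a phi psi = a psi phi.
  by move=> t1 t2; apply: aformC; exact: gradient_sqint1.
have co phi i : test phi -> theta * ipO (partial i phi) (partial i phi) <= a phi phi.
  move=> tp; apply: le_trans (aform_coercive t0 Ath (gradient_sqint1 oO tp)).
  rewrite ler_pM2l// (bigD1 i)//=.
  rewrite (@eq_ip _ _ _ mu Omega (partial i phi) (fun x => gradient phi x ord0 i)
     (partial i phi) (fun x => gradient phi x ord0 i)); try by move=> x _; rewrite mxE.
  by rewrite lerDl sumr_ge0// => j _; exact: ip_ge0.
pose P := (2 * K) ^+ 2 / theta.
have co0 phi : test phi -> ipO phi phi <= P * a phi phi.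
  move=> tp; rewrite -nrm_sq.
  apply: (@le_trans _ _ ((2 * K * nrmO (partial i0 phi)) ^+ 2)).
    rewrite ler_sqr ?nnegrE ?nrm_ge0//; first exact: test_poincare.
    exact: le_trans (nrm_ge0 _ _ _) (test_poincare oO i0 OK tp).
  rewrite exprMn nrm_sq /P -mulrA ler_wpM2l ?sqr_ge0//.
  by rewrite ler_pdivlMl//; exact: co.
have a0 phi : test phi -> 0 <= a phi phi.
  by move=> tp; apply: aform_ge0; exact: gradient_sqint1.
pose J phi := a phi phi - 2 * ipO f phi.
pose B := ipO f f * P.
have JB phi : test phi -> - B <= J phi.
  move=> tp; have := ip_sq_le mO sf (test_sqint oO tp).
  move=> /le_trans/(_ (ler_wpM2l (ip_ge0 _ _ _) (co0 _ tp))).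
  rewrite mulrA -/B /J; have := a0 _ tp; move: (a phi phi) (ipO f phi) => q l q0 lB.
  have B0 : 0 <= B by rewrite mulr_ge0 ?ip_ge0// divr_ge0 ?sqr_ge0// ltW.
  have : `|2 * l| <= q + B.
    rewrite -(@ler_pXn2r _ 2)// ?nnegrE ?addr_ge0// real_normK ?num_real//.
    have := sqr_ge0 (q - B); nra.
  by rewrite ler_norml => /andP[_]; lra.
pose E := [set J phi | phi in test].
have hE : has_inf E.
  split; first by exists (J (fun=> 0)), (fun=> 0) => //; exact: test0.
  by exists (- B) => _ [phi tp <-]; exact: JB.
have /choice[p Hp] : forall k : nat, exists phi,
    test phi /\ J phi < inf E + k.+1%:R^-1.
  move=> k; have [] := @inf_adherent _ E k.+1%:R^-1 _ hE; first by rewrite invr_gt0.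
  by move=> _ [phi tp <-] Jp; exists phi.
have tp k : test (p k) by case: (Hp k).
(* the first variation at p k, bounded by the discriminant of
   t |-> J (p k + t psi) - inf E *)
pose r k psi := a (p k) psi - ipO f psi.
have rk k psi : test psi -> r k psi ^+ 2 <= a psi psi * k.+1%:R^-1.
  move=> tpsi; apply: discriminant_le => [|t]; first exact: a0.
  have tt := test_lin t (tp k) tpsi.
  have : inf E <= J (fun x => p k x + t * psi x).
    by apply: ge_inf; [case: hE|exists (fun x => p k x + t * psi x)].
  have := (Hp k).2; rewrite /J alin// (aC (p k) _)// (aC psi _)// !alin//.
  have sp := test_sqint oO (tp k); have spsi := test_sqint oO tpsi.
  rewrite ipDr ?ipZr//; last exact: sqintZ.
  rewrite (aC psi (p k))// /r; move: (inf E) => m.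
  move: (a _ _) (a _ psi) (ipO f _) (ipO f psi) (a psi psi) (k.+1%:R^-1).
  move=> *; nra.
pose dd k l x := p k x + (-1) * p l x.
have tdd k l : test (dd k l) by exact: test_lin.
have add k l : a (dd k l) (dd k l) <= 2 * (k.+1%:R^-1 + l.+1%:R^-1).
  have h1 := rk k _ (tdd k l); have h2 := rk l _ (tdd k l).
  have h3 : a (dd k l) (dd k l) = r k (dd k l) - r l (dd k l).
    by rewrite [LHS]alin// /r; ring.
  have h4 := a0 _ (tdd k l).
  have [->|an0] := eqVneq (a (dd k l) (dd k l)) 0.
    by rewrite mulr_ge0// addr_ge0// invr_ge0.
  have ap : 0 < a (dd k l) (dd k l) by rewrite lt_def an0.
  rewrite -(ler_pM2l ap); move: h1 h2 h3.
  move: (r k _) (r l _) (a _ _) (k.+1%:R^-1) (l.+1%:R^-1) => x z q e1 e2 h1 h2 h3.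
  have := sqr_ge0 (x + z); rewrite {1}h3; nra.
have cau Q (D : (V -> R) -> V -> R) : 0 <= Q ->
    (forall k l, ipO (fun x => D (p k) x - D (p l) x) (fun x => D (p k) x - D (p l) x)
       <= Q * a (dd k l) (dd k l)) ->
    forall e, 0 < e -> exists N, forall k l, (N <= k)%N -> (N <= l)%N ->
      ipO (fun x => D (p k) x - D (p l) x) (fun x => D (p k) x - D (p l) x) <= e.
  move=> Q0 HD e e0; exists (Num.bound (4 * Q / e)) => k l Nk Nl.
  apply: le_trans (HD k l) _.
  apply: le_trans (ler_wpM2l Q0 (add k l)) _.
  have bnd m : (Num.bound (4 * Q / e) <= m)%N -> 4 * Q * m.+1%:R^-1 <= e.
    move=> Nm; rewrite ler_pdivrMr// [leRHS]mulrC -ler_pdivrMr//.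
    apply: le_trans (ltW (archi_boundP _)) _; first by rewrite divr_ge0 ?mulr_ge0// ltW.
    by rewrite ler_nat leqW.
  have := bnd _ Nk; have := bnd _ Nl.
  by move: (k.+1%:R^-1) (l.+1%:R^-1) => s t; nra.
have P0 : 0 <= P by rewrite divr_ge0 ?sqr_ge0// ltW.
have [y sy cy] : exists2 y, sq y & nrmO (fun x => p k x - y x) @[k --> \oo] --> (0 : R).
  apply: riesz_fischer => //; first by move=> k; exact: test_sqint.
  apply: (cau P (fun f => f) P0) => k l; apply: le_trans (co0 _ (tdd k l)).
  rewrite le_eqVlt; apply/orP; left; apply/eqP.
  by apply: eq_ip => x _; rewrite /dd mulN1r.
have /choice[gg Hg] : forall i, exists gi, sq gi /\
    nrmO (fun x => partial i (p k) x - gi x) @[k --> \oo] --> (0 : R).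
  move=> i.
  have [|gi s c] := riesz_fischer mO (fun k => test_partial_sqint oO i (tp k)).
    apply: (cau theta^-1 (partial i)); first by rewrite invr_ge0 ltW.
    move=> k l; rewrite ler_pdivlMl//; apply: le_trans (co _ i (tdd k l)).
    rewrite ler_pM2l// le_eqVlt; apply/orP; left; apply/eqP.
    by apply: eq_ip => x _; rewrite /dd partial_lin ?mulN1r//;
      by [exact: test_C1 (tp k)|exact: test_C1 (tp l)].
  by exists gi.
pose g x : V := \row_i gg i x.
have sg : sqint1 y g.
  by split=> // i; under eq_fun do rewrite mxE; case: (Hg i).
have cg : H1_cvg Omega p y g.
  split=> // i; have [_] := Hg i.
  by under [X in _ -> X @ _ --> _]eq_fun do under eq_fun do rewrite mxE.
have hyg : Sobolev_H10 Omega y g by apply/(H10P oO); split=> //; exists p.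
exists y, g; apply/weak_solutionP; split=> //.
have wt psi : test psi -> aform y g psi (gradient psi) = ipO f psi.
  move=> tpsi; apply: cvgn_unique (cvg_aform tp sg (gradient_sqint1 oO tpsi) cg) _.
  apply: (cvg_dominated (C := Num.sqrt (a psi psi))
    (b := fun k => Num.sqrt (k.+1%:R^-1))) => [k|].
    rewrite -sqrtrM ?a0// -[leLHS]ger0_norm// -sqrtr_sqr ler_wsqrtr//.
    by rewrite real_normK ?num_real//; exact: rk.
  rewrite -[X in _ --> X]sqrtr0; apply: continuous_cvg (@cvg_harmonic R).
  exact: sqrt_continuous.
move=> v gv /[dup] hv /(H10P oO)[sv [psi [tpsi cpsi]]].
rewrite aformC//.
apply: cvgn_unique (cvg_aform tpsi sv sg cpsi) _.
have -> : (fun k => aform (psi k) (gradient (psi k)) y g) = (fun k => ipO (psi k) f).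
  apply/funext => k; rewrite aformC//; last exact: gradient_sqint1.
  by rewrite wt// ipC.
rewrite ipC; apply: cvg_ip => //; first by move=> k; exact: test_sqint.
  by case: sv.
by case: cpsi.
Qed.

End existence.

End elliptic_form.

(** * Barycentric coordinates *)

Section affine.
Context (R : realType) (n : nat).
Local Notation V := 'rV[R]_n.

Lemma dotvDr (d x y : V) : dotv d (x + y) = dotv d x + dotv d y.
Proof. by rewrite /dotv -big_split; apply: eq_bigr => i _; rewrite !mxE mulrDr. Qed.

Lemma dotvZr (d x : V) t : dotv d (t *: x) = t * dotv d x.
Proof. by rewrite /dotv mulr_sumr; apply: eq_bigr => i _; rewrite !mxE mulrCA. Qed.

Lemma dotvDl (d d' x : V) : dotv (d + d') x = dotv d x + dotv d' x.
Proof. by rewrite /dotv -big_split; apply: eq_bigr => i _; rewrite !mxE mulrDl. Qed.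

Lemma dotvZl (d x : V) t : dotv (t *: d) x = t * dotv d x.
Proof. by rewrite /dotv mulr_sumr; apply: eq_bigr => i _; rewrite !mxE mulrA. Qed.

Lemma dotv_sumr (I : Type) (s : seq I) (F : I -> V) d :
  dotv d (\sum_(i <- s) F i) = \sum_(i <- s) dotv d (F i).
Proof.
elim: s => [|i s IH]; last by rewrite !big_cons dotvDr IH.
by rewrite !big_nil /dotv big1// => i _; rewrite mxE mulr0.
Qed.

Lemma dotv_ge0 (x : V) : 0 <= dotv x x.
Proof. by apply: sumr_ge0 => i _; rewrite -expr2 sqr_ge0. Qed.

Lemma enorm_sq (x : V) : enorm x ^+ 2 = dotv x x.
Proof. by rewrite sqr_sqrtr// dotv_ge0. Qed.

Lemma enorm_ge0 (x : V) : 0 <= enorm x. Proof. exact: sqrtr_ge0. Qed.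

Lemma enormN (x : V) : enorm (- x) = enorm x.
Proof. by congr Num.sqrt; apply: eq_bigr => i _; rewrite !mxE mulrNN. Qed.

Lemma dotv_le (x y : V) : `|dotv x y| <= enorm x * enorm y.
Proof.
rewrite -(@ler_pXn2r _ 2)// ?nnegrE ?mulr_ge0 ?enorm_ge0//.
rewrite exprMn real_normK ?num_real// !enorm_sq mulrC.
apply: discriminant_le => [|t]; first exact: dotv_ge0.
have := dotv_ge0 (x + t *: y); rewrite !(dotvDl, dotvDr, dotvZl, dotvZr).
have -> : dotv y x = dotv x y by apply: eq_bigr => i _; rewrite mulrC.
by congr (0 <= _); ring.
Qed.

Lemma enormD (x y : V) : enorm (x + y) <= enorm x + enorm y.
Proof.
rewrite -(@ler_pXn2r _ 2)// ?nnegrE ?addr_ge0 ?enorm_ge0//.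
rewrite sqrrD !enorm_sq !(dotvDl, dotvDr).
have -> : dotv y x = dotv x y by apply: eq_bigr => i _; rewrite mulrC.
have := le_trans (ler_norm _) (dotv_le x y); rewrite mulr2n; lra.
Qed.

Lemma continuous_dotv (d : V) : continuous (dotv d).
Proof.
rewrite /dotv; elim: (index_enum 'I_n) => [|i s IH] x; rewrite /continuous_at.
  rewrite big_nil; under eq_fun do rewrite big_nil.
  exact: (@cst_continuous _ _ (0 : R) x).
rewrite big_cons; under eq_fun do rewrite big_cons.
apply: cvgD (IH x); apply: (cvgM (cvg_cst _)); exact: coord_continuous.
Qed.

Lemma partial_affine (k : R) (d : V) (v : V -> R) x i :
  (\forall y \near x, v y = k + dotv d y) -> partial i v x = d ord0 i.
Proof.
move=> vd; rewrite /partial (near_eq_derive _ vd) /derive.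
rewrite (_ : (fun h : R => _) = (fun h => h^-1 * (h * d ord0 i))).
  apply: lim_near_cst => //; near=> h; rewrite mulKf//.
  by near: h; exact: nbhs_dnbhs_neq.
apply/funext => h /=; congr (_ * _).
rewrite dotvDr dotvZr addrCA addrK; congr (_ * _).
rewrite /dotv (bigD1 i)//= mxE !eqxx mulr1 big1 ?addr0// => j ji.
by rewrite mxE (negbTE ji) andbF mulr0.
Unshelve. all: by end_near. Qed.

End affine.

Section simplex.
Context (R : realType) (n : nat).
Hypothesis n0 : (0 < n)%N.
Local Notation V := 'rV[R]_n.
Local Notation mu := (lebesgue_rV R n).
Implicit Types (T : n.+1.-tuple V).

Lemma cast_ord_bij m k (e : m = k) : bijective (cast_ord e).
Proof. by exists (cast_ord (esym e)); [exact: cast_ordK|exact: cast_ordKV]. Qed.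

Lemma hullE T x : hull T x <-> exists l : 'I_n.+1 -> R,
  [/\ forall i, 0 <= l i, \sum_i l i = 1 & x = \sum_i l i *: tnth T i].
Proof.
have e := size_tuple T; split => -[l [l0 l1 ->]].
  exists (fun i => l (cast_ord (esym e) i)); split => //.
    by rewrite -l1 [RHS](reindex (cast_ord (esym e)))//; exact/onW_bij/cast_ord_bij.
  rewrite (reindex (cast_ord (esym e))); last exact/onW_bij/cast_ord_bij.
  by apply: eq_bigr => i _; rewrite (tnth_nth 0).
exists (fun i => l (cast_ord e i)); split => //.
  by rewrite -l1 [RHS](reindex (cast_ord e))//; exact/onW_bij/cast_ord_bij.
rewrite (reindex (cast_ord e)); last exact/onW_bij/cast_ord_bij.
by apply: eq_bigr => i _; rewrite (tnth_nth 0).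
Qed.

(** A row of weights times this matrix collects the sum of the weights and the
    weighted sum of the vertices. *)
Definition vertex_mx T : 'M[R]_n.+1 := \matrix_(i < n.+1) rV_cons (1, tnth T i).

Lemma mul_vertex_mx T (c : 'rV[R]_n.+1) : c *m vertex_mx T =
  rV_cons (\sum_i c ord0 i, \sum_i c ord0 i *: tnth T i).
Proof.
apply/rowP => j; rewrite [LHS]mxE.
under eq_bigr do rewrite [X in _ * X]mxE.
case: (unliftP ord0 j) => [k|] ->; rewrite ?rV_consS ?rV_cons0 /=.
  by rewrite summxE; apply: eq_bigr => i _; rewrite rV_consS mxE.
by apply: eq_bigr => i _; rewrite rV_cons0 mulr1.
Qed.

Lemma rV_cons_inj : injective (@rV_cons R n).
Proof. exact: can_inj (@rV_consK R n). Qed.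

(** A linear relation between the rows is an affine relation between the vertices,
    which the freeness of the edges excludes. *)
Lemma vertex_mx_unit T : free [seq x - thead T | x <- behead T] ->
  vertex_mx T \in unitmx.
Proof.
move=> fT; rewrite -row_free_unit -kermx_eq0; apply/eqP/row_matrixP => r.
rewrite row0; set c := row r _.
have : c *m vertex_mx T = 0 by rewrite -row_mul mulmx_ker row0.
rewrite mul_vertex_mx => e.
have s0 : \sum_i c ord0 i = 0.
  by have /rowP/(_ ord0) := e; rewrite rV_cons0 mxE.
have sv : \sum_i c ord0 i *: tnth T i = 0.
  apply/rowP => k; have /rowP/(_ (lift ord0 k)) := e.
  by rewrite rV_consS /= !mxE.
have : free (map_tuple (fun x => x - thead T) (behead_tuple T)) by [].
move=> /freeP/(_ (fun i => c ord0 (lift ord0 i))) ci.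
have cS i : c ord0 (lift ord0 i) = 0.
  apply: ci; move: sv; rewrite big_ord_recl => sv.
  transitivity (\sum_(j < n) (c ord0 (lift ord0 j) *: tnth T (lift ord0 j) -
      c ord0 (lift ord0 j) *: thead T)).
    apply: eq_bigr => j _; rewrite -scalerBr -tnth_nth tnth_map.
    by rewrite tnth_behead /=; congr (_ *: (tnth T _ - _)); apply/val_inj; rewrite /= inordK// ltnS.
  rewrite sumrB -scaler_suml; move: s0; rewrite big_ord_recl => /eqP.
  by rewrite addrC addr_eq0 => /eqP ->; rewrite scaleNr opprK addrC.
apply/rowP => i; rewrite [RHS]mxE.
case: (unliftP ord0 i) => [j|] ->; first exact: cS.
by move: s0; rewrite big_ord_recl big1 ?addr0.
Qed.

Definition bary T (x : V) : 'rV[R]_n.+1 :=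
  rV_cons (1, x) *m invmx (vertex_mx T).

Section bary.
Variable T : n.+1.-tuple V.
Hypothesis fT : free [seq x - thead T | x <- behead T].

Lemma bary_sum x : \sum_i bary T x ord0 i = 1.
Proof.
have := mul_vertex_mx T (bary T x); rewrite {1}/bary mulmxKV ?vertex_mx_unit// => e.
by have [<- _] := rV_cons_inj e.
Qed.

Lemma bary_vec x : x = \sum_i bary T x ord0 i *: tnth T i.
Proof.
have := mul_vertex_mx T (bary T x); rewrite {1}/bary mulmxKV ?vertex_mx_unit// => e.
by have [_ <-] := rV_cons_inj e.
Qed.

Lemma bary_uniq (l : 'I_n.+1 -> R) : \sum_i l i = 1 ->
  bary T (\sum_i l i *: tnth T i) = \row_i l i.
Proof.
move=> l1; rewrite -[RHS](mulmxK (vertex_mx_unit fT)) mul_vertex_mx; congr (_ *m _).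
congr rV_cons; congr pair; last by apply: eq_bigr => i _; rewrite mxE.
by rewrite -l1; apply: eq_bigr => i _; rewrite mxE.
Qed.

Lemma hull_bary x : hull T x <-> forall i, 0 <= bary T x ord0 i.
Proof.
rewrite hullE; split => [[l [l0 l1 ->]] i|H].
  by rewrite bary_uniq// mxE.
by exists (fun i => bary T x ord0 i); rewrite bary_sum -bary_vec.
Qed.

Lemma bary_vertex j i : bary T (tnth T j) ord0 i = (i == j)%:R.
Proof.
have s1 : \sum_(i < n.+1) (i == j)%:R = 1 :> R.
  by rewrite (bigD1 j)//= eqxx big1 ?addr0// => k /negbTE ->.
have := bary_uniq s1.
rewrite (bigD1 j)//= eqxx scale1r big1 ?addr0; last first.
  by move=> k /negbTE ->; rewrite scale0r.
by move=> ->; rewrite mxE.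
Qed.

(** The gradient of a barycentric coordinate. *)
Definition bary_dir i : V := \row_j invmx (vertex_mx T) (lift ord0 j) i.

Lemma bary_affine i x :
  bary T x ord0 i = invmx (vertex_mx T) ord0 i + dotv (bary_dir i) x.
Proof.
rewrite /bary mxE big_ord_recl rV_cons0 mul1r; congr (_ + _).
by apply: eq_bigr => j _; rewrite rV_consS mxE mulrC.
Qed.

Lemma bary_dir_neq0 i : bary_dir i != 0.
Proof.
have [j ji] : exists j : 'I_n.+1, j != i.
  case: (unliftP ord0 i) => [k|] ->; first by exists ord0; exact: neq_lift.
  by exists (lift ord0 (Ordinal n0)); rewrite eq_sym neq_lift.
apply/eqP => d0; have := bary_vertex i i; have := bary_vertex j i.
rewrite !bary_affine d0 eqxx eq_sym (negbTE ji) /dotv.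
rewrite !big1; try by move=> k _; rewrite mxE mul0r.
by move=> -> /eqP; rewrite eq_sym oner_eq0.
Qed.

Lemma bary_neq0_ae : {ae mu, forall x, forall i, bary T x ord0 i != 0}.
Proof.
apply: filter_forall => i.
exists [set x | dotv (bary_dir i) x = - invmx (vertex_mx T) ord0 i].
split.
- rewrite -[X in measurable X]setTI.
  by have := @measurable_dotv R n (bary_dir i) measurableT _
    (measurable_set1 (- invmx (vertex_mx T) ord0 i)).
- by apply: lebesgue_rV_hyperplane; exact: bary_dir_neq0.
- move=> x /= /negP; rewrite negbK bary_affine addr_eq0 => /eqP ->.
  by rewrite opprK.
Qed.

Lemma bary_continuous i : continuous (fun x => bary T x ord0 i).
Proof.
move=> x; rewrite /continuous_at bary_affine; under eq_fun do rewrite bary_affine.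
exact: (cvgD (@cst_continuous _ _ _ x) (@continuous_dotv R n (bary_dir i) x)).
Qed.

Lemma bary_gt0_interior x : (forall i, 0 < bary T x ord0 i) -> interior (hull T) x.
Proof.
move=> x0; rewrite /interior; near=> y; apply/hull_bary => i.
apply: ltW; move: i; near: y; apply: filter_forall => i.
exact: (cvgr_gt _ (@bary_continuous i x) _ (x0 i)).
Unshelve. all: by end_near. Qed.

Lemma vertex_hull i : hull T (tnth T i).
Proof. by apply/hull_bary => j; rewrite bary_vertex ler0n. Qed.

(** The segment from a point of the simplex to the barycentre runs in the
    interior. *)
Lemma hull_closure_interior : hull T `<=` closure (interior (hull T)).
Proof.
move=> x hx; pose g : V := \sum_(i < n.+1) n.+1%:R^-1 *: tnth T i.
have s1 : \sum_(i < n.+1) n.+1%:R^-1 = 1 :> R.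
  by rewrite sumr_const card_ord -[_ *+ _]mulr_natr mulVf// pnatr_eq0.
have inI t : 0 < t -> t <= 1 -> interior (hull T) ((1 - t) *: x + t *: g).
  move=> t0 t1; apply: bary_gt0_interior => i.
  have -> : (1 - t) *: x + t *: g =
      \sum_i ((1 - t) * bary T x ord0 i + t * n.+1%:R^-1) *: tnth T i.
    rewrite {1}(bary_vec x) /g !scaler_sumr -big_split; apply: eq_bigr => j _ /=.
    by rewrite !scalerA -scalerDl.
  rewrite bary_uniq.
    rewrite mxE ltr_wpDl//; last by rewrite mulr_gt0// invr_gt0.
    by rewrite mulr_ge0 ?subr_ge0//; exact: (hull_bary x).1.
  by rewrite big_split -!mulr_sumr /= s1 bary_sum; ring.
have cv : (1 - t) *: x + t *: g @[t --> (0 : R)^'+] --> x.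
  rewrite -[X in _ --> X](_ : (1 - 0) *: x + 0 *: g = x); last first.
    by rewrite subr0 scale1r scale0r addr0.
  apply: cvg_at_right_filter; apply: cvgD; apply: cvgZr_tmp.
    by apply: cvgB; [exact: cvg_cst|exact: cvg_id].
  exact: cvg_id.
apply: closed_cvg (cv); first exact: closed_closure.
near=> t; apply: subset_closure; apply: inI => //.
near: t; exact: nbhs_right_le.
Unshelve. all: by end_near. Qed.

End bary.

End simplex.

(** * Finite element functions *)

Section mesh.
Context (R : realType) (n : nat).
Hypothesis n0 : (0 < n)%N.
Local Notation V := 'rV[R]_n.
Local Notation mu := (lebesgue_rV R n).
Variable Omega : set V.
Hypothesis oO : open Omega.
Hypothesis bO : bounded_set Omega.
Let mO : measurable Omega := open_measurable_rV oO.
Variable K : seq (n.+1.-tuple V).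
Hypothesis fK : forall T : n.+1.-tuple V, T \in K ->
  free [seq x - thead T | x <- behead T].
Hypothesis KO : mesh_domain K `<=` Omega.
Implicit Types (T : n.+1.-tuple V) (v w : V -> R).
Local Notation Yh := (Yh Omega K).

Lemma enorm_hull_diff T x y : hull T x -> hull T y ->
  enorm (x - y) <= diameter (hull T).
Proof.
move=> hx hy; apply: sup_ubound; last by exists (x, y).
pose M := \sum_i enorm (tnth T i).
have bnd z : hull T z -> enorm z <= M.
  move=> /hullE[l [l0 l1 ->]].
  have l_le1 i : l i <= 1.
    by rewrite -l1 (bigD1 i)//= lerDl sumr_ge0.
  have aux (s : seq 'I_n.+1) : enorm (\sum_(i <- s) l i *: tnth T i) <=
      \sum_(i <- s) enorm (tnth T i).
    elim: s => [|i s IH].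
      by rewrite !big_nil /enorm /dotv big1 ?sqrtr0// => i _; rewrite mxE mul0r.
    rewrite !big_cons; apply: le_trans (enormD _ _) (lerD _ IH).
    rewrite /enorm dotvZl dotvZr mulrA -expr2 sqrtrM ?sqr_ge0// sqrtr_sqr.
    by rewrite ger0_norm// ler_piMl// sqrtr_ge0.
  exact: aux.
exists (M + M) => _ [[z z'] [/= hz hz'] <-].
by apply: le_trans (enormD _ _) _; rewrite enormN lerD ?bnd.
Qed.

Lemma interior_hull_mesh T : T \in K -> interior (hull T) `<=` mesh_domain K.
Proof.
move=> TK; apply: interiorS => x hx; exists T => //.
Qed.

Lemma hull_closure_domain T : T \in K -> hull T `<=` closure Omega.
Proof.
move=> TK x /(hull_closure_interior (fK TK)); apply: closure_subset.
by move=> y /(interior_hull_mesh TK)/KO.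
Qed.

Lemma affine_hull T v (l : 'I_n.+1 -> R) : T \in K -> affine_on (hull T) v ->
  (forall i, 0 <= l i) -> \sum_i l i = 1 ->
  v (\sum_i l i *: tnth T i) = \sum_i l i * v (tnth T i).
Proof.
move=> TK [k [d vE]] l0 l1; rewrite vE; last by apply/hullE; exists l.
rewrite [RHS](eq_bigr (fun i => k * l i + dotv d (l i *: tnth T i))).
  by rewrite big_split /= -mulr_sumr l1 mulr1 dotv_sumr.
by move=> i _; rewrite vE ?dotvZr ?mulrDr ?(mulrC k)//; exact: vertex_hull (fK TK) _.
Qed.

Lemma vertex_nodes T i : T \in K ->
  (tnth T i \in nodes K) = (tnth T i \in mesh_domain K).
Proof.
move=> TK; rewrite mem_filter mem_undup andbC.
suff -> : tnth T i \in flatten [seq tval T0 | T0 <- K] by [].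
by apply/flattenP; exists (tval T); [exact: map_f|exact: mem_tnth].
Qed.

Lemma vertex_eq0 T i v : T \in K -> Yh v -> tnth T i \notin nodes K ->
  v (tnth T i) = 0.
Proof.
move=> TK [_ _ v0]; rewrite vertex_nodes// notin_setE => Ti; apply: v0 => //.
exact: (hull_closure_domain TK (vertex_hull (fK TK) _)).
Qed.

Lemma nodes_closure p : p \in nodes K -> closure Omega p.
Proof.
by rewrite mem_filter => /andP[/set_mem /KO Op _]; exact: subset_closure.
Qed.

Lemma uniq_nodes : uniq (nodes K).
Proof. by rewrite filter_uniq// undup_uniq. Qed.

Section nodal_basis.
Variable phi : V -> V -> R.
Hypothesis hphi : nodal_basis Omega K phi.

Lemma phi_Yh p : p \in nodes K -> Yh (phi p).
Proof. by move=> /hphi[]. Qed.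

Lemma vertex_sum (c : V -> R) T i : T \in K ->
  \sum_(p <- nodes K) c p * phi p (tnth T i) =
  if tnth T i \in nodes K then c (tnth T i) else 0.
Proof.
move=> TK; case: ifPn => Ti.
  rewrite (bigD1_seq (tnth T i))//=; last exact: uniq_nodes.
  have [_ ->//] := hphi Ti; rewrite eqxx mulr1 big_seq_cond big1 ?addr0//.
  move=> p /andP[pK pT]; have [_ ->//] := hphi pK.
  by rewrite eq_sym (negbTE pT) mulr0.
rewrite big_seq big1// => p /phi_Yh Yp.
by rewrite (vertex_eq0 TK Yp Ti) mulr0.
Qed.

Lemma nodal_sum_hull (c : V -> R) T (l : 'I_n.+1 -> R) : T \in K ->
  (forall i, 0 <= l i) -> \sum_i l i = 1 ->
  \sum_(p <- nodes K) c p * phi p (\sum_i l i *: tnth T i) =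
  \sum_i l i * (if tnth T i \in nodes K then c (tnth T i) else 0).
Proof.
move=> TK l0 l1; transitivity (\sum_(p <- nodes K) c p *
    \sum_i l i * phi p (tnth T i)).
  apply: eq_big_seq => p /phi_Yh[_ ap _]; congr (_ * _).
  by apply: affine_hull => //; exact: ap.
under eq_bigr do rewrite mulr_sumr.
rewrite exchange_big; apply: eq_bigr => i _ /=.
by rewrite -vertex_sum// mulr_sumr; apply: eq_bigr => p _; rewrite mulrCA.
Qed.

Lemma Yh_out v x : Yh v -> closure Omega x -> ~ mesh_domain K x -> v x = 0.
Proof. by case=> _ _; apply. Qed.

Lemma mesh_cell x : mesh_domain K x -> exists T, T \in K /\ hull T x.
Proof. by move=> /interior_subset[T TK hT]; exists T. Qed.

(** Both sides are affine on each cell and agree at its vertices. *)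
Lemma Yh_expand v x : Yh v -> closure Omega x ->
  v x = \sum_(p <- nodes K) v p * phi p x.
Proof.
move=> Yv cx; have [/mesh_cell[T [TK /hullE[l [l0 l1 ->]]]]|nx] := pselect (mesh_domain K x).
  rewrite nodal_sum_hull//; have [_ av _] := Yv.
  rewrite (affine_hull TK (av _ TK) l0 l1); apply: eq_bigr => i _.
  by case: ifPn => // /(vertex_eq0 TK Yv) ->.
rewrite (Yh_out Yv)// big_seq big1// => p /phi_Yh Yp.
by rewrite (Yh_out Yp)// mulr0.
Qed.

Lemma phi_ge0 p x : p \in nodes K -> closure Omega x -> 0 <= phi p x.
Proof.
move=> pK cx; have Yp := phi_Yh pK.
have [/mesh_cell[T [TK /hullE[l [l0 l1 ->]]]]|nx] := pselect (mesh_domain K x); last first.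
  by rewrite (Yh_out Yp).
have [_ ap _] := Yp; rewrite (affine_hull TK (ap _ TK) l0 l1).
apply: sumr_ge0 => i _; rewrite mulr_ge0//.
have [Ti|Ti] := boolP (tnth T i \in nodes K); last by rewrite (vertex_eq0 TK Yp Ti).
by have [_ ->] := hphi pK; rewrite ?ler0n.
Qed.

Lemma phi_sum_le1 x : closure Omega x -> \sum_(p <- nodes K) phi p x <= 1.
Proof.
move=> cx; have [/mesh_cell[T [TK /hullE[l [l0 l1 ->]]]]|nx] := pselect (mesh_domain K x); last first.
  by rewrite big_seq big1// => p /phi_Yh Yp; rewrite (Yh_out Yp).
under eq_bigr do rewrite -[phi _ _]mul1r.
rewrite (nodal_sum_hull (fun=> 1))// -[leRHS]l1; apply: ler_sum => i _.
by case: ifP => _; rewrite ?mulr1// mulr0.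
Qed.

(** Where [grad_h] is the gradient of the affine function of the cell, or the
    point is outside the mesh, where all finite element functions vanish. *)
Definition off_faces x : Prop :=
  mesh_domain K x -> exists T, T \in K /\ interior (hull T) x.

Lemma grad_h_cell T v k d x : T \in K -> (forall y, hull T y -> v y = k + dotv d y) ->
  interior (hull T) x -> grad_h K v x = d.
Proof.
move=> TK vE Tx; apply/rowP => i; rewrite mxE patchE mem_set; last by exists T.
apply: (@partial_affine _ _ k); near=> y; apply: vE.
by near: y; exact: Tx.
Unshelve. all: by end_near. Qed.

Variable h : R.
Hypothesis dK : forall T, T \in K -> diameter (hull T) <= h.

Lemma cell_slope T v x y : T \in K -> Yh v -> interior (hull T) x -> hull T y ->
  `|v y - v x| <= h * enorm (grad_h K v x).
Proof.
move=> TK [_ av _] Tx Ty; have [k [d vE]] := av _ TK.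
rewrite (grad_h_cell TK vE Tx) !vE//; last exact: interior_subset Tx.
rewrite opprD addrACA subrr add0r.
have -> : dotv d y - dotv d x = dotv d (y - x).
  by rewrite dotvDr -[- x]scaleN1r dotvZr mulN1r.
apply: le_trans (dotv_le _ _) _; rewrite mulrC ler_wpM2r ?enorm_ge0//.
apply: le_trans (dK TK); apply: enorm_hull_diff => //; exact: interior_subset Tx.
Qed.

(** A hat function that does not vanish at [x] has its node among the vertices of
    the cell of [x]. *)
Lemma cell_phi T v x p : T \in K -> Yh v -> interior (hull T) x -> p \in nodes K ->
  phi p x != 0 -> `|v p - v x| <= h * enorm (grad_h K v x).
Proof.
move=> TK Yv Tx pK; have /hullE[l [l0 l1 xE]] := interior_subset Tx.
have [_ ap _] := phi_Yh pK; rewrite {1}xE (affine_hull TK (ap _ TK) l0 l1) => s0.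
have [i Hi] : exists i, phi p (tnth T i) != 0.
  apply: contrapT => /forallNP H; move: s0; rewrite big1 ?eqxx// => i _.
  by have /negP/negPn/eqP -> := H i; rewrite mulr0.
have Ti : tnth T i \in nodes K.
  by apply: contraR Hi => /(vertex_eq0 TK (phi_Yh pK)) ->.
have ip : tnth T i = p.
  have [_ /(_ _ Ti) e] := hphi pK; move: Hi; rewrite e.
  by case: (tnth T i =P p) => // _; rewrite eqxx.
rewrite -ip; apply: (cell_slope TK) => //; exact: (vertex_hull (fK TK) _).
Qed.

(** If the hat functions do not sum to 1 at [x], some vertex of its cell carries
    none of them, and [v] vanishes there. *)
Lemma cell_phi0 T v x : T \in K -> Yh v -> interior (hull T) x ->
  \sum_(p <- nodes K) phi p x != 1 -> `|v x| <= h * enorm (grad_h K v x).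
Proof.
move=> TK Yv Tx; have /hullE[l [l0 l1 xE]] := interior_subset Tx.
under eq_bigr do rewrite {1}xE -[phi _ _]mul1r.
rewrite (nodal_sum_hull (fun=> 1))// => s1.
have [i Hi] : exists i, tnth T i \notin nodes K.
  apply: contrapT => /forallNP H; move/eqP: s1; apply.
  rewrite -[RHS]l1; apply: eq_bigr => i _.
  by have /negP/negPn -> := H i; rewrite mulr1.
rewrite -normrN -[- v x]add0r -(vertex_eq0 TK Yv Hi).
by apply: (cell_slope TK) => //; exact: (vertex_hull (fK TK) _).
Qed.

Lemma off_faces_phi v x p : off_faces x -> Omega x -> Yh v -> p \in nodes K ->
  phi p x != 0 -> `|v p - v x| <= h * enorm (grad_h K v x).
Proof.
move=> ox Ox Yv pK; have [mx|nx] := pselect (mesh_domain K x).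
  by have [T [TK Tx]] := ox mx; exact: (cell_phi TK).
by rewrite (Yh_out (phi_Yh pK)) ?eqxx//; exact: subset_closure.
Qed.

Lemma off_faces_phi0 v x : 0 <= h -> off_faces x -> Omega x -> Yh v ->
  \sum_(p <- nodes K) phi p x != 1 -> `|v x| <= h * enorm (grad_h K v x).
Proof.
move=> h0 ox Ox Yv; have [mx|nx] := pselect (mesh_domain K x).
  by have [T [TK Tx]] := ox mx; exact: (cell_phi0 TK).
rewrite (Yh_out Yv) ?normr0//; last exact: subset_closure.
by rewrite mulr_ge0// enorm_ge0.
Qed.

End nodal_basis.

(** A face lies in the zero set of a barycentric coordinate, a hyperplane. *)
Lemma off_faces_ae : {ae mu, forall x, off_faces x}.
Proof.
have : {ae mu, forall x, forall i : 'I_(size K), forall j,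
    bary (tnth (in_tuple K) i) x ord0 j != 0}.
  by apply: filter_forall => i; apply: bary_neq0_ae => //; apply: fK; exact: mem_tnth.
apply: filterS => x H /mesh_cell[T [TK hT]]; exists T; split => //.
apply: (bary_gt0_interior (fK TK)) => j.
rewrite lt_def (hull_bary (fK TK) x).1// andbT.
have /tnthP[i ->] : T \in in_tuple K by [].
exact: H.
Qed.

Lemma affine_on_lin D v w t : affine_on D v -> affine_on D w ->
  affine_on D (fun x => v x + t * w x).
Proof.
move=> [k [d vE]] [k' [d' wE]]; exists (k + t * k'), (d + t *: d') => x Dx.
by rewrite vE// wE// dotvDl dotvZl; ring.
Qed.

Lemma Yh_lin v w t : Yh v -> Yh w -> Yh (fun x => v x + t * w x).
Proof.
move=> [cv av v0] [cw aw w0]; split.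
- by move=> x; apply: cvgD; [exact: cv|apply: cvgM; [exact: cvg_cst|exact: cw]].
- by move=> T TK; apply: affine_on_lin; [exact: av|exact: aw].
- by move=> x cx nx; rewrite v0// w0// mulr0 addr0.
Qed.

Lemma Yh0 : Yh (fun=> 0).
Proof.
split => //; first by move=> x; exact: cvg_cst.
by move=> T TK; exists 0, 0 => x _; rewrite add0r /dotv big1// => i _; rewrite mxE mul0r.
Qed.

Lemma Yh_sum (I : eqType) (s : seq I) (c : I -> R) (f : I -> V -> R) :
  (forall i, i \in s -> Yh (f i)) -> Yh (fun x => \sum_(i <- s) c i * f i x).
Proof.
elim: s => [|i s IH] Hs.
  by under eq_fun do rewrite big_nil; exact: Yh0.
under eq_fun do rewrite big_cons addrC.
apply: Yh_lin; last by apply: Hs; rewrite mem_head.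
by apply: IH => j js; apply: Hs; rewrite in_cons js orbT.
Qed.

Lemma grad_h_out v x : ~ mesh_domain K x -> grad_h K v x = 0.
Proof.
move=> nx; apply/rowP => i; rewrite !mxE patchE memNset// => -[T TK Tx].
exact/nx/(interior_hull_mesh TK).
Qed.

Lemma grad_h_lin v w t x : Yh v -> Yh w ->
  grad_h K (fun z => v z + t * w z) x = grad_h K v x + t *: grad_h K w x.
Proof.
move=> [_ av _] [_ aw _].
have [[T TK Tx]|nx] := pselect ((\bigcup_(T in [set` K]) interior (hull T)) x).
  have [k [d vE]] := av _ TK; have [k' [d' wE]] := aw _ TK.
  rewrite (grad_h_cell TK vE Tx) (grad_h_cell TK wE Tx).
  apply: (@grad_h_cell T _ (k + t * k')) => // y hy.
  by rewrite vE// wE// dotvDl dotvZl; ring.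
by apply/rowP => i; rewrite !mxE !patchE memNset// mulr0 addr0.
Qed.

Lemma bounded_closure_compact : compact (closure Omega).
Proof.
apply: bounded_closed_compact; last exact: closed_closure.
have [M [rM HM]] := bO; exists M; split => // N MN.
have cN : closed [set x : V | `|x| <= N].
  have := @closed_comp _ _ (fun y : V => `|y|) [set t | t <= N].
  by apply => [y _|]; [exact: norm_continuous|exact: closed_le].
have sub : Omega `<=` [set x | `|x| <= N] by move=> x; exact: HM.
by move=> x /(closure_subset sub); rewrite -((closure_id _).1 cN).
Qed.

Lemma Yh_bounded v : Yh v -> exists M : R, forall x, closure Omega x -> `|v x| <= M.
Proof.
move=> [cv _ _].
have [M [rM HM]] := compact_bounded (continuous_compact cv bounded_closure_compact).
by exists (M + 1) => x cx; apply: HM; [rewrite ltrDl|exists x].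
Qed.

Lemma Omega_lty : (mu Omega < +oo)%E.
Proof. exact: bounded_lebesgue_rV_lty. Qed.

Lemma bounded_sqint (f : V -> R) M : measurable_fun Omega f ->
  (forall x, Omega x -> `|f x| <= M) -> sqint mu Omega f.
Proof.
move=> mf fM; split => //; apply: measurable_bounded_integrable => //.
- exact: Omega_lty.
- exact: measurable_funX.
- exists (M ^+ 2); split; first exact: num_real.
  move=> N MN x Ox /=; rewrite normrX; apply: le_trans (ltW MN).
  by rewrite lerXn2r ?nnegrE ?normr_ge0 ?fM// (le_trans _ (fM _ Ox)).
Qed.

Lemma Yh_sqint v : Yh v -> sqint mu Omega v.
Proof.
move=> Yv; have [M vM] := Yh_bounded Yv; apply: (@bounded_sqint _ M); last first.
  by move=> x Ox; apply: vM; exact: subset_closure.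
apply: continuous_measurable_rV => //; have [cv _ _] := Yv.
rewrite -continuous_open_subspace//; apply: continuous_subspaceW cv.
exact: subset_closure.
Qed.

Lemma grad_h_sqint v i : Yh v -> sqint mu Omega (fun x => grad_h K v x ord0 i).
Proof.
move=> Yv; have [_ av _] := Yv.
have /choice[d Hd] : forall T, exists d, T \in K ->
    forall x, interior (hull T) x -> grad_h K v x = d.
  move=> T; have [TK|nT] := boolP (T \in K); last by exists 0.
  have [k [d vE]] := av _ TK; exists d => _ x Tx; exact: grad_h_cell vE Tx.
pose U := \bigcup_(T in [set` K]) interior (hull T).
have out x : ~ U x -> grad_h K v x ord0 i = 0.
  by move=> nx; rewrite !mxE patchE memNset.
have mI T : measurable (interior (hull T)).
  by apply: open_measurable_rV; exact: open_interior.
have mU : measurable U by apply: fin_bigcup_measurable => // T _; exact: mI.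
apply: (@bounded_sqint _ (\sum_(T <- K) `|d T ord0 i|)).
  move=> _ Y mY.
  have -> : (fun x => grad_h K v x ord0 i) @^-1` Y =
      (\bigcup_(T in [set T | T \in K /\ Y (d T ord0 i)]) interior (hull T)) `|`
      ((~` U) `&` [set x | Y 0]).
    apply/seteqP; split => [x /= Yx|x [[T [TK YT] Tx]|[nx Y0]]] /=.
    - have [[T TK Tx]|nx] := pselect (U x).
        left; exists T => //; split => //.
        by move: Yx; rewrite (Hd T TK x Tx).
      by right; split => //=; rewrite -(out _ nx).
    - by rewrite (Hd T TK x Tx).
    - by rewrite out.
  apply: measurableI => //; apply: measurableU.
    apply: fin_bigcup_measurable; last by move=> T _; exact: mI.
    by apply: sub_finite_set (finite_seq K) => T [].
  apply: measurableI; first exact: measurableC.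
  have [Y0|nY0] := pselect (Y 0).
    by rewrite (_ : [set x | Y 0] = setT) //; apply/seteqP; split.
  by rewrite (_ : [set x | Y 0] = set0) //; apply/seteqP; split.
move=> x _; have [[T TK Tx]|nx] := pselect (U x).
  by rewrite (Hd T TK x Tx) (big_rem T)//= lerDl sumr_ge0.
by rewrite out// normr0 sumr_ge0.
Qed.

Lemma Yh_sqint1 v : Yh v -> sqint1 Omega v (grad_h K v).
Proof. by move=> Yv; split; [exact: Yh_sqint|move=> i; exact: grad_h_sqint]. Qed.

(** The mesh may leave a part of [Omega] uncovered, but discrete integrands vanish
    there: all integrals can be taken over [Omega]. *)
Lemma mesh_integral (f : V -> R) :
  (forall x, Omega x -> ~ mesh_domain K x -> f x = 0) ->
  \int[mu]_(x in mesh_domain K) f x = \int[mu]_(x in Omega) f x.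
Proof.
move=> f0; rewrite Rintegral_mkcond [RHS]Rintegral_mkcond.
apply: eq_Rintegral => x _; rewrite !patchE.
have [mx|nx] := pselect (mesh_domain K x); first by rewrite !mem_set//; exact: KO.
by rewrite memNset//; case: ifPn => // /set_mem Ox; rewrite f0.
Qed.

End mesh.

(** * The pointwise variational inequality *)

Section shrinkage.
Variables (R : realType) (a b alpha beta : R).
Hypotheses (a0 : a < 0) (b0 : 0 < b) (alpha0 : 0 < alpha) (beta0 : 0 < beta).

(** Soft thresholding of [- s] at level [beta], divided by [alpha] and projected
    onto the interval from [a] to [b]. *)
Definition shrink (s : R) : R :=
  if s < - beta then Num.min b ((- s - beta) / alpha)
  else if beta < s then Num.max a ((- s + beta) / alpha) else 0.

Lemma shrink_bounds s : a <= shrink s <= b.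
Proof.
rewrite /shrink; case: ltP => [sb|_].
  have p : 0 < (- s - beta) / alpha by rewrite divr_gt0//; lra.
  by rewrite ge_min lexx le_min /= (ltW (lt_trans a0 b0)) (ltW (lt_trans a0 p)).
case: ltP => [sb|_]; last by rewrite !ltW.
have p : (- s + beta) / alpha < 0 by rewrite pmulr_llt0 ?invr_gt0//; lra.
by rewrite le_max lexx ge_max (ltW (lt_trans a0 b0)) (ltW (lt_trans p b0)).
Qed.

(** The optimality condition for the minimum of [alpha/2 w^2 + s w + beta |w|] over
    [a <= w <= b], which is attained at [shrink s]. *)
Lemma shrink_VI s w : a <= w <= b ->
  0 <= (alpha * shrink s + s) * (w - shrink s) + beta * (`|w| - `|shrink s|).
Proof.
move=> /andP[aw wb]; rewrite /shrink; case: ltP => [sb|bs].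
  set t := (- s - beta) / alpha.
  have ta : alpha * t = - s - beta by rewrite /t mulrC divfK// gt_eqF.
  have t0 : 0 < t by rewrite divr_gt0//; lra.
  have := ler_norm w; case: (leP b t) => bt w1.
    rewrite (gtr0_norm b0); have : alpha * b <= alpha * t by rewrite ler_pM2l.
    rewrite ta => tb.
    have h1 : 0 <= (- s - beta - alpha * b) * (b - w) by rewrite mulr_ge0//; lra.
    have h2 : 0 <= beta * (`|w| - w) by rewrite mulr_ge0 ?subr_ge0// ltW.
    by move: `|w| h2 => z h2; lra.
  have h2 : 0 <= beta * (`|w| - w) by rewrite mulr_ge0 ?subr_ge0// ltW.
  by rewrite (gtr0_norm t0) ta; move: `|w| h2 => z h2; lra.
case: ltP => [sb|sb].
  set t := (- s + beta) / alpha.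
  have ta : alpha * t = - s + beta by rewrite /t mulrC divfK// gt_eqF.
  have t0 : t < 0 by rewrite pmulr_llt0 ?invr_gt0//; lra.
  have := ler_norm (- w); rewrite normrN; case: (leP a t) => bt w1.
    have h2 : 0 <= beta * (`|w| - - w) by rewrite mulr_ge0 ?subr_ge0// ltW.
    by rewrite (ltr0_norm t0) ta; move: `|w| h2 => z h2; lra.
  rewrite (ltr0_norm a0); have : alpha * t <= alpha * a by rewrite ler_pM2l// ltW.
  rewrite ta => tb.
  have h1 : 0 <= (alpha * a + s - beta) * (w - a) by rewrite mulr_ge0//; lra.
  have h2 : 0 <= beta * (`|w| - - w) by rewrite mulr_ge0 ?subr_ge0// ltW.
  by move: `|w| h2 => z h2; lra.
rewrite normr0 mulr0 add0r !subr0.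
have := ler_norm w; have := ler_norm (- w); rewrite normrN.
by move: `|w| => z w1 w2; have [|] := lerP 0 w => ?; nra.
Qed.

(** Add the inequalities at [s] and [s'], each tested with the other value. *)
Lemma shrink_lip s s' : `|shrink s - shrink s'| <= alpha^-1 * `|s - s'|.
Proof.
have h1 := shrink_VI s (shrink_bounds s').
have h2 := shrink_VI s' (shrink_bounds s).
rewrite ler_pdivlMl//.
have h3 : alpha * `|shrink s - shrink s'| ^+ 2 <= `|s - s'| * `|shrink s - shrink s'|.
  rewrite -normrM real_normK ?num_real//.
  have := ler_norm (- ((s - s') * (shrink s - shrink s'))); rewrite normrN.
  by apply: le_trans; move: (shrink s) (shrink s') h1 h2 => x y; nra.
have [->|n0] := eqVneq `|shrink s - shrink s'| 0; first by rewrite mulr0.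
have p0 : 0 < `|shrink s - shrink s'| by rewrite lt_def n0 normr_ge0.
by rewrite -(ler_pM2r p0) -mulrA -expr2.
Qed.

Lemma shrink0 : shrink 0 = 0.
Proof. by rewrite /shrink oppr_gt0 ltNge (ltW beta0). Qed.

Lemma shrink_le s : `|shrink s| <= alpha^-1 * `|s|.
Proof. by have := shrink_lip s 0; rewrite shrink0 !subr0. Qed.

Lemma measurable_shrink : measurable_fun setT shrink.
Proof.
apply: continuous_measurable_fun => s; apply/cvgrPdist_le => e e0; near=> s'.
apply: le_trans (shrink_lip _ _) _; rewrite ler_pdivrMl//.
by near: s'; apply: cvgr_dist_le; [exact: cvg_id|rewrite mulr_gt0].
Unshelve. all: by end_near. Qed.

End shrinkage.

(** Divide by [t] and let [t] tend to 0. *)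
Lemma first_order_ge0 (R : realType) (L Q : R) :
  (forall t, 0 < t -> t <= 1 -> 0 <= t * L + t ^+ 2 * Q) -> 0 <= L.
Proof.
move=> H; rewrite leNgt; apply/negP => L0.
have Q0 : 0 < `|Q| + 1 by rewrite ltr_wpDl.
pose t := Num.min 1 (- L / (2 * (`|Q| + 1))).
have t0 : 0 < t by rewrite lt_min ltr01 divr_gt0 ?mulr_gt0//; lra.
have t1 : t <= 1 by rewrite ge_min lexx.
have t2 : t * (`|Q| + 1) <= - L / 2.
  apply: (@le_trans _ _ (- L / (2 * (`|Q| + 1)) * (`|Q| + 1))).
    by rewrite ler_pM2r// ge_min lexx orbT.
  rewrite le_eqVlt; apply/orP; left; apply/eqP; field.
  by rewrite gt_eqF.
have := H t t0 t1; rewrite expr2 -mulrA -mulrDr pmulr_rge0// => H1.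
have := ler_norm Q; nra.
Qed.

(** * Bounds and discrete solutions *)

Section energy_bounds.
Context (R : realType) (n : nat).
Local Notation V := 'rV[R]_n.
Local Notation mu := (lebesgue_rV R n).
Variable Omega : set V.
Hypothesis oO : open Omega.
Let mO : measurable Omega := open_measurable_rV oO.
Local Notation sq := (sqint mu Omega).
Local Notation ipO := (ip mu Omega).
Local Notation nrmO := (nrm mu Omega).

Lemma sqint_enorm (g : V -> V) : (forall i, sq (fun x => g x ord0 i)) ->
  sq (fun x => enorm (g x)).
Proof.
move=> sg; have m2 : measurable_fun Omega (fun x => dotv (g x) (g x)).
  rewrite /dotv; apply: measurable_sum => i.
  by apply: measurable_funM; case: (sg i).
split.
  rewrite (_ : (fun x => _) = Num.sqrt \o (fun x => dotv (g x) (g x)))//.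
  apply: measurableT_comp m2; apply: continuous_measurable_fun.
  exact: sqrt_continuous.
have := integrable_Rsum mO (index_enum 'I_n) (fun i => sqint_mul mO (sg i) (sg i)).
by apply: eq_integrable => // x _ /=; rewrite enorm_sq.
Qed.

Lemma nrm_enorm (g : V -> V) : (forall i, sq (fun x => g x ord0 i)) ->
  nrmO (fun x => enorm (g x)) ^+ 2 =
  \sum_i ipO (fun x => g x ord0 i) (fun x => g x ord0 i).
Proof.
move=> sg; rewrite nrm_sq /ip -Rintegral_sum//; last first.
  by move=> i; exact: sqint_mul.
by apply: eq_Rintegral => x _; rewrite -expr2 enorm_sq.
Qed.

Lemma nrm_coord_le (g : V -> V) i : (forall i, sq (fun x => g x ord0 i)) ->
  nrmO (fun x => g x ord0 i) <= nrmO (fun x => enorm (g x)).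
Proof.
move=> sg; rewrite -(@ler_pXn2r _ 2)// ?nnegrE ?nrm_ge0// nrm_enorm// nrm_sq.
by rewrite (bigD1 i)//= lerDl sumr_ge0// => j _; exact: ip_ge0.
Qed.

Variables (A : V -> 'M[R]_n) (c0 : V -> R).
Hypothesis hA : elliptic Omega A c0.

(** Coercivity and the Poincare inequality. *)
Lemma weak_solution_bound (i0 : 'I_n) K : (forall x, Omega x -> `|x| <= K) ->
  0 <= K -> exists2 C, 0 <= C & forall f y g, sq f ->
    weak_solution Omega A c0 f y g ->
    nrmO y <= C * nrmO f /\ nrmO (fun x => enorm (g x)) <= C * nrmO f.
Proof.
move=> OK K0; have [theta t0 Ath] := elliptic_coercive hA.
exists (2 * K / theta + (2 * K) ^+ 2 / theta).
  by rewrite addr_ge0// divr_ge0 ?sqr_ge0 ?mulr_ge0// ltW.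
move=> f y g sf /(weak_solutionP oO hA)[hy wy].
have [sy sg] := H10_sqint1 oO hy.
have co := aform_coercive oO hA t0 Ath (conj sy sg).
rewrite -nrm_enorm// (wy _ _ hy) in co.
have p1 := H10_poincare oO i0 OK hy; have p2 := nrm_coord_le i0 sg.
have cs := le_trans (ler_norm _) (ip_le mO sf sy).
have F0 := nrm_ge0 mu Omega f; have G0 := nrm_ge0 mu Omega (fun x => enorm (g x)).
have Y0 := nrm_ge0 mu Omega y.
move: (nrmO f) (nrmO y) (nrmO (fun x => enorm (g x))) (nrmO (fun x => g x ord0 i0))
  (ipO f y) co p1 p2 cs F0 G0 Y0 => F Y G G1 I co p1 p2 cs F0 G0 Y0.
have k2 : 0 <= 2 * K by rewrite mulr_ge0.
have YG : Y <= 2 * K * G by apply: le_trans p1 _; rewrite ler_wpM2l.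
have GF : G <= 2 * K / theta * F.
  have [->|Gn] := eqVneq G 0.
    by rewrite mulr_ge0// divr_ge0// ltW.
  have Gp : 0 < G by rewrite lt_def Gn.
  rewrite mulrAC ler_pdivlMr// -(ler_pM2r Gp).
  by apply: (@le_trans _ _ (theta * G ^+ 2)); [rewrite expr2; lra|nra].
have e0 : 0 <= 2 * K / theta by rewrite divr_ge0// ltW.
have e1 : (2 * K) ^+ 2 / theta = 2 * K * (2 * K / theta) by ring.
by rewrite e1; move: (2 * K / theta) e0 GF => q q0 GF; split; nra.
Qed.

End energy_bounds.

Section discrete.
Context (R : realType) (n : nat).
Hypothesis n0 : (0 < n)%N.
Local Notation V := 'rV[R]_n.
Local Notation mu := (lebesgue_rV R n).
Variable Omega : set V.
Hypothesis oO : open Omega.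
Hypothesis bO : bounded_set Omega.
Let mO : measurable Omega := open_measurable_rV oO.
Variables (A : V -> 'M[R]_n) (c0 : V -> R).
Hypothesis hA : elliptic Omega A c0.
Variable K : seq (n.+1.-tuple V).
Hypothesis fK : forall T : n.+1.-tuple V, T \in K ->
  free [seq x - thead T | x <- behead T].
Hypothesis KO : mesh_domain K `<=` Omega.
Implicit Types (f v w : V -> R).
Local Notation Yh := (Yh Omega K).
Local Notation sq := (sqint mu Omega).
Local Notation ipO := (ip mu Omega).
Local Notation nrmO := (nrm mu Omega).

Definition hform v w : R := aform Omega A c0 v (grad_h K v) w (grad_h K w).

Let s1 v (Yv : Yh v) : sqint1 Omega v (grad_h K v) := Yh_sqint1 oO bO Yv.

Lemma hformC v w : Yh v -> Yh w -> hform v w = hform w v.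
Proof. by move=> Yv Yw; apply: (aformC oO hA); exact: s1. Qed.

Lemma hform_lin v v' w t : Yh v -> Yh v' -> Yh w ->
  hform (fun x => v x + t * v' x) w = hform v w + t * hform v' w.
Proof.
move=> Yv Yv' Yw.
rewrite /hform -(aform_lin oO hA t (s1 Yv) (s1 Yv') (s1 Yw)); congr aform.
by apply/funext => x; apply: (grad_h_lin t x Yv Yv').
Qed.

Lemma hform0 w : Yh w -> hform (fun=> 0) w = 0.
Proof.
move=> Yw; have Y0 := Yh0 Omega K; have := hform_lin (-1) Y0 Y0 Yw.
rewrite (_ : (fun x : V => 0 + -1 * 0) = fun=> 0) ?mulN1r ?subrr//.
Qed.

Lemma hform_sum (I : eqType) (s : seq I) (c : I -> R) (f : I -> V -> R) w :
  (forall i, i \in s -> Yh (f i)) -> Yh w ->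
  hform (fun x => \sum_(i <- s) c i * f i x) w = \sum_(i <- s) c i * hform (f i) w.
Proof.
move=> + Yw; elim: s => [|i s IH] Hs.
  transitivity (hform (fun=> 0) w); last by rewrite hform0// big_nil.
  by congr (hform _ w); apply/funext => x; rewrite big_nil.
have Hs' j : j \in s -> Yh (f j) by move=> js; apply: Hs; rewrite in_cons js orbT.
rewrite big_cons -IH// [RHS]addrC -hform_lin//.
- by congr (hform _ w); apply/funext => x; rewrite big_cons addrC.
- exact: Yh_sum.
- by apply: Hs; rewrite mem_head.
Qed.

Lemma discrete_solutionP f yh : discrete_solution Omega K A c0 f yh <->
  Yh yh /\ forall vh, Yh vh -> hform yh vh = ipO f vh.
Proof.
have e v w : Yh v -> Yh w -> \int[mu]_(x in mesh_domain K)
    energy A c0 v (grad_h K v) w (grad_h K w) x = hform v w.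
  move=> Yv Yw; rewrite (mesh_integral KO).
    exact: energyE (s1 Yv) (s1 Yw).
  move=> x Ox nx; rewrite /energy (Yh_out Yv) ?mulr0 ?mul0r ?addr0//; last exact: subset_closure.
  by rewrite !big1// => i _; rewrite big1// => j _; rewrite grad_h_out// mxE mulr0 mul0r.
have e' v : Yh v -> \int[mu]_(x in mesh_domain K) (f x * v x) = ipO f v.
  move=> Yv; apply: (mesh_integral KO) => x Ox nx.
  by rewrite (Yh_out Yv) ?mulr0//; exact: subset_closure.
split=> -[Yy H]; split=> // v Yv; first by rewrite -e// H// e'.
by rewrite e// H// e'.
Qed.

Lemma discrete_solution_lin f f' y y' t : sq f -> sq f' ->
  discrete_solution Omega K A c0 f y -> discrete_solution Omega K A c0 f' y' ->
  discrete_solution Omega K A c0 (fun x => f x + t * f' x) (fun x => y x + t * y' x).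
Proof.
move=> sf sf' /discrete_solutionP[Yy H] /discrete_solutionP[Yy' H'].
apply/discrete_solutionP; split; first exact: Yh_lin.
move=> v Yv; rewrite hform_lin// H// H'//.
have sv := Yh_sqint oO bO Yv.
by rewrite ipDl ?ipZl//; exact: sqintZ.
Qed.

Section existence.
Variable phi : V -> V -> R.
Hypothesis hphi : nodal_basis Omega K phi.

(** Existence from uniqueness, the stiffness matrix being square: a vector in its
    kernel gives a function of norm zero, to which the load is orthogonal. *)
Lemma discrete_solution_exists :
  (forall v, Yh v -> (forall w, Yh w -> hform v w = 0) -> nrmO v = 0) ->
  forall f, sq f -> exists yh, discrete_solution Omega K A c0 f yh.
Proof.
move=> uniq0 f sf; pose N := size (nodes K).
pose p (i : 'I_N) := tnth (in_tuple (nodes K)) i.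
have pK i : p i \in nodes K by exact: mem_tnth.
have Yp i : Yh (phi (p i)) by exact: phi_Yh.
have Yc (c : 'I_N -> R) : Yh (fun x => \sum_i c i * phi (p i) x) by exact: Yh_sum.
have expand w x : Yh w -> closure Omega x -> w x = \sum_i w (p i) * phi (p i) x.
  by move=> Yw cx; rewrite {1}(Yh_expand fK KO hphi Yw cx)// big_tnth.
(* elements of Y_h are total functions, only determined on the closure of Omega *)
have grad_congr v w : Yh v -> Yh w -> (forall x, closure Omega x -> v x = w x) ->
    grad_h K v = grad_h K w.
  move=> Yv Yw vw; apply/funext => x.
  have [[T TK Tx]|nx] := pselect ((\bigcup_(T in [set` K]) interior (hull T)) x).
    have [_ av _] := Yv; have [k [d vE]] := av _ TK.
    rewrite (grad_h_cell TK vE Tx); apply/esym/(grad_h_cell (k := k) TK) => // y hy.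
    by rewrite -vw ?vE//; exact: (hull_closure_domain fK KO TK hy).
  by apply/rowP => i; rewrite !mxE !patchE memNset.
have form_congr v v' w : Yh v -> Yh v' -> (forall x, closure Omega x -> v x = v' x) ->
    hform v w = hform v' w.
  move=> Yv Yv' vv; rewrite /hform /aform (grad_congr _ _ Yv Yv' vv); congr (_ + _).
  by apply: eq_ip => // x Ox; rewrite vv//; exact: subset_closure.
pose M : 'M[R]_N := \matrix_(i, j) hform (phi (p i)) (phi (p j)).
pose F : 'rV[R]_N := \row_j ipO f (phi (p j)).
have : (F <= M)%MS.
  rewrite submxE; apply/eqP/rowP => j; rewrite [RHS]mxE mxE.
  pose c i := cokermx M i j; pose v x := \sum_i c i * phi (p i) x.
  have Yv : Yh v by exact: Yc.
  have v0 : nrmO v = 0.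
    apply: uniq0 => // w Yw; rewrite hformC//.
    rewrite (form_congr w (fun x => \sum_i w (p i) * phi (p i) x))//; first last.
    - by move=> x cx; exact: expand.
    rewrite hform_sum// big1// => i _.
    rewrite hformC// hform_sum// [X in _ * X](_ : _ = 0) ?mulr0//.
    transitivity ((M *m cokermx M) i j); last by rewrite mulmx_coker mxE.
    by rewrite mxE; apply: eq_bigr => k _; rewrite mxE mulrC hformC.
  have : ipO f v = 0.
    have := ip_le mO sf (Yh_sqint oO bO Yv); rewrite v0 mulr0.
    by rewrite normr_le0 => /eqP.
  move=> e0; rewrite -[RHS]e0 /ip.
  rewrite (@eq_Rintegral _ _ _ mu Omega (fun x => \sum_i c i * (f x * phi (p i) x))); last first.
    by move=> x _; rewrite /v mulr_sumr; apply: eq_bigr => i _; rewrite mulrCA.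
  have jf i := sqint_mul mO sf (Yh_sqint oO bO (Yp i)).
  rewrite Rintegral_sum//; last first.
    move=> i; have := integrableZl mO (c i) (jf i).
    by apply: eq_integrable => // x _ /=; rewrite EFinM.
  by apply: eq_bigr => i _; rewrite RintegralZl// mxE mulrC.
move=> /submxP[D FD]; exists (fun x => \sum_i D ord0 i * phi (p i) x).
apply/discrete_solutionP; split; first exact: Yc.
move=> v Yv; rewrite hformC//.
rewrite (form_congr v (fun x => \sum_i v (p i) * phi (p i) x))//; first last.
- by move=> x cx; exact: expand.
rewrite hform_sum//.
have -> : ipO f v = \sum_i v (p i) * ipO f (phi (p i)).
  have jf i := sqint_mul mO sf (Yh_sqint oO bO (Yp i)).
  under eq_bigr => i _ do rewrite /ip -RintegralZl//.
  rewrite -Rintegral_sum//; last first.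
    move=> i; have := integrableZl mO (v (p i)) (jf i).
    by apply: eq_integrable => // x _ /=; rewrite EFinM.
  apply: eq_Rintegral => x /set_mem Ox.
  rewrite {1}(expand v x Yv) ?mulr_sumr; last exact: subset_closure.
  by apply: eq_bigr => i _; rewrite mulrCA.
apply: eq_bigr => i _; congr (_ * _).
rewrite hformC// hform_sum//; have /rowP/(_ i) := FD; rewrite !mxE => ->.
by apply: eq_bigr => k _; rewrite mxE.
Qed.

End existence.

End discrete.

(** * Mass lumping and quasi-interpolation *)

Section Rintegral_sum_seq.
Context d (T : measurableType d) (R : realType).
Variable mu : {measure set T -> \bar R}.
Variable D : set T.
Hypothesis mD : measurable D.

Lemma integrable_Zl (k : R) (f : T -> R) : mu.-integrable D (EFin \o f) ->
  mu.-integrable D (EFin \o (fun x => k * f x)).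
Proof.
move=> /(integrableZl mD k); exact: eq_integrable.
Qed.

Lemma integrable_Dl (f g : T -> R) : mu.-integrable D (EFin \o f) ->
  mu.-integrable D (EFin \o g) -> mu.-integrable D (EFin \o (fun x => f x + g x)).
Proof. by move=> jf /(integrableD mD jf); exact: eq_integrable. Qed.

Lemma integrable_Rsum_seq (I : eqType) (s : seq I) (F : I -> T -> R) :
  (forall i, i \in s -> mu.-integrable D (EFin \o F i)) ->
  mu.-integrable D (EFin \o (fun x => \sum_(i <- s) F i x)) /\
  \int[mu]_(x in D) (\sum_(i <- s) F i x) = \sum_(i <- s) \int[mu]_(x in D) F i x.
Proof.
move=> jF; have e x : \sum_(i <- s) F i x = \sum_(k < size s) F (tnth (in_tuple s) k) x.
  by rewrite big_tnth.
have jF' k := jF _ (mem_tnth k (in_tuple s)).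
split; first by under eq_fun do rewrite e; exact: integrable_Rsum.
under eq_Rintegral do rewrite e; rewrite Rintegral_sum//.
by rewrite [RHS]big_tnth.
Qed.

End Rintegral_sum_seq.

Section lumping.
Context (R : realType) (n : nat).
Hypothesis n0 : (0 < n)%N.
Local Notation V := 'rV[R]_n.
Local Notation mu := (lebesgue_rV R n).
Variable Omega : set V.
Hypothesis oO : open Omega.
Hypothesis bO : bounded_set Omega.
Let mO : measurable Omega := open_measurable_rV oO.
Variable K : seq (n.+1.-tuple V).
Hypothesis fK : forall T : n.+1.-tuple V, T \in K ->
  free [seq x - thead T | x <- behead T].
Hypothesis KO : mesh_domain K `<=` Omega.
Variable phi : V -> V -> R.
Hypothesis hphi : nodal_basis Omega K phi.
Variable h : R.
Hypothesis h0 : 0 <= h.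
Hypothesis dK : forall T, T \in K -> diameter (hull T) <= h.
Implicit Types (f g v w c : V -> R).
Local Notation Yh := (Yh Omega K).
Local Notation sq := (sqint mu Omega).
Local Notation ipO := (ip mu Omega).
Local Notation nrmO := (nrm mu Omega).

Definition mass (q : V) : R := \int[mu]_(x in Omega) phi q x.

Definition lump f g : R := \sum_(q <- nodes K) f q * g q * mass q.

Definition lump_err f g : R := lump f g - ipO f g.

Lemma sqint1_cst (k : R) : sq (fun=> k).
Proof. by apply: (bounded_sqint oO bO (M := `|k|)) => //; exact: measurable_cst. Qed.

Lemma sqint_integrable f : sq f -> mu.-integrable Omega (EFin \o f).
Proof.
move=> sf; have := sqint_mul mO sf (sqint1_cst 1).
by apply: eq_integrable => // x _ /=; rewrite mulr1.
Qed.

Let sphi q (qK : q \in nodes K) : sq (phi q) := Yh_sqint oO bO (phi_Yh hphi qK).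

Let phi0 q x (qK : q \in nodes K) (Ox : Omega x) : 0 <= phi q x :=
  phi_ge0 fK KO hphi qK (@subset_closure _ _ _ Ox).

Let sum_phi x (Ox : Omega x) : \sum_(q <- nodes K) phi q x <= 1 :=
  phi_sum_le1 fK KO hphi (@subset_closure _ _ _ Ox).

Let expand v x (Yv : Yh v) (Ox : Omega x) :
  v x = \sum_(q <- nodes K) v q * phi q x :=
  Yh_expand fK KO hphi Yv (@subset_closure _ _ _ Ox).

Lemma phi_le1 q x : q \in nodes K -> Omega x -> phi q x <= 1.
Proof.
move=> qK Ox; apply: le_trans (sum_phi Ox).
rewrite (big_rem q)//= lerDl big_seq; apply: sumr_ge0 => r /mem_rem rK.
exact: phi0.
Qed.

Lemma mass_ge0 q : q \in nodes K -> 0 <= mass q.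
Proof. by move=> qK; apply: Rintegral_ge0 => x Ox; exact: phi0. Qed.

Lemma sqint_phiM q f : q \in nodes K -> sq f -> sq (fun x => phi q x * f x).
Proof.
move=> qK sf; apply: (le_sqint mO sf (sqint0 mu mO)).
  by apply: measurable_funM; [case: (sphi qK)|case: sf].
move=> x Ox; rewrite normr0 addr0 normrM ger0_norm ?phi0//.
by rewrite ler_piMl// phi_le1.
Qed.

Lemma lump_integral c : lump c c =
  \int[mu]_(x in Omega) (\sum_(q <- nodes K) c q ^+ 2 * phi q x).
Proof.
rewrite (integrable_Rsum_seq mO _).2; last first.
  by move=> q qK; apply: integrable_Zl => //; exact/sqint_integrable/sphi.
apply: eq_big_seq => q qK; rewrite RintegralZl//.
exact/sqint_integrable/sphi.
Qed.

Lemma integrable_lump c : mu.-integrable Omega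
  (EFin \o (fun x => \sum_(q <- nodes K) c q ^+ 2 * phi q x)).
Proof.
apply: (integrable_Rsum_seq mO _).1 => q qK.
by apply: integrable_Zl => //; exact/sqint_integrable/sphi.
Qed.

(** Expand [v] in the hat functions: each [c q] is defined by the product of [u]
    with one of them. *)
Lemma lump_average u c v : sq u ->
  (forall q, q \in nodes K -> c q * mass q = ipO u (phi q)) -> Yh v ->
  lump c v = ipO u v.
Proof.
move=> su cE Yv; transitivity (\sum_(q <- nodes K) v q * ipO u (phi q)).
  by apply: eq_big_seq => q qK; rewrite mulrAC mulrC cE.
rewrite /ip; have j q : q \in nodes K -> mu.-integrable Omega
    (EFin \o (fun x => v q * (u x * phi q x))).
  by move=> qK; apply: integrable_Zl => //; apply: sqint_mul => //; exact: sphi.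
transitivity (\int[mu]_(x in Omega) (\sum_(q <- nodes K) v q * (u x * phi q x))).
  rewrite (integrable_Rsum_seq mO j).2; apply: eq_big_seq => q qK.
  by rewrite RintegralZl//; apply: sqint_mul => //; exact: sphi.
apply: eq_Rintegral => x /set_mem Ox; rewrite (expand Yv Ox) mulr_sumr.
by apply: eq_bigr => q _; rewrite mulrCA.
Qed.

Lemma lumpC f g : lump f g = lump g f.
Proof. by apply: eq_bigr => q _; rewrite (mulrC (f q)). Qed.

Lemma lump_lin f g w t : lump (fun x => f x + t * g x) w = lump f w + t * lump g w.
Proof.
rewrite /lump mulr_sumr -big_split; apply: eq_bigr => q _ /=; ring.
Qed.

Lemma lump_errC f g : lump_err f g = lump_err g f.
Proof. by rewrite /lump_err lumpC ipC. Qed.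

Lemma lump_err_lin f g w t : sq f -> sq g -> sq w ->
  lump_err (fun x => f x + t * g x) w = lump_err f w + t * lump_err g w.
Proof.
move=> sf sg sw; rewrite /lump_err lump_lin ipDl ?ipZl//; last exact: sqintZ.
ring.
Qed.

Lemma lump_err_segment f g t : sq f -> sq g ->
  lump_err (fun x => f x + t * g x) (fun x => f x + t * g x) =
  lump_err f f + 2 * t * lump_err f g + t ^+ 2 * lump_err g g.
Proof.
move=> sf sg; have sS := sqintD mO sf (sqintZ mO t sg).
rewrite (lump_err_lin t sf sg sS) (lump_errC f) (lump_errC g).
rewrite (lump_err_lin t sf sg sf) (lump_err_lin t sf sg sg) (lump_errC g f); ring.
Qed.

(** The variance identity for the weights [phi q x], with the missing weight
    [1 - \sum_q phi q x] at the value 0. For [c = f] and [k = f x] this is the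
    integrand of the lumping error of [f]. *)
Lemma nodal_variance c k x : \sum_(q <- nodes K) phi q x * (c q - k) ^+ 2
    + (1 - \sum_(q <- nodes K) phi q x) * k ^+ 2 =
  \sum_(q <- nodes K) c q ^+ 2 * phi q x
    - 2 * k * (\sum_(q <- nodes K) c q * phi q x) + k ^+ 2.
Proof.
have -> : \sum_(q <- nodes K) phi q x * (c q - k) ^+ 2 =
   \sum_(q <- nodes K) c q ^+ 2 * phi q x
   - 2 * k * (\sum_(q <- nodes K) c q * phi q x)
   + k ^+ 2 * \sum_(q <- nodes K) phi q x.
  rewrite !mulr_sumr -sumrB -big_split; apply: eq_bigr => q _ /=; ring.
ring.
Qed.

Lemma lump_errE f : Yh f -> lump_err f f =
  \int[mu]_(x in Omega) (\sum_(q <- nodes K) f q ^+ 2 * phi q x - f x ^+ 2).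
Proof.
move=> Yf; have [_ jf] := Yh_sqint oO bO Yf.
rewrite /lump_err lump_integral /ip -RintegralB//; exact: integrable_lump.
Qed.

Lemma nodal_variance_ge0 c k x : Omega x ->
  0 <= \sum_(q <- nodes K) phi q x * (c q - k) ^+ 2
    + (1 - \sum_(q <- nodes K) phi q x) * k ^+ 2.
Proof.
move=> Ox; rewrite addr_ge0//.
  by rewrite big_seq; apply: sumr_ge0 => q qK; rewrite mulr_ge0 ?sqr_ge0 ?phi0.
by rewrite mulr_ge0 ?sqr_ge0// subr_ge0 sum_phi.
Qed.

Lemma lump_err_ge0 f : Yh f -> 0 <= lump_err f f.
Proof.
move=> Yf; rewrite lump_errE//; apply: Rintegral_ge0 => x Ox.
have := nodal_variance_ge0 f (f x) Ox; rewrite nodal_variance -(expand Yf Ox).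
by congr (0 <= _); ring.
Qed.

(** Convexity of the absolute value, as the hat functions are nonnegative. *)
Lemma Yh_L1_le f : Yh f ->
  \int[mu]_(x in Omega) `|f x| <= \sum_(q <- nodes K) `|f q| * mass q.
Proof.
move=> Yf; have j q : q \in nodes K ->
    mu.-integrable Omega (EFin \o (fun x => `|f q| * phi q x)).
  by move=> qK; apply: integrable_Zl => //; exact/sqint_integrable/sphi.
have -> : \sum_(q <- nodes K) `|f q| * mass q =
    \int[mu]_(x in Omega) \sum_(q <- nodes K) (`|f q| * phi q x).
  rewrite (integrable_Rsum_seq mO j).2; apply: eq_big_seq => q qK.
  by rewrite RintegralZl//; exact/sqint_integrable/sphi.
apply: le_Rintegral => //.
- exact/sqint_integrable/sqint_norm/(Yh_sqint oO bO Yf).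
- exact: (integrable_Rsum_seq mO j).1.
move=> x Ox; rewrite (expand Yf Ox); apply: le_trans (ler_norm_sum _ _ _) _.
rewrite big_seq [leRHS]big_seq; apply: ler_sum => q qK.
by rewrite normrM (ger0_norm (phi0 qK Ox)).
Qed.

(** A variance over the nodes of a cell is bounded by the squared oscillation on
    the cell. *)
Lemma nodal_variance_le f x : Yh f -> off_faces K x -> Omega x ->
  \sum_(q <- nodes K) phi q x * (f q - f x) ^+ 2
    + (1 - \sum_(q <- nodes K) phi q x) * f x ^+ 2 <=
  h ^+ 2 * enorm (grad_h K f x) ^+ 2.
Proof.
move=> Yf ox Ox; rewrite -exprMn; set G := h * enorm (grad_h K f x).
have G0 : 0 <= G by rewrite mulr_ge0// enorm_ge0.
have -> : G ^+ 2 = \sum_(q <- nodes K) phi q x * G ^+ 2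
    + (1 - \sum_(q <- nodes K) phi q x) * G ^+ 2.
  by rewrite -mulr_suml; ring.
have sqle t : `|t| <= G -> t ^+ 2 <= G ^+ 2.
  by move=> tG; rewrite -(real_normK (num_real t)) ler_sqr ?nnegrE.
apply: lerD.
  rewrite big_seq [leRHS]big_seq; apply: ler_sum => q qK.
  have [->|pn] := eqVneq (phi q x) 0; first by rewrite !mul0r.
  by rewrite ler_wpM2l ?phi0//; apply: sqle; exact: (off_faces_phi fK KO hphi dK ox Ox Yf qK pn).
have [->|sn] := eqVneq (\sum_(q <- nodes K) phi q x) 1; first by rewrite subrr !mul0r.
rewrite ler_wpM2l ?subr_ge0 ?sum_phi//; apply: sqle.
exact: (off_faces_phi0 fK KO hphi dK).
Qed.

Lemma lump_err_le f : Yh f ->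
  lump_err f f <= h ^+ 2 * nrmO (fun x => enorm (grad_h K f x)) ^+ 2.
Proof.
move=> Yf; have sE := sqint_enorm oO (fun i => grad_h_sqint oO bO i Yf).
have sf := Yh_sqint oO bO Yf.
rewrite lump_errE// nrm_sq /ip -RintegralZl//; last exact: sqint_mul.
apply: ae_le_Rintegral => //.
- exact: (integrableB mO (integrable_lump f) sf.2).
- by apply: integrable_Zl => //; exact: sqint_mul.
apply: filterS (off_faces_ae n0 fK) => x ox Ox.
have := nodal_variance_le Yf ox Ox; rewrite nodal_variance -(expand Yf Ox).
by apply: le_trans; rewrite le_eqVlt; apply/orP; left; apply/eqP; ring.
Qed.

Section quasi_interpolation.
Variables (u : V -> R) (a b : R).
Hypotheses (su : sq u) (a0 : a < 0) (b0 : 0 < b).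
Hypothesis uab : {ae mu, forall x, Omega x -> a <= u x <= b}.

(** If the mass vanishes, so does the moment in the numerator, by
    [average_moment_bounds]; hence [average_mass] holds in all cases. *)
Definition average (q : V) : R := ipO u (phi q) / mass q.

Lemma average_moment_bounds q : q \in nodes K ->
  a * mass q <= ipO u (phi q) <= b * mass q.
Proof.
move=> qK; have jp := sqint_integrable (sphi qK); have jup := sqint_mul mO su (sphi qK).
rewrite /mass -!RintegralZl//; apply/andP; split; apply: ae_le_Rintegral => //;
  try (by apply: integrable_Zl); apply: filterS uab => x + Ox => /(_ Ox)/andP[ax bx];
  by rewrite ler_wpM2r ?phi0.
Qed.

Lemma average_mass q : q \in nodes K -> average q * mass q = ipO u (phi q).
Proof.
move=> qK; rewrite /average; have [m0|mn] := eqVneq (mass q) 0; last by rewrite divfK.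
have := average_moment_bounds qK; rewrite m0 !mulr0 => /andP[x0 y0].
by apply/eqP; rewrite eq_le x0 y0.
Qed.

Lemma average_bounds q : q \in nodes K -> a <= average q <= b.
Proof.
move=> qK; have [m0|mn] := eqVneq (mass q) 0.
  by rewrite /average m0 invr0 mulr0 !ltW.
have mp : 0 < mass q by rewrite lt_def mn mass_ge0.
by rewrite /average ler_pdivlMr// ler_pdivrMr// average_moment_bounds.
Qed.

Definition quasi_interp (x : V) : R := \sum_(q <- nodes K) average q * phi q x.

Lemma quasi_interp_Yh : Yh quasi_interp.
Proof. by apply: Yh_sum => q; exact: phi_Yh. Qed.

Lemma quasi_interp_node q : q \in nodes K -> quasi_interp q = average q.
Proof.
move=> qK; rewrite /quasi_interp (bigD1_seq q)//=; last exact: uniq_nodes.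
have [_ ->//] := hphi qK; rewrite eqxx mulr1 big_seq_cond big1 ?addr0//.
move=> p /andP[pK pq]; have [_ ->//] := hphi pK.
by rewrite eq_sym (negbTE pq) mulr0.
Qed.

Lemma quasi_interp_bounds x : Omega x -> a <= quasi_interp x <= b.
Proof.
move=> Ox; have s1 := sum_phi Ox.
have s0 : 0 <= \sum_(q <- nodes K) phi q x.
  by rewrite big_seq; apply: sumr_ge0 => q qK; exact: phi0.
have lb : a * \sum_(q <- nodes K) phi q x <= quasi_interp x.
  rewrite mulr_sumr /quasi_interp big_seq [leRHS]big_seq; apply: ler_sum => q qK.
  by rewrite ler_wpM2r ?phi0//; have /andP[] := average_bounds qK.
have ub : quasi_interp x <= b * \sum_(q <- nodes K) phi q x.
  rewrite mulr_sumr /quasi_interp big_seq [leRHS]big_seq; apply: ler_sum => q qK.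
  by rewrite ler_wpM2r ?phi0//; have /andP[] := average_bounds qK.
move: (quasi_interp x) (\sum_(q <- _) _) s0 s1 lb ub => z s s0 s1 lb ub.
apply/andP; split; [apply: le_trans lb|apply: le_trans ub _].
  by rewrite -{1}[a]mulr1 ler_wnM2l// ltW.
by rewrite -{2}[b]mulr1 ler_wpM2l// ltW.
Qed.

Lemma lump_quasi_interp v : Yh v -> lump quasi_interp v = ipO u v.
Proof.
move=> Yv; apply: lump_average => // q qK.
by rewrite quasi_interp_node// average_mass.
Qed.

Lemma quasi_interp_L1 : \sum_(q <- nodes K) `|quasi_interp q| * mass q <=
  \int[mu]_(x in Omega) `|u x|.
Proof.
have sa := sqint_norm mO su.
have j q : q \in nodes K -> mu.-integrable Omega (EFin \o (fun x => `|u x| * phi q x)).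
  by move=> qK; apply: sqint_mul => //; exact: sphi.
apply: (@le_trans _ _ (\sum_(q <- nodes K) ipO (fun x => `|u x|) (phi q))).
  rewrite big_seq [leRHS]big_seq; apply: ler_sum => q qK.
  rewrite quasi_interp_node// -[mass q]ger0_norm ?mass_ge0// -normrM average_mass//.
  apply: le_trans (le_normr_Rintegral mO (sqint_mul mO su (sphi qK))) _.
  rewrite le_eqVlt; apply/orP; left; apply/eqP/eq_Rintegral => x /set_mem Ox.
  by rewrite normrM (ger0_norm (phi0 qK Ox)).
rewrite /ip -(integrable_Rsum_seq mO j).2; apply: le_Rintegral => //.
- exact: (integrable_Rsum_seq mO j).1.
- exact: sqint_integrable.
by move=> x Ox; rewrite -mulr_sumr ler_piMr// sum_phi.
Qed.

(** The right-hand side is quadratic in [k] and minimal at the average. *)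
Lemma average_best q k : q \in nodes K ->
  mass q * (average q - k) ^+ 2 <= \int[mu]_(x in Omega) (phi q x * (u x - k) ^+ 2).
Proof.
move=> qK; have jp := sqint_integrable (sphi qK); have jup := sqint_mul mO su (sphi qK).
have juu := sqint_mul mO su (sqint_phiM qK su).
have ex l : \int[mu]_(x in Omega) (phi q x * (u x - l) ^+ 2) =
    ipO u (fun x => phi q x * u x) - 2 * l * ipO u (phi q) + l ^+ 2 * mass q.
  rewrite /ip /mass -!RintegralZl//.
  rewrite -RintegralB//; last exact: integrable_Zl.
  rewrite -RintegralD//; last exact: integrable_Zl.
    by apply: eq_Rintegral => x _; ring.
  exact: (integrableB mO juu (integrable_Zl mO (2 * l) jup)).
rewrite ex.
have : 0 <= \int[mu]_(x in Omega) (phi q x * (u x - average q) ^+ 2).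
  by apply: Rintegral_ge0 => x Ox; rewrite mulr_ge0 ?sqr_ge0 ?phi0.
rewrite ex -average_mass//.
by move: (average q) (mass q) (ipO u _) => z m I; lra.
Qed.

(** The nodal values of the quasi-interpolant are averages of [S o p], hence close
    to [S o pt] at the nodes: [p] is close to [pt] in [L^2], and [pt] varies by at
    most [h |grad pt|] on a cell. The lumping error is the variance of the nodal
    values, so it is at most their squared deviation from [S (pt x)]. *)
Lemma lump_err_quasi_interp (S : R -> R) (p pt : V -> R) (l : R) :
  0 <= l -> (forall s t, `|S s - S t| <= l * `|s - t|) -> S 0 = 0 ->
  {ae mu, forall x, Omega x -> u x = S (p x)} -> sq p -> Yh pt ->
  lump_err quasi_interp quasi_interp <= l ^+ 2 *
    (4 * nrmO (fun x => p x - pt x) ^+ 2 +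
     6 * (h ^+ 2 * nrmO (fun x => enorm (grad_h K pt x)) ^+ 2)).
Proof.
move=> l0 Slip S0 uS sp Ypt; have spt := Yh_sqint oO bO Ypt.
have sE := sqint_enorm oO (fun i => grad_h_sqint oO bO i Ypt).
have sd := sqintB mO sp spt.
pose g x := enorm (grad_h K pt x).
have jg : mu.-integrable Omega (EFin \o (fun x => g x ^+ 2)) by case: sE.
have jd : mu.-integrable Omega (EFin \o (fun x => (p x - pt x) ^+ 2)) by case: sd.
have ig : \int[mu]_(x in Omega) g x ^+ 2 = nrmO g ^+ 2.
  by rewrite nrm_sq; apply: eq_Rintegral => x _; rewrite expr2.
have id : \int[mu]_(x in Omega) (p x - pt x) ^+ 2 = nrmO (fun x => p x - pt x) ^+ 2.
  by rewrite nrm_sq; apply: eq_Rintegral => x _; rewrite expr2.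
have Ssq s t : (S s - S t) ^+ 2 <= l ^+ 2 * (s - t) ^+ 2.
  rewrite -exprMn -(real_normK (num_real (S s - S t))) -(real_normK (num_real (l * _))).
  by rewrite ler_sqr ?nnegrE ?normr_ge0// normrM (ger0_norm l0).
have sqD x y : (x + y) ^+ 2 <= 2 * x ^+ 2 + 2 * y ^+ 2 :> R.
  by have := sqr_ge0 (x - y); rewrite !expr2; lra.
(* bounded through the squared deviation of u itself, by average_best *)
pose D := \sum_(q <- nodes K) mass q * (average q - S (pt q)) ^+ 2.
have DE : D <= l ^+ 2 * (2 * nrmO (fun x => p x - pt x) ^+ 2 + 2 * (h ^+ 2 * nrmO g ^+ 2)).
  have j q : q \in nodes K -> mu.-integrable Omega
      (EFin \o (fun x => phi q x * (u x - S (pt q)) ^+ 2)).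
    move=> qK; have s1 := sqintB mO su (sqint1_cst (S (pt q))).
    have := sqint_mul mO s1 (sqint_phiM qK s1).
    by apply: eq_integrable => // x _ /=; congr EFin; ring.
  apply: (@le_trans _ _ (\sum_(q <- nodes K)
      \int[mu]_(x in Omega) (phi q x * (u x - S (pt q)) ^+ 2))).
    rewrite /D big_seq [leRHS]big_seq; apply: ler_sum => q qK; exact: average_best.
  rewrite -(integrable_Rsum_seq mO j).2 -id -ig.
  rewrite -!RintegralZl//; try exact: integrable_Zl.
  rewrite -RintegralD//; try (by do ?exact: integrable_Zl); last first.
    by do 2 apply: integrable_Zl => //.
  rewrite -RintegralZl//; last first.
    apply: (integrable_Dl mO (integrable_Zl mO 2 jd)).
    exact: (integrable_Zl mO 2 (integrable_Zl mO (h ^+ 2) jg)).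
  apply: ae_le_Rintegral => //.
  - exact: (integrable_Rsum_seq mO j).1.
  - apply: integrable_Zl => //; apply: (integrable_Dl mO (integrable_Zl mO 2 jd)).
    exact: (integrable_Zl mO 2 (integrable_Zl mO (h ^+ 2) jg)).
  apply: filterS2 (off_faces_ae n0 fK) uS => x ox + Ox => /(_ Ox) ux.
  set E := l ^+ 2 * _; apply: (@le_trans _ _ (\sum_(q <- nodes K) phi q x * E)).
    rewrite big_seq [leRHS]big_seq; apply: ler_sum => q qK.
    have [->|pn] := eqVneq (phi q x) 0; first by rewrite !mul0r.
    rewrite ler_wpM2l ?phi0// ux; apply: le_trans (Ssq _ _) _.
    rewrite ler_wpM2l ?sqr_ge0//.
    have := off_faces_phi fK KO hphi dK ox Ox Ypt qK pn => pq.
    have -> : p x - pt q = (p x - pt x) + (pt x - pt q) by ring.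
    apply: le_trans (sqD _ _) _; rewrite lerD2l ler_wpM2l// -exprMn.
    rewrite -(real_normK (num_real (pt x - pt q))) ler_sqr ?nnegrE// ?mulr_ge0 ?enorm_ge0//.
    by rewrite distrC.
  rewrite -mulr_suml ler_piMl ?sum_phi//.
  by rewrite /E mulr_ge0 ?sqr_ge0// addr_ge0// mulr_ge0 ?sqr_ge0// mulr_ge0 ?sqr_ge0.
apply: (@le_trans _ _ (2 * D + 2 * l ^+ 2 * (h ^+ 2 * nrmO g ^+ 2))); last first.
  rewrite -/g; move: DE.
  move: (nrmO g ^+ 2) (nrmO (fun x => p x - pt x) ^+ 2) (l ^+ 2) D (h ^+ 2).
  by move=> G P L D H; lra.
have Yq := quasi_interp_Yh.
have jq q : q \in nodes K -> mu.-integrable Omega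
    (EFin \o (fun x => (average q - S (pt q)) ^+ 2 * phi q x)).
  by move=> qK; apply: integrable_Zl => //; exact/sqint_integrable/sphi.
have D_int : D = \int[mu]_(x in Omega)
    (\sum_(q <- nodes K) (average q - S (pt q)) ^+ 2 * phi q x).
  rewrite (integrable_Rsum_seq mO jq).2; apply: eq_big_seq => q qK.
  by rewrite RintegralZl ?(mulrC (mass q))//; exact/sqint_integrable/sphi.
have j1 := integrable_Zl mO 2 (integrable_Rsum_seq mO jq).1.
have j2 := integrable_Zl mO (2 * l ^+ 2) (integrable_Zl mO (h ^+ 2) jg).
rewrite lump_errE// D_int -ig -!RintegralZl//; try exact: integrable_Zl;
  try exact: (integrable_Rsum_seq mO jq).1.
rewrite -RintegralD//; apply: ae_le_Rintegral => //.
- exact: (integrableB mO (integrable_lump _) (Yh_sqint oO bO Yq).2).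
- exact: (integrable_Dl mO j1 j2).
apply: filterS (off_faces_ae n0 fK) => x ox Ox.
pose k := S (pt x).
have := nodal_variance quasi_interp k x; rewrite -(expand Yq Ox) => vE.
apply: (@le_trans _ _ (\sum_(q <- nodes K) phi q x * (quasi_interp q - k) ^+ 2
    + (1 - \sum_(q <- nodes K) phi q x) * k ^+ 2)).
  by rewrite vE; have := sqr_ge0 (quasi_interp x - k); rewrite sqrrB; lra.
set E := l ^+ 2 * (h ^+ 2 * g x ^+ 2).
have E0 : 0 <= E by rewrite /E mulr_ge0 ?sqr_ge0// mulr_ge0 ?sqr_ge0.
have t1 : \sum_(q <- nodes K) phi q x * (quasi_interp q - k) ^+ 2 <=
    2 * (\sum_(q <- nodes K) (average q - S (pt q)) ^+ 2 * phi q x) +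
    (\sum_(q <- nodes K) phi q x) * (2 * E).
  rewrite mulr_sumr mulr_suml -big_split big_seq [leRHS]big_seq /=.
  apply: ler_sum => q qK; rewrite quasi_interp_node//.
  have [->|pn] := eqVneq (phi q x) 0; first by rewrite !(mul0r, mulr0) addr0.
  rewrite mulrA [_ * phi q x]mulrC -mulrDr ler_wpM2l ?phi0//.
  have -> : average q - k = (average q - S (pt q)) + (S (pt q) - k) by ring.
  apply: le_trans (sqD _ _) _; rewrite lerD2l ler_wpM2l//.
  apply: le_trans (Ssq _ _) _; rewrite /E ler_wpM2l ?sqr_ge0// -exprMn.
  rewrite -(real_normK (num_real (pt q - pt x))) ler_sqr ?nnegrE// ?mulr_ge0 ?enorm_ge0//.
  exact: (off_faces_phi fK KO hphi dK ox Ox Ypt qK pn).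
have t2 : (1 - \sum_(q <- nodes K) phi q x) * k ^+ 2 <=
    (1 - \sum_(q <- nodes K) phi q x) * (2 * E).
  have [->|sn] := eqVneq (\sum_(q <- nodes K) phi q x) 1; first by rewrite subrr !mul0r.
  rewrite ler_wpM2l ?subr_ge0 ?sum_phi//.
  apply: (@le_trans _ _ E); last by lra.
  have := Ssq (pt x) 0; rewrite S0 !subr0 => /le_trans; apply.
  rewrite /E ler_wpM2l ?sqr_ge0// -exprMn.
  rewrite -(real_normK (num_real (pt x))) ler_sqr ?nnegrE// ?mulr_ge0 ?enorm_ge0//.
  exact: (off_faces_phi0 fK KO hphi dK).
apply: le_trans (lerD t1 t2) _.
by rewrite le_eqVlt; apply/orP; left; apply/eqP; rewrite /E; ring.
Qed.

End quasi_interpolation.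

End lumping.

(** * Variational inequalities *)

Section expansions.
Context d (T : measurableType d) (R : realType).
Variable mu : {measure set T -> \bar R}.
Variable D : set T.
Hypothesis mD : measurable D.
Implicit Types f g : T -> R.

Lemma sqint_subset (D' : set T) f : measurable D' -> D' `<=` D ->
  sqint mu D f -> sqint mu D' f.
Proof.
move=> mD' DD [mf jf]; split; first exact: measurable_funS mf.
exact: integrableS jf.
Qed.

Lemma ip_segment f g (t : R) : sqint mu D f -> sqint mu D g ->
  ip mu D (fun x => f x + t * g x) (fun x => f x + t * g x) =
  ip mu D f f + 2 * t * ip mu D f g + t ^+ 2 * ip mu D g g.
Proof.
move=> sf sg; have sZ := sqintZ mD t sg; have sS := sqintD mD sf sZ.
by rewrite ipDl// !ipDr// !ipZl// !ipZr// (ipC mu D g f); ring.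
Qed.

Lemma norm_segment_le (t r s : R) : 0 <= t -> t <= 1 ->
  `|r + t * (s - r)| <= `|r| + t * (`|s| - `|r|).
Proof.
move=> t0 t1; rewrite (_ : r + t * (s - r) = (1 - t) * r + t * s); last by ring.
apply: le_trans (ler_normD _ _) _.
rewrite !normrM (ger0_norm t0) ger0_norm ?subr_ge0//.
by rewrite le_eqVlt; apply/orP; left; apply/eqP; ring.
Qed.

End expansions.

Section optimality.
Context (R : realType) (n : nat).
Local Notation V := 'rV[R]_n.
Local Notation mu := (lebesgue_rV R n).
Variable Omega : set V.
Hypothesis oO : open Omega.
Hypothesis bO : bounded_set Omega.
Let mO : measurable Omega := open_measurable_rV oO.
Variables (A : V -> 'M[R]_n) (c0 : V -> R).
Hypothesis hA : elliptic Omega A c0.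
Variables (yc yd : V -> R) (a b alpha beta : R).
Hypotheses (a0 : a < 0) (b0 : 0 < b) (alpha0 : 0 < alpha) (beta0 : 0 < beta).
Local Notation sq := (sqint mu Omega).
Local Notation ipO := (ip mu Omega).
Local Notation nrmO := (nrm mu Omega).
Hypotheses (syc : sq yc) (syd : sq yd).
Implicit Types (u v y e : V -> R).

Definition between v : Prop := {ae mu, forall x, Omega x -> a <= v x <= b}.

Lemma between_segment u v t : 0 <= t -> t <= 1 -> between u -> between v ->
  between (fun x => u x + t * (v x - u x)).
Proof.
move=> t0 t1; apply: filterS2 => x + + Ox => /(_ Ox)/andP[ua ub] /(_ Ox)/andP[va vb].
by move: (u x) (v x) ua ub va vb => p q *; apply/andP; split; nra.
Qed.

Lemma nrm_between v : sq v -> between v -> nrmO v <= nrmO (fun=> Num.max (- a) b).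
Proof.
move=> sv vab; have sM := sqint1_cst oO bO (Num.max (- a) b).
rewrite -(@ler_pXn2r _ 2)// ?nnegrE ?nrm_ge0// !nrm_sq; apply: ae_le_ip => //.
apply: filterS vab => x + Ox => /(_ Ox)/andP[va vb].
have M1 : - a <= Num.max (- a) b by rewrite le_max lexx.
have M2 : b <= Num.max (- a) b by rewrite le_max lexx orbT.
by move: (Num.max _ _) M1 M2 => M M1 M2; nra.
Qed.

Variables (y u z : V -> R).
Hypothesis opt : optimal Omega A c0 yc yd a b alpha beta y u z.

Let fe_ : feasible Omega A c0 yc a b y u z := opt.1.

Lemma optimal_sqint : sq u.
Proof. by case: fe_ => /(L2P mO). Qed.

Lemma optimal_between : between u.
Proof.
case: fe_ => _ _ _ uz [_ zab].
by apply: filterS2 uz zab => x uz zab Ox; rewrite uz// zab.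
Qed.

Lemma optimal_state : exists g, weak_solution Omega A c0 (u \+ yc) y g.
Proof. by case: fe_. Qed.

Lemma optimal_state_sqint : sq y.
Proof.
have [g /(weak_solutionP oO hA)[hy _]] := optimal_state.
by have [] := H10_sqint1 oO hy.
Qed.

Let su := optimal_sqint.
Let sy := optimal_state_sqint.

Lemma optimal_costE : cost Omega yd alpha beta y u z =
  1 / 2 * ipO (fun x => y x - yd x) (fun x => y x - yd x)
  + alpha / 2 * ipO u u + beta * \int[mu]_(x in Omega) `|u x|.
Proof.
have [_ /(L2P mO) sz _ uz _] := fe_.
rewrite /cost !L2normE// ?nrm_sq; last exact: (sqintB mO sy syd).
have -> : ipO z z = ipO u u.
  apply: ae_eq_ip => //; try by case: sz; try by case: su.
  by apply: filterS uz => x uz Ox; rewrite uz.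
rewrite L1normE; last exact: (sqint_integrable oO bO).
have -> : \int[mu]_(x in Omega) `|z x| = \int[mu]_(x in Omega) `|u x|.
  apply: ae_eq_Rintegral => //.
  - by apply: measurableT_comp => //; case: sz.
  - by apply: measurableT_comp => //; case: su.
  - by apply: filterS uz => x uz Ox; rewrite uz.
by rewrite (_ : y \- yd = fun x => y x - yd x)//; field.
Qed.

Lemma diag_costE y' u' : sq y' -> sq u' -> cost Omega yd alpha beta y' u' u' =
  1 / 2 * ipO (fun x => y' x - yd x) (fun x => y' x - yd x)
  + alpha / 2 * ipO u' u' + beta * \int[mu]_(x in Omega) `|u' x|.
Proof.
move=> sy' su'; rewrite /cost !L2normE// ?nrm_sq; last exact: (sqintB mO sy' syd).
rewrite L1normE; last exact: (sqint_integrable oO bO).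
by rewrite (_ : y' \- yd = fun x => y' x - yd x)//; field.
Qed.

(** Expand the quadratic part of the cost along the segment from [u] to [v], and
    bound the [L^1] part by convexity. *)
Lemma continuous_VI v e ge : sq v -> between v ->
  weak_solution Omega A c0 (fun x => v x - u x) e ge ->
  0 <= ipO (fun x => y x - yd x) e + alpha * ipO u (fun x => v x - u x)
       + beta * (\int[mu]_(x in Omega) `|v x| - \int[mu]_(x in Omega) `|u x|).
Proof.
move=> sv vab we; have [g wy] := optimal_state.
have sd := sqintB mO sv su; have syy := sqintB mO sy syd.
have se : sq e.
  by have /(weak_solutionP oO hA)[he _] := we; have [] := H10_sqint1 oO he.
apply: (@first_order_ge0 _ _ (1 / 2 * ipO e e
  + alpha / 2 * ipO (fun x => v x - u x) (fun x => v x - u x))) => t t0 t1.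
have sut := sqintD mO su (sqintZ mO t sd).
have syt := sqintD mO sy (sqintZ mO t se).
have suc := sqintD mO su syc.
have wt := weak_solution_lin oO hA t suc sd wy we.
have := opt.2 (fun x => y x + t * e x) (fun x => u x + t * (v x - u x))
  (fun x => u x + t * (v x - u x)).
rewrite optimal_costE diag_costE//.
have -> : (fun x => y x + t * e x - yd x) = (fun x => (y x - yd x) + t * e x).
  by apply/funext => x; ring.
rewrite !ip_segment//.
have ab : \int[mu]_(x in Omega) `|u x + t * (v x - u x)| <=
    \int[mu]_(x in Omega) `|u x| + t * (\int[mu]_(x in Omega) `|v x| - \int[mu]_(x in Omega) `|u x|).
  have ju := sqint_integrable oO bO (sqint_norm mO su).
  have jv := sqint_integrable oO bO (sqint_norm mO sv).
  have jd : mu.-integrable Omega (EFin \o (fun x => `|v x| - `|u x|)).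
    exact: (sqint_integrable oO bO (sqintB mO (sqint_norm mO sv) (sqint_norm mO su))).
  rewrite -RintegralB// -RintegralZl// -RintegralD//; last exact: integrable_Zl.
  apply: le_Rintegral => //.
  - exact: (sqint_integrable oO bO (sqint_norm mO sut)).
  - exact: (integrable_Dl mO ju (integrable_Zl mO t jd)).
  - by move=> x _; apply: norm_segment_le => //; exact: ltW.
have ft : feasible Omega A c0 yc a b (fun x => y x + t * e x)
    (fun x => u x + t * (v x - u x)) (fun x => u x + t * (v x - u x)).
  split; [exact/(L2P mO)|exact/(L2P mO)| |by apply: filterS (filterT) => x _ _|].
    exists (fun x => g x + t *: ge x); congr (weak_solution _ _ _ _ _ _): wt.
    by apply/funext => x /=; ring.
  by split; [exact/(L2P mO)|apply: between_segment => //; [exact: ltW|exact: optimal_between]].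
move=> /(_ ft).
move: (\int[mu]_(x in Omega) _) ab => I ab.
move: (ipO _ _) (ipO _ _) (ipO _ _) (ipO _ _) (ipO _ _) (ipO _ _) => *.
have := ler_wpM2l (ltW beta0) ab; lra.
Qed.

(** The candidate [shrink (p x)] is admissible: add the inequality for [u] tested
    with it and the pointwise inequality tested with [u]. The adjoint state comes
    in through the symmetry of the solution operator. *)
Lemma projection_formula (i0 : 'I_n) K p gp : (forall x, Omega x -> `|x| <= K) ->
  weak_solution Omega A c0 (fun x => y x - yd x) p gp ->
  {ae mu, forall x, Omega x -> u x = shrink a b alpha beta (p x)}.
Proof.
move=> OK wp; have syy := sqintB mO sy syd.
have sp : sq p.
  by have /(weak_solutionP oO hA)[hp _] := wp; have [] := H10_sqint1 oO hp.
pose v x := shrink a b alpha beta (p x).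
have sv : sq v.
  apply: (le_sqint mO (sqintZ mO alpha^-1 sp) (sqint0 mu mO)).
    by apply: measurableT_comp; [exact: measurable_shrink|case: sp].
  move=> x _; rewrite normr0 addr0 normrM ger0_norm ?invr_ge0 ?(ltW alpha0)//.
  exact: shrink_le.
have vab : between v by apply: filterS (filterT) => x _ _; exact: shrink_bounds.
have sd := sqintB mO sv su.
have [e [ge we]] := weak_solution_exists oO hA i0 OK sd.
have h1 := continuous_VI sv vab we.
have /(weak_solutionP oO hA)[hp Hp] := wp.
have /(weak_solutionP oO hA)[he He] := we.
have ee : ipO (fun x => y x - yd x) e = ipO (fun x => v x - u x) p.
  rewrite -(Hp _ _ he) -(He _ _ hp) (aformC oO hA)//; exact: H10_sqint1.
rewrite ee in h1.
have ja := sqint_integrable oO bO (sqint_norm mO su).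
have jb := sqint_integrable oO bO (sqint_norm mO sv).
have sD := sqintB mO su sv.
have sA := sqintD mO (sqintZ mO alpha sv) sp.
have h2 : 0 <= ipO (fun x => alpha * v x + p x) (fun x => u x - v x)
    + beta * (\int[mu]_(x in Omega) `|u x| - \int[mu]_(x in Omega) `|v x|).
  rewrite -RintegralB// -RintegralZl//; last first.
    exact: (sqint_integrable oO bO (sqintB mO (sqint_norm mO su) (sqint_norm mO sv))).
  have jn := integrable_Zl mO beta
    (sqint_integrable oO bO (sqintB mO (sqint_norm mO su) (sqint_norm mO sv))).
  rewrite /ip -RintegralD//; last exact: sqint_mul.
  rewrite -[leLHS](_ : \int[mu]_(x in Omega) 0 = 0); last by rewrite Rintegral_cst// mul0r.
  apply: ae_le_Rintegral => //.
  - exact: (sqint_integrable oO bO (sqint0 mu mO)).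
  - exact: (integrable_Dl mO (sqint_mul mO sA sD) jn).
  apply: filterS optimal_between => x + Ox => /(_ Ox) uab.
  exact: shrink_VI.
have h3 : ipO (fun x => u x - v x) (fun x => u x - v x) <= 0.
  move: h1 h2; have sZ := sqintZ mO alpha sv.
  rewrite (ipBl mO sv su sp) (ipBr mO sv su su) (ipDl mO sZ sp sD) (ipZl mO _ sv sD).
  rewrite !(ipBl mO su sv sD) !(ipBr mO su sv) //.
  rewrite (ipC mu Omega p u) (ipC mu Omega p v) (ipC mu Omega v u).
  move: (\int[mu]_(x in Omega) _) (\int[mu]_(x in Omega) _) => I J h1 h2.
  suff : 0 <= alpha * - (ipO u u - ipO u v - (ipO u v - ipO v v)).
    by rewrite pmulr_rge0// oppr_ge0.
  by move: (ipO u p) (ipO v p) (ipO u u) (ipO u v) (ipO v v) h1 h2 => *; lra.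
have h4 : ipO (fun x => u x - v x) (fun x => u x - v x) = 0.
  by apply/eqP; rewrite eq_le h3 ip_ge0.
have := integral_sqr mO sD; rewrite h4 => h5.
have : ae_eq mu Omega (fun x => ((u x - v x) ^+ 2)%:E) (cst 0%E).
  apply/ae_eq_integral_abs => //.
    apply/measurable_EFinP; apply: measurable_funX; exact: sD.1.
  by rewrite -[RHS]h5; apply: eq_integral => x _; rewrite gee0_abs// lee_fin sqr_ge0.
apply: filterS => x + Ox => /(_ Ox) [] /eqP; rewrite sqrf_eq0 subr_eq0 => /eqP.
by [].
Qed.

End optimality.

Section discrete_optimality.
Context (R : realType) (n : nat).
Local Notation V := 'rV[R]_n.
Local Notation mu := (lebesgue_rV R n).
Variable Omega : set V.
Hypothesis oO : open Omega.
Hypothesis bO : bounded_set Omega.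
Let mO : measurable Omega := open_measurable_rV oO.
Variables (A : V -> 'M[R]_n) (c0 : V -> R).
Hypothesis hA : elliptic Omega A c0.
Variables (yc yd : V -> R) (a b alpha beta : R).
Hypotheses (alpha0 : 0 < alpha) (beta0 : 0 < beta).
Variable K : seq (n.+1.-tuple V).
Hypothesis fK : forall T : n.+1.-tuple V, T \in K ->
  free [seq x - thead T | x <- behead T].
Hypothesis KO : mesh_domain K `<=` Omega.
Variable phi : V -> V -> R.
Hypothesis hphi : nodal_basis Omega K phi.
Local Notation Yh := (Yh Omega K).
Local Notation sq := (sqint mu Omega).
Local Notation ipO := (ip mu Omega).
Local Notation mass := (mass Omega phi).
Local Notation lump := (lump Omega K phi).
Hypotheses (syc : sq yc) (syd : sq yd).
Implicit Types (u v y e : V -> R).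

Let mM : measurable (mesh_domain K) := open_measurable_rV (@open_interior _ _).

Lemma mesh_massE q : q \in nodes K -> \int[mu]_(x in mesh_domain K) phi q x = mass q.
Proof.
move=> qK; apply: mesh_integral => // x Ox nx.
by apply: (Yh_out (phi_Yh hphi qK)) => //; exact: subset_closure.
Qed.

Let sumM (c : V -> R) : \sum_(q <- nodes K) c q * \int[mu]_(x in mesh_domain K) phi q x =
  \sum_(q <- nodes K) c q * mass q.
Proof. by apply: eq_big_seq => q qK; rewrite mesh_massE. Qed.

Lemma L2h_normE w : L2h_norm K phi w ^+ 2 = lump w w.
Proof.
rewrite /L2h_norm sumM sqr_sqrtr//.
rewrite big_seq; apply: sumr_ge0 => q qK.
by rewrite mulr_ge0 ?sqr_ge0// (mass_ge0 fK KO hphi).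
Qed.

Lemma L1h_normE w : L1h_norm K phi w = \sum_(q <- nodes K) `|w q| * mass q.
Proof. exact: sumM. Qed.

Lemma mesh_ipE f e : Yh e -> ip mu (mesh_domain K) f e = ipO f e.
Proof.
move=> Ye; apply: mesh_integral => // x Ox nx.
by rewrite (Yh_out Ye) ?mulr0//; exact: subset_closure.
Qed.

Lemma cost_hE y u : sq y -> Yh u -> cost_h K phi yd alpha beta y u u =
  1 / 2 * ip mu (mesh_domain K) (fun x => y x - yd x) (fun x => y x - yd x)
  + alpha / 4 * ipO u u + alpha / 4 * lump u u
  + beta * \sum_(q <- nodes K) `|u q| * mass q.
Proof.
move=> sy Yu; have sub f := sqint_subset (f := f) mO mM KO.
rewrite /cost_h L2h_normE L1h_normE !L2normE ?nrm_sq ?(mesh_ipE _ Yu)//.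
- exact: sub (Yh_sqint oO bO Yu).
- exact/sub/(sqintB mO sy syd).
Qed.

Variables (yh uh zh : V -> R).
Hypothesis opt : optimal_h Omega K phi A c0 yc yd a b alpha beta yh uh zh.

Lemma optimal_h_Yh : Yh uh. Proof. by case: opt => -[]. Qed.

Lemma optimal_h_between : between Omega a b uh.
Proof.
have [_ _ _ uz [_ [_]]] := opt.1.
by apply: filterS => x + Ox => /(_ Ox); rewrite uz//; exact: subset_closure.
Qed.

Lemma optimal_h_state : discrete_solution Omega K A c0 (uh \+ yc) yh.
Proof. by case: opt => -[]. Qed.

Let Yu := optimal_h_Yh.
Let su : sq uh := Yh_sqint oO bO Yu.

Lemma optimal_h_state_Yh : Yh yh.
Proof. by have /(discrete_solutionP oO bO hA KO)[] := optimal_h_state. Qed.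

Lemma optimal_h_costE :
  cost_h K phi yd alpha beta yh uh zh = cost_h K phi yd alpha beta yh uh uh.
Proof.
have [_ _ _ uz _] := opt.1; have nc := nodes_closure KO.
rewrite /cost_h /L2h_norm /L1h_norm; congr (_ + _ * Num.sqrt _ ^+ 2 + _ * _);
  by apply: eq_big_seq => q /nc Oq; rewrite uz.
Qed.

(** As [continuous_VI]; half of the quadratic cost of the control is lumped. *)
Lemma discrete_VI v e : Yh v -> between Omega a b v ->
  discrete_solution Omega K A c0 (fun x => v x - uh x) e ->
  0 <= ipO (fun x => yh x - yd x) e + alpha / 2 * ipO uh (fun x => v x - uh x)
    + alpha / 2 * lump uh (fun x => v x - uh x)
    + beta * (\sum_(q <- nodes K) `|v q| * mass q - \sum_(q <- nodes K) `|uh q| * mass q).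
Proof.
move=> Yv vab we; have wy := optimal_h_state.
have sv := Yh_sqint oO bO Yv; have sd := sqintB mO sv su.
have Yd : Yh (fun x => v x - uh x).
  by have := Yh_lin (-1) Yv Yu; congr (Defs.Yh _ _ _); apply/funext => x; ring.
have Ye : Yh e by have /(discrete_solutionP oO bO hA KO)[] := we.
have Yy := optimal_h_state_Yh.
have se := Yh_sqint oO bO Ye; have sy := Yh_sqint oO bO Yy.
have syy := sqintB mO sy syd.
apply: (@first_order_ge0 _ _ (1 / 2 * ip mu (mesh_domain K) e e
  + alpha / 4 * ipO (fun x => v x - uh x) (fun x => v x - uh x)
  + alpha / 4 * lump (fun x => v x - uh x) (fun x => v x - uh x))) => t t0 t1.
have Yut := Yh_lin t Yu Yd.
have syt := sqintD mO sy (sqintZ mO t se).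
have wt := discrete_solution_lin oO bO hA KO t (sqintD mO su syc) sd wy we.
have := opt.2 (fun x => yh x + t * e x) (fun x => uh x + t * (v x - uh x))
  (fun x => uh x + t * (v x - uh x)).
rewrite optimal_h_costE !cost_hE//.
have -> : (fun x => yh x + t * e x - yd x) = (fun x => (yh x - yd x) + t * e x).
  by apply/funext => x; ring.
rewrite (ip_segment mM)//; [|exact: (sqint_subset mO mM KO)|exact: (sqint_subset mO mM KO)].
rewrite (ip_segment mO)// (mesh_ipE _ Ye) (lump_lin Omega K phi uh).
rewrite ![lump _ (fun x => uh x + _)]lumpC !lump_lin.
rewrite [lump (fun x => v x - uh x) uh]lumpC.
have ab : \sum_(q <- nodes K) `|uh q + t * (v q - uh q)| * mass q <=
    \sum_(q <- nodes K) `|uh q| * mass q + t * (\sum_(q <- nodes K) `|v q| * mass q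
      - \sum_(q <- nodes K) `|uh q| * mass q).
  rewrite -sumrB mulr_sumr -big_split big_seq [leRHS]big_seq; apply: ler_sum => q qK /=.
  rewrite -mulrBl mulrA -mulrDl ler_wpM2r ?(mass_ge0 fK KO hphi)//.
  by apply: norm_segment_le => //; exact: ltW.
have ft : feasible_h Omega K A c0 yc a b (fun x => yh x + t * e x)
    (fun x => uh x + t * (v x - uh x)) (fun x => uh x + t * (v x - uh x)).
  split=> //.
    congr (discrete_solution _ _ _ _ _ _): wt.
    by apply/funext => x /=; ring.
  split=> //; split; first by apply/(L2P mO); exact: (Yh_sqint oO bO Yut).
  by apply: between_segment => //; [exact: ltW|exact: optimal_h_between].
move=> /(_ ft).
move: (\sum_(q <- _) `|_ + _| * _) ab => I ab.
move: (\sum_(q <- _) _) (\sum_(q <- _) _) ab => I1 I2 ab.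
have := ler_wpM2l (ltW beta0) ab; lra.
Qed.

End discrete_optimality.

(** * The error estimate *)

(** [buu], [bup], [bpp], [bqp], [bqq] are the values of the lumping error at the
    discrete control, at the quasi-interpolant and at the discrete adjoint state:
    its nonnegativity at [u_h + pi / 2] and at [q_h + alpha pi] bounds the mixed
    terms. *)
Lemma error_balance (R : realFieldType) (alpha alpha0 h h0 c1 : R)
    (E W Y Z Y1 Z1 D0 D1 buu bup bpp bqp bqq : R) :
  0 < alpha -> alpha <= alpha0 -> 0 < h -> h <= h0 -> 0 <= c1 ->
  0 <= Y -> Y <= Y1 -> 0 <= Z -> Z <= Z1 ->
  0 <= buu + bup + bpp / 4 -> 0 <= bqq + 2 * alpha * bqp + alpha ^+ 2 * bpp ->
  bpp <= alpha^-1 ^+ 2 * (h ^+ 2 * D0) -> bqq <= h ^+ 2 * D1 ->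
  0 <= E -> 0 <= W -> W <= c1 * h ^+ 2 * Z ->
  alpha * E ^+ 2 + alpha / 2 * (bup + buu) + bqp <=
    Y * (c1 * h ^+ 2 * E) + W ^+ 2 / 4 ->
  E ^+ 2 <= (alpha^-1 * h) ^+ 2 *
    (2 * (5 / 8 * D0 + D1 / 2 + c1 ^+ 2 * h0 ^+ 2 * Y1 ^+ 2 / 2
      + c1 ^+ 2 * h0 ^+ 2 * alpha0 * Z1 ^+ 2 / 4)).
Proof.
move=> al0 ala hp hh0 c10 Y0 YY Z0 ZZ s1 s2 b1 b2 E0 W0 WZ main.
have an : alpha != 0 by rewrite gt_eqF.
have ai : alpha * alpha^-1 = 1 by rewrite divff.
have i0 : 0 < alpha^-1 by rewrite invr_gt0.
have sq2 x y : 0 <= x -> x <= y -> x ^+ 2 <= y ^+ 2 :> R.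
  by move=> x0 xy; rewrite ler_sqr ?nnegrE// (le_trans x0 xy).
set i := alpha^-1 in b1 ai i0 *.
(* all terms are multiplied by alpha, to avoid divisions *)
have t1 : - (alpha ^+ 2 / 2 * (bup + buu)) <= alpha ^+ 2 * bpp / 8.
  by have := mulr_ge0 (sqr_ge0 alpha) s1; lra.
have t2 : - (alpha * bqp) <= bqq / 2 + alpha ^+ 2 * bpp / 2 by lra.
have t3 : alpha ^+ 2 * bpp <= h ^+ 2 * D0.
  have := ler_wpM2l (sqr_ge0 alpha) b1.
  by rewrite mulrA -exprMn ai expr1n mul1r.
have t4 : alpha * (Y * (c1 * h ^+ 2 * E)) <= alpha ^+ 2 * E ^+ 2 / 2
    + (Y * c1 * h ^+ 2) ^+ 2 / 2.
  by have := sqr_ge0 (alpha * E - Y * c1 * h ^+ 2); lra.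
have t5 : (Y * c1 * h ^+ 2) ^+ 2 <= h ^+ 2 * (c1 ^+ 2 * h0 ^+ 2 * Y1 ^+ 2).
  rewrite [leLHS](_ : _ = h ^+ 2 * (c1 ^+ 2 * (h ^+ 2 * Y ^+ 2))); last by ring.
  rewrite -(mulrA (c1 ^+ 2)) !ler_wpM2l ?sqr_ge0//.
  by apply: ler_pM; rewrite ?sqr_ge0// sq2// ltW.
have t6 : alpha * W ^+ 2 <= h ^+ 2 * (c1 ^+ 2 * h0 ^+ 2 * alpha0 * Z1 ^+ 2).
  apply: (@le_trans _ _ (alpha * (c1 * h ^+ 2 * Z) ^+ 2)).
    by rewrite ler_wpM2l ?sq2// ltW.
  rewrite [leLHS](_ : _ = h ^+ 2 * (c1 ^+ 2 * (h ^+ 2 * (alpha * Z ^+ 2)))); last by ring.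
  have hh : h ^+ 2 <= h0 ^+ 2 by rewrite sq2// ltW.
  have zz : alpha * Z ^+ 2 <= alpha0 * Z1 ^+ 2.
    by apply: ler_pM; rewrite ?sqr_ge0 ?sq2// ltW.
  have z0 : 0 <= alpha * Z ^+ 2 by rewrite mulr_ge0 ?sqr_ge0// ltW.
  rewrite ler_wpM2l ?sqr_ge0// -2!mulrA ler_wpM2l ?sqr_ge0//.
  by apply: ler_pM => //; exact: sqr_ge0.
have main' := ler_wpM2l (ltW al0) main.
have fin : alpha ^+ 2 * E ^+ 2 <= h ^+ 2 *
    (2 * (5 / 8 * D0 + D1 / 2 + c1 ^+ 2 * h0 ^+ 2 * Y1 ^+ 2 / 2
      + c1 ^+ 2 * h0 ^+ 2 * alpha0 * Z1 ^+ 2 / 4)).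
  by move: t1 t2 t3 t4 t5 t6 main' b2; lra.
have := ler_wpM2l (sqr_ge0 i) fin.
by rewrite (mulrA _ (alpha ^+ 2)) -exprMn (mulrC i) ai expr1n mul1r (mulrA (i ^+ 2)) -exprMn.
Qed.

Section error_bound.
Context (R : realType) (n : nat).
Local Notation V := 'rV[R]_n.
Local Notation mu := (lebesgue_rV R n).
Variable i0 : 'I_n.
Variable Omega : set V.
Hypothesis oO : open Omega.
Hypothesis bO : bounded_set Omega.
Variable Kb : R.
Hypothesis OK : forall x, Omega x -> `|x| <= Kb.
Let mO : measurable Omega := open_measurable_rV oO.
Variables (A : V -> 'M[R]_n) (c0 : V -> R).
Hypothesis hA : elliptic Omega A c0.
Local Notation sq := (sqint mu Omega).
Local Notation ipO := (ip mu Omega).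
Local Notation nrmO := (nrm mu Omega).
Variables (yc yd : V -> R) (a b alpha beta : R).
Hypotheses (syc : sq yc) (syd : sq yd).
Hypotheses (a0 : a < 0) (b0 : 0 < b) (alpha_gt0 : 0 < alpha) (beta0 : 0 < beta).
Variables (CS : R) (CS0 : 0 <= CS).
Hypothesis HCS : forall f y g, sq f -> weak_solution Omega A c0 f y g ->
  nrmO y <= CS * nrmO f /\ nrmO (fun x => enorm (g x)) <= CS * nrmO f.
Variable K : seq (n.+1.-tuple V).
Hypothesis fK : forall T : n.+1.-tuple V, T \in K ->
  free [seq x - thead T | x <- behead T].
Hypothesis KO : mesh_domain K `<=` Omega.
Variable phi : V -> V -> R.
Hypothesis hphi : nodal_basis Omega K phi.
Variables (h h0 c1 : R).
Hypotheses (hp : 0 < h) (hh0 : h <= h0) (c1p : 0 < c1).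
Hypothesis dK : forall T, T \in K -> diameter (hull T) <= h.
Local Notation sol := (weak_solution Omega A c0).
Local Notation dsol := (discrete_solution Omega K A c0).
Local Notation Yh := (Yh Omega K).
Hypothesis fe : forall f y g yh, sq f -> sol f y g -> dsol f yh ->
  nrmO (fun x => y x - yh x) + h * nrmO (fun x => enorm (g x - grad_h K yh x)) <=
  c1 * h ^+ 2 * nrmO f.
Implicit Types (f u v y e : V -> R).

Lemma sol_sqint f y g : sol f y g -> sq y.
Proof. by move=> /(weak_solutionP oO hA)[hy _]; have [] := H10_sqint1 oO hy. Qed.

Lemma dsol_Yh f y : dsol f y -> Yh y.
Proof. by move=> /(discrete_solutionP oO bO hA KO)[]. Qed.

(** The error estimate for the zero right-hand side is a uniqueness statement,
    whence existence. *)
Lemma dsol_exists f : sq f -> exists yh, dsol f yh.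
Proof.
apply: (discrete_solution_exists oO bO hA fK KO hphi) => v Yv Hv.
have s0 := sqint0 mu mO.
have dv : dsol (fun=> 0) v.
  apply/(discrete_solutionP oO bO hA KO); split=> // w Yw.
  rewrite Hv// /ip -[LHS](mul0r (fine (mu Omega))) -Rintegral_cst//.
  by apply: eq_Rintegral => x _; rewrite mul0r.
have := fe s0 (weak_solution0 oO hA) dv; rewrite nrm0// mulr0.
rewrite nrm_distC (@eq_nrm _ _ _ mu Omega (fun x => v x - 0) v); last first.
  by move=> x _; rewrite subr0.
move=> le0; apply/eqP; rewrite eq_le nrm_ge0 andbT; apply: le_trans le0.
by rewrite lerDl mulr_ge0 ?nrm_ge0// ltW.
Qed.

(** Bounds the discrete solution operator uniformly in [h], in [L^2] and in [H^1]. *)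
Let CD := CS + c1 * h0 + c1 * h0 ^+ 2.

Lemma fe_state f y g yh : sq f -> sol f y g -> dsol f yh ->
  nrmO (fun x => y x - yh x) <= c1 * h ^+ 2 * nrmO f.
Proof.
move=> sf wy dy; apply: le_trans (fe sf wy dy).
by rewrite lerDl mulr_ge0 ?nrm_ge0// ltW.
Qed.

(** The discrete solution inherits the bounds of the weak solution through the
    error estimate. *)
Lemma dsol_bound f yh : sq f -> dsol f yh ->
  nrmO yh <= CD * nrmO f /\ nrmO (fun x => enorm (grad_h K yh x)) <= CD * nrmO f.
Proof.
move=> sf dy; have [y [g wy]] := weak_solution_exists oO hA i0 OK sf.
have /(weak_solutionP oO hA)[hy _] := wy.
have [sy sg] := H10_sqint1 oO hy.
have Yy := dsol_Yh dy; have syh := Yh_sqint oO bO Yy.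
have sgh := fun i => grad_h_sqint oO bO i Yy.
have [B1 B2] := HCS sf wy; have E := fe sf wy dy.
have F0 := nrm_ge0 mu Omega f; have h00 : 0 <= h0 by apply: le_trans hh0; exact: ltW.
have sE := sqint_enorm oO sg; have sEh := sqint_enorm oO sgh.
have sEd : sq (fun x => enorm (g x - grad_h K yh x)).
  apply: (sqint_enorm oO) => i.
  have := sqintB mO (sg i) (sgh i).
  by congr (sqint _ _ _); apply/funext => x; rewrite !mxE.
have T1 : nrmO yh <= nrmO (fun x => y x - yh x) + nrmO y.
  by rewrite nrm_distC; exact: nrm_le_dist.
have T2 : nrmO (fun x => enorm (grad_h K yh x)) <=
    nrmO (fun x => enorm (g x - grad_h K yh x)) + nrmO (fun x => enorm (g x)).
  apply: le_trans (nrmD mO sEd sE); apply: le_nrm => //; last exact: sqintD.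
  move=> x _; rewrite !ger0_norm ?addr_ge0 ?enorm_ge0//.
  rewrite -(enormN (g x - _)) opprB.
  by apply: le_trans (enormD _ _); rewrite subrK.
have N1 := nrm_ge0 mu Omega (fun x => y x - yh x).
have N2 := nrm_ge0 mu Omega (fun x => enorm (g x - grad_h K yh x)).
move: (nrmO (fun x => y x - yh x)) (nrmO (fun x => enorm (g x - grad_h K yh x)))
  (nrmO y) (nrmO (fun x => enorm (g x))) (nrmO yh)
  (nrmO (fun x => enorm (grad_h K yh x))) (nrmO f) B1 B2 E F0 T1 T2 N1 N2.
move=> d dg ny ng nh ngh F B1 B2 E F0 T1 T2 N1 N2.
have q1 : d <= c1 * h0 ^+ 2 * F.
  apply: (@le_trans _ _ (c1 * h ^+ 2 * F)).
    by apply: le_trans E; rewrite lerDl mulr_ge0// ltW.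
  rewrite ler_wpM2r// ler_wpM2l ?(ltW c1p)// ler_sqr ?nnegrE//; exact: ltW.
have q2 : dg <= c1 * h0 * F.
  apply: (@le_trans _ _ (c1 * h * F)); last first.
    by rewrite ler_wpM2r// ler_wpM2l// ltW.
  rewrite -(ler_pM2l hp); apply: (@le_trans _ _ (c1 * h ^+ 2 * F)); last first.
    by rewrite le_eqVlt; apply/orP; left; apply/eqP; ring.
  by apply: le_trans E; rewrite lerDr.
have r1 : 0 <= c1 * h0 * F by rewrite !mulr_ge0// ltW.
have r2 : 0 <= c1 * h0 ^+ 2 * F by rewrite !mulr_ge0 ?sqr_ge0// ltW.
by rewrite /CD; split; lra.
Qed.

(** [Ub] bounds the admissible controls, [Yb] the residuals [y - y_d] and
    [y_h - y_d]. *)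
Let Ub := nrmO (fun=> Num.max (- a) b).
Let Yb := CD * (Ub + nrmO yc) + nrmO yd.

Variables (y u z yh uh zh : V -> R).
Hypothesis opt : optimal Omega A c0 yc yd a b alpha beta y u z.
Hypothesis opth : optimal_h Omega K phi A c0 yc yd a b alpha beta yh uh zh.

Local Notation pi := (quasi_interp Omega K phi u).
Local Notation B := (lump_err Omega K phi).

Let su : sq u := optimal_sqint oO opt.
Let uab : between Omega a b u := optimal_between opt.
Let Yuh : Yh uh := optimal_h_Yh opth.
Let suh : sq uh := Yh_sqint oO bO Yuh.
Let Ypi : Yh pi := quasi_interp_Yh hphi u.
Let spi : sq pi := Yh_sqint oO bO Ypi.
Let sy : sq y := optimal_state_sqint oO hA opt.
Let Yyh : Yh yh := optimal_h_state_Yh oO bO hA KO opth.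
Let syh : sq yh := Yh_sqint oO bO Yyh.
Let CD0 : 0 <= CD.
Proof.
have h00 : 0 <= h0 by apply: le_trans hh0; exact: ltW.
by rewrite /CD !addr_ge0// !mulr_ge0 ?sqr_ge0// ltW.
Qed.
Let CSD : CS <= CD.
Proof.
have h00 : 0 <= h0 by apply: le_trans hh0; exact: ltW.
have : 0 <= c1 * h0 + c1 * h0 ^+ 2 by rewrite addr_ge0// !mulr_ge0 ?sqr_ge0// ltW.
by rewrite /CD; lra.
Qed.

Lemma rhs_bound v : sq v -> between Omega a b v ->
  nrmO (v \+ yc) <= Ub + nrmO yc.
Proof.
move=> sv vab; apply: le_trans (nrmD mO sv syc) _.
by rewrite lerD2r; exact: nrm_between.
Qed.

Lemma state_residual_bound : nrmO (fun x => y x - yd x) <= Yb.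
Proof.
have [g wy] := optimal_state opt.
apply: le_trans (nrmB mO sy syd) _; rewrite /Yb lerD2r.
apply: le_trans (HCS (sqintD mO su syc) wy).1 _.
by apply: ler_pM => //; [exact: nrm_ge0|exact: rhs_bound].
Qed.

Lemma discrete_residual_bound : nrmO (fun x => yh x - yd x) <= Yb.
Proof.
have dy := optimal_h_state opth.
apply: le_trans (nrmB mO syh syd) _; rewrite /Yb lerD2r.
apply: le_trans (dsol_bound (sqintD mO suh syc) dy).1 _.
by rewrite ler_wpM2l//; apply: rhs_bound => //; exact: (optimal_h_between opth).
Qed.

(** The adjoint state is approximated to second order, so the projection
    formula makes the quasi-interpolant of the control regular. *)
Lemma lump_err_control : B pi pi <= alpha^-1 ^+ 2 * (h ^+ 2 *
  (4 * (c1 ^+ 2 * h0 ^+ 2 * Yb ^+ 2) + 6 * (CD ^+ 2 * Yb ^+ 2))).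
Proof.
have n0 : (0 < n)%N by case: i0 => k; exact: leq_ltn_trans.
have sr := sqintB mO sy syd.
have [p [gp wp]] := weak_solution_exists oO hA i0 OK sr.
have [pt dpt] := dsol_exists sr.
have uS := projection_formula oO bO hA a0 b0 alpha_gt0 beta0 syc syd opt i0 OK wp.
have ai : 0 <= alpha^-1 by rewrite invr_ge0 ltW.
apply: le_trans (lump_err_quasi_interp n0 oO bO fK KO hphi (ltW hp) dK su uab
  ai (shrink_lip a0 b0 alpha_gt0 beta0) (shrink0 a b alpha beta0) uS
  (sol_sqint wp) (dsol_Yh dpt)) _.
rewrite ler_wpM2l ?sqr_ge0//.
have P1 := fe_state sr wp dpt; have [_ P2] := dsol_bound sr dpt.
have P0 := nrm_ge0 mu Omega (fun x => p x - pt x).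
have Q0 := nrm_ge0 mu Omega (fun x => enorm (grad_h K pt x)).
have rb := state_residual_bound; have r0 := nrm_ge0 mu Omega (fun x => y x - yd x).
have h00 : 0 <= h0 by apply: le_trans hh0; exact: ltW.
have Yb0 := le_trans r0 rb.
have e1 : nrmO (fun x => p x - pt x) ^+ 2 <= h ^+ 2 * (c1 ^+ 2 * h0 ^+ 2 * Yb ^+ 2).
  rewrite -!exprMn ler_sqr ?nnegrE ?mulr_ge0 ?(ltW hp) ?(ltW c1p)//.
  apply: le_trans P1 _; rewrite expr2 mulrA [c1 * h]mulrC -!mulrA ler_wpM2l ?(ltW hp)//.
  rewrite ler_wpM2l ?(ltW c1p)//; apply: ler_pM => //; exact: ltW.
have e2 : nrmO (fun x => enorm (grad_h K pt x)) ^+ 2 <= CD ^+ 2 * Yb ^+ 2.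
  rewrite -exprMn ler_sqr ?nnegrE ?mulr_ge0//.
  by apply: le_trans P2 _; rewrite ler_wpM2l.
have e3 := ler_wpM2l (sqr_ge0 h) e2.
by move: e1 e3; move: (nrmO _ ^+ 2) (nrmO _ ^+ 2) => X1 X2; lra.
Qed.

(** In the sum of the continuous inequality tested with the discrete control
    and the discrete one tested with the quasi-interpolant, the costs of the
    controls leave [- alpha |u - u_h|^2] and lumping errors, and the states
    contribute finite element errors and the lumping error at the discrete adjoint
    state [qh]. *)
Lemma control_balance : exists qh,
  [/\ Yh qh, B qh qh <= h ^+ 2 * (CD ^+ 2 * Yb ^+ 2) &
  alpha * nrmO (fun x => u x - uh x) ^+ 2
    + alpha / 2 * (B uh pi + B uh uh) + B qh pi <=
  nrmO (fun x => y x - yd x) * (c1 * h ^+ 2 * nrmO (fun x => u x - uh x))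
    + (c1 * h ^+ 2 * nrmO (u \+ yc)) ^+ 2 / 4].
Proof.
set W := c1 * h ^+ 2 * nrmO (u \+ yc); have n0 : (0 < n)%N by case: i0 => k; exact: leq_ltn_trans.
have sr := sqintB mO sy syd; have srh := sqintB mO syh syd.
have sd := sqintB mO suh su; have spd := sqintB mO spi suh.
have [qh dq] := dsol_exists srh; have Yq := dsol_Yh dq.
exists qh; split=> //.
  apply: le_trans (lump_err_le n0 oO bO fK KO hphi (ltW hp) dK Yq) _.
  rewrite ler_wpM2l ?sqr_ge0// -exprMn ler_sqr ?nnegrE ?nrm_ge0//; last first.
    by rewrite mulr_ge0// (le_trans (nrm_ge0 _ _ _) discrete_residual_bound).
  apply: le_trans (dsol_bound srh dq).2 _.
  by rewrite ler_wpM2l// discrete_residual_bound.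
have uhab := optimal_h_between opth.
have [e [ge we]] := weak_solution_exists oO hA i0 OK sd.
have [w dw] := dsol_exists sd; have Yw := dsol_Yh dw.
have [ed ded] := dsol_exists spd; have Yed := dsol_Yh ded.
have se := sol_sqint we; have sw := Yh_sqint oO bO Yw; have sq_ := Yh_sqint oO bO Yq.
have piab : between Omega a b pi.
  apply: filterS (filterT) => x _ Ox.
  exact: (quasi_interp_bounds oO bO fK KO hphi su a0 b0 uab Ox).
have V1 := continuous_VI oO bO hA beta0 syc syd opt suh uhab we.
have V2 := discrete_VI oO bO hA beta0 fK KO hphi syc syd opth Ypi piab ded.
(* the discrete adjoint state transfers the state term to the controls *)
have ed_q : ipO (fun x => yh x - yd x) ed = - ipO (fun x => yh x - yd x) w - B qh pi.
  have /(discrete_solutionP oO bO hA KO)[_ Hq] := dq.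
  have /(discrete_solutionP oO bO hA KO)[_ Hed] := ded.
  have /(discrete_solutionP oO bO hA KO)[_ Hw] := dw.
  rewrite -Hq// -Hq// !(hformC oO bO hA Yq)// Hed// Hw// (lump_errC _ _ _ qh).
  rewrite /lump_err (lump_quasi_interp oO bO fK KO hphi su uab Yq).
  by rewrite (ipBl mO suh su sq_) (ipBl mO spi suh sq_); ring.
have e_w : ipO (fun x => y x - yd x) e <= ipO (fun x => y x - yd x) w
    + nrmO (fun x => y x - yd x) * (c1 * h ^+ 2 * nrmO (fun x => u x - uh x)).
  rewrite -lerBlDl -(ipBr mO se sw sr).
  apply: le_trans (ler_norm _) _; apply: le_trans (ip_le mO sr (sqintB mO se sw)) _.
  rewrite ler_wpM2l ?nrm_ge0// (nrm_distC mu Omega u).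
  exact: (fe_state sd we dw).
have y_w : ipO (fun x => y x - yd x) w - ipO (fun x => yh x - yd x) w <= W ^+ 2 / 4.
  have [g wy] := optimal_state opt; have suc := sqintD mO su syc.
  have dyt : dsol (u \+ yc) (fun x => yh x - w x).
    have := discrete_solution_lin oO bO hA KO (-1) (sqintD mO suh syc) sd
      (optimal_h_state opth) dw.
    by congr (dsol _ _); apply/funext => x /=; ring.
  have := fe_state suc wy dyt; rewrite -/W.
  set f := fun x => y x - (yh x - w x) => fW.
  have sf : sq f by exact: (sqintB mO sy (sqintB mO syh sw)).
  have -> : ipO (fun x => y x - yd x) w - ipO (fun x => yh x - yd x) w = ipO f w - ipO w w.
    rewrite -(ipBl mO sr srh sw) -(ipBl mO sf sw sw).
    by apply: eq_ip => // x _; rewrite /f; ring.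
  have f2 : nrmO f ^+ 2 <= W ^+ 2.
    by rewrite ler_sqr ?nnegrE ?nrm_ge0// (le_trans (nrm_ge0 _ _ _) fW).
  rewrite nrm_sq in f2.
  (* completing the square in (f, w) - |w|^2 *)
  have := ip_ge0 mu Omega (fun x => f x + -2 * w x).
  by rewrite (ip_segment mO)//; lra.
have L1a := quasi_interp_L1 oO bO fK KO hphi su uab.
have L1b : \int[mu]_(x in Omega) `|uh x| <=
    \sum_(q <- nodes K) `|uh q| * mass Omega phi q.
  exact: (Yh_L1_le oO bO fK KO hphi Yuh).
rewrite ed_q in V2.
have luh : lump Omega K phi uh pi = ipO u uh.
  by rewrite lumpC (lump_quasi_interp oO bO fK KO hphi su uab Yuh).
have L2 : lump Omega K phi uh (fun x => pi x - uh x) = ipO u uh - lump Omega K phi uh uh.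
  have -> : (fun x => pi x - uh x) = (fun x => pi x + -1 * uh x) by apply/funext => x; ring.
  by rewrite lumpC lump_lin lumpC luh; ring.
rewrite L2 (ipBr mO suh su su) (ipBr mO spi suh suh) in V1 V2.
rewrite nrm_sq (ipBl mO su suh (sqintB mO su suh)) !(ipBr mO su suh)// (ipC mu Omega uh u).
rewrite /lump_err luh; rewrite /lump_err in V2.
have := ler_wpM2l (ltW beta0) (lerD L1a L1b).
move: V1 V2 e_w y_w.
move: (\int[mu]_(x in Omega) `|u x|) (\int[mu]_(x in Omega) `|uh x|)
  (\sum_(q <- _) _) (\sum_(q <- _) _) => I1 I2 I3 I4.
lra.
Qed.

Lemma control_error alpha0 : alpha <= alpha0 ->
  nrmO (fun x => u x - uh x) ^+ 2 <= (alpha^-1 * h) ^+ 2 *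
    (2 * (5 / 8 * (4 * (c1 ^+ 2 * h0 ^+ 2 * Yb ^+ 2) + 6 * (CD ^+ 2 * Yb ^+ 2))
      + CD ^+ 2 * Yb ^+ 2 / 2 + c1 ^+ 2 * h0 ^+ 2 * Yb ^+ 2 / 2
      + c1 ^+ 2 * h0 ^+ 2 * alpha0 * (Ub + nrmO yc) ^+ 2 / 4)).
Proof.
move=> ala; have [qh [Yq bq main]] := control_balance.
have sq_ := Yh_sqint oO bO Yq.
apply: (error_balance alpha_gt0 ala hp hh0 (ltW c1p) (nrm_ge0 _ _ _)
  state_residual_bound (nrm_ge0 _ _ _) (rhs_bound su uab) _ _ lump_err_control bq
  (nrm_ge0 _ _ _) _ (lexx _) main).
- have := lump_err_ge0 oO bO fK KO hphi (Yh_lin (1 / 2) Yuh Ypi).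
  by rewrite (lump_err_segment oO)//; lra.
- have := lump_err_ge0 oO bO fK KO hphi (Yh_lin alpha Yq Ypi).
  by rewrite (lump_err_segment oO).
- by rewrite !mulr_ge0 ?sqr_ge0 ?nrm_ge0// ltW.
Qed.

End error_bound.

Lemma diameter_le_mesh_size (R : realType) (n : nat) (K : seq (n.+1.-tuple 'rV[R]_n)) T :
  T \in K -> diameter (hull T) <= mesh_size K.
Proof. by move=> TK; exact: (@le_bigmax_seq _ _ _ _ 0 T xpredT (fun T => diameter (hull T)) TK). Qed.

(** The estimate splits the right-hand side into two summands: here the second
    one is zero. *)
Lemma fe_estimate_nrm (R : realType) (n : nat) (Omega : set 'rV[R]_n)
    (A : 'rV[R]_n -> 'M[R]_n) (c0 : 'rV[R]_n -> R) c1 H Th h :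
  open Omega -> bounded_set Omega -> elliptic Omega A c0 ->
  fe_estimate Omega A c0 c1 H Th -> H h -> mesh_domain (Th h) `<=` Omega ->
  forall f y g yh, sqint (lebesgue_rV R n) Omega f ->
    weak_solution Omega A c0 f y g -> discrete_solution Omega (Th h) A c0 f yh ->
  nrm (lebesgue_rV R n) Omega (fun x => y x - yh x)
    + h * nrm (lebesgue_rV R n) Omega (fun x => enorm (g x - grad_h (Th h) yh x)) <=
  c1 * h ^+ 2 * nrm (lebesgue_rV R n) Omega f.
Proof.
move=> oO bO hA fe Hh KO f y g yh sf wy dy; have mO := open_measurable_rV oO.
have s0 : sqint (lebesgue_rV R n) Omega (fun=> 0) := sqint0 _ mO.
have f0 : f \+ (fun=> 0) = f by apply/funext => x /=; rewrite addr0.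
have := fe h Hh f (fun=> 0) y g yh; rewrite f0 => /(_ _ _ wy dy).
have Yy : Yh Omega (Th h) yh by have /(discrete_solutionP oO bO hA KO)[] := dy.
have /(weak_solutionP oO hA)[hy _] := wy; have [sy sg] := H10_sqint1 oO hy.
have syh := Yh_sqint oO bO Yy.
have sEd : sqint (lebesgue_rV R n) Omega (fun x => enorm (g x - grad_h (Th h) yh x)).
  apply: (sqint_enorm oO) => i.
  have := sqintB mO (sg i) (grad_h_sqint oO bO i Yy).
  by congr (sqint _ _ _); apply/funext => x; rewrite !mxE.
rewrite (L2normE mO sf) (L2normE mO s0) (L2normE mO sEd).
rewrite (L2normE mO (sqintB mO sy syh)) nrm0// addr0; apply.
- exact/(L2P mO).
- exact/(L2P mO).
Qed.

Theorem corollary1 (R : realType) (n : nat) (hn : n = 2%N \/ n = 3%N)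
    (Omega : set 'rV[R]_n) (hOmega : convex_domain Omega)
    (hbd : C11_boundary Omega \/ polyhedral Omega)
    (A : 'rV[R]_n -> 'M[R]_n) (c0 : 'rV[R]_n -> R)
    (hA : elliptic Omega A c0)
    (yc yd : 'rV[R]_n -> R) (hyc : L2 Omega yc) (hyd : L2 Omega yd)
    (a b beta : R) (ha : a < 0) (hb : 0 < b) (hbeta : 0 < beta)
    (kappa tau c c1 : R) (hkappa : 0 < kappa) (htau : 0 < tau) (hc1 : 0 < c1)
    (h0 alpha0 : R) (hh0 : 0 < h0) (halpha0 : 0 < alpha0) :
  exists2 C : R, 0 < C &
    forall (H : set R) (Th : R -> seq (n.+1.-tuple 'rV[R]_n)),
    mesh_family Omega kappa tau c H Th ->
    fe_estimate Omega A c0 c1 H Th ->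
    forall alpha h : R, 0 < alpha <= alpha0 -> H h -> h <= h0 ->
    forall (phi : 'rV[R]_n -> 'rV[R]_n -> R) (y u z yh uh zh : 'rV[R]_n -> R),
    nodal_basis Omega (Th h) phi ->
    optimal Omega A c0 yc yd a b alpha beta y u z ->
    optimal_h Omega (Th h) phi A c0 yc yd a b alpha beta yh uh zh ->
    L2norm Omega (u \- uh) <=
      C * (alpha^-1 * h + alpha `^ (- (3 / 2)) * h ^+ 2).
Proof.
have n0 : (0 < n)%N by case: hn => ->.
pose i0 := Ordinal n0.
have oO := domain_open hOmega; have bO := domain_bounded hOmega.
have mO := open_measurable_rV oO.
have [Kb Kb0 OK] : exists2 Kb, 0 <= Kb & forall x, Omega x -> `|x| <= Kb.
  by have [Kb /ltW Kb0 OK] := pinfty_ex_gt0 bO; exists Kb.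
have [CS CS0 HCS] := weak_solution_bound oO hA i0 OK Kb0.
move/(L2P mO): hyc => syc; move/(L2P mO): hyd => syd.
pose nrmO := nrm (lebesgue_rV R n) Omega.
pose CD := CS + c1 * h0 + c1 * h0 ^+ 2.
pose Ub := nrmO (fun=> Num.max (- a) b).
pose Yb := CD * (Ub + nrmO yc) + nrmO yd.
pose Q := 2 * (5 / 8 * (4 * (c1 ^+ 2 * h0 ^+ 2 * Yb ^+ 2) + 6 * (CD ^+ 2 * Yb ^+ 2))
  + CD ^+ 2 * Yb ^+ 2 / 2 + c1 ^+ 2 * h0 ^+ 2 * Yb ^+ 2 / 2
  + c1 ^+ 2 * h0 ^+ 2 * alpha0 * (Ub + nrmO yc) ^+ 2 / 4).
exists (Num.sqrt `|Q| + 1); first by rewrite ltr_wpDl ?sqrtr_ge0.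
move=> H Th mesh fe alpha h /andP[al0 ala] Hh hh0' phi y u z yh uh zh hphi opt opth.
have hp := mesh_size_gt0 mesh Hh; have KO := mesh_sub mesh Hh.
have [fK _] := mesh_triangulation mesh Hh.
have dK T : T \in Th h -> diameter (hull T) <= h.
  by move=> /diameter_le_mesh_size; rewrite (mesh_sizeE mesh Hh).
have fe' := fe_estimate_nrm oO bO hA fe Hh KO.
have := control_error i0 oO bO OK hA syc syd ha hb al0 hbeta CS0 HCS fK KO hphi
  hp hh0' hc1 dK fe' opt opth ala.
rewrite -/nrmO -/CD -/Ub -/Yb -/Q => E2.
have su := optimal_sqint oO opt; have suh := Yh_sqint oO bO (optimal_h_Yh opth).
rewrite (L2normE mO (sqintB mO su suh)) -/nrmO.
have ah : 0 <= alpha^-1 * h by rewrite mulr_ge0 ?invr_ge0// ltW.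
apply: (@le_trans _ _ (Num.sqrt `|Q| * (alpha^-1 * h))).
  have s0 := mulr_ge0 (sqrtr_ge0 `|Q|) ah.
  rewrite -(@ler_pXn2r _ 2)// ?nnegrE ?nrm_ge0//.
  rewrite exprMn (sqr_sqrtr (normr_ge0 Q)) mulrC; apply: le_trans E2 _.
  by rewrite ler_wpM2l ?sqr_ge0// ler_norm.
have p0 : 0 <= alpha `^ (- (3 / 2)) * h ^+ 2 by rewrite mulr_ge0 ?powR_ge0 ?sqr_ge0.
by apply: ler_pM; rewrite ?sqrtr_ge0// ?lerDl.
Qed.
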